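(* Let $M^2$ be a smooth timelike surface in $\mathbb{R}^4_1$ with zero mean curvature, free of flat points. Then $M^2$ locally admits canonical parameters; that is, every point of $M^2$ has a neighbourhood in $M^2$ which admits a parametrization $z=z(u,v)$ by canonical parameters $(u,v)$.
   Context: $\mathbb{R}^4_1$ is Minkowski 4-space, i.e. $\mathbb{R}^4$ with the flat metric $\langle\,,\rangle = dx_1^2+dx_2^2+dx_3^2-dx_4^2$. A surface $M^2\subset\mathbb{R}^4_1$ is timelike if the induced metric has signature $(1,1)$; the normal planes are then positive definite. $\sigma$ denotes the second fundamental tensor (the normal component of the flat connection: $\nabla'_XY=\nabla_XY+\sigma(X,Y)$). The mean curvature vector is $H=\frac12(-\sigma(x,x)+\sigma(y,y))$ for an orthonormal tangent frame with $\langle x,x\rangle=-1$, $\langle y,y\rangle=1$; ''zero mean curvature'' means $H=0$ at every point. Flat points: for a local parametrization $z(u,v)$ and an orthonormal normal frame $\{e_1,e_2\}$ put $c_{11}^k=\langle z_{uu},e_k\rangle$, $c_{12}^k=\langle z_{uv},e_k\rangle$, $c_{22}^k=\langle z_{vv},e_k\rangle$ and $\Delta_1=c_{11}^1c_{12}^2-c_{12}^1c_{11}^2$, $\Delta_2=c_{11}^1c_{22}^2-c_{22}^1c_{11}^2$, $\Delta_3=c_{12}^1c_{22}^2-c_{22}^1c_{12}^2$. The surface is free of flat points if $(\Delta_1,\Delta_2,\Delta_3)\neq(0,0,0)$ at each point (equivalently, the vectors $\sigma(X,Y)$, $X,Y\in T_pM^2$, span the normal plane at each $p$). Geometric frame: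 on a timelike surface with $H=0$ free of flat points there is, at each point, an orthonormal frame $\{x,y,n_1,n_2\}$ ($x,y$ tangent, $\langle x,x\rangle=-1$, $\langle y,y\rangle=1$; $n_1,n_2$ normal) such that $$\sigma(x,x)=\nu\,n_1,\qquad \sigma(x,y)=\mu\,n_2,\qquad \sigma(y,y)=\nu\,n_1,$$ with $\nu\mu\neq0$; the directions of $x$ and $y$ (called the canonical directions) are uniquely determined, and the frame is called the geometric frame field. The functions $\nu,\mu$ are called the geometric functions (they are determined up to signs coming from the choice of signs of the frame vectors; $\mu^2+\nu^2$ is well defined). Parameters $(u,v)$ are semi-canonical if the parametric lines are integral lines of the canonical directions. Semi-canonical parameters $(u,v)$ are called canonical if the coefficients $E=\langle z_u,z_u\rangle$, $F=\langle z_u,z_v\rangle$, $G=\langle z_v,z_v\rangle$ of the first fundamental form satisfy $$E=-\frac{1}{\sqrt{\mu^2+\nu^2}},\qquad F=0,\qquad G=\frac{1}{\sqrt{\mu^2+\nu^2}}.$$ *)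

(* Defs.v *)
From HB Require Import structures.
From mathcomp Require Import all_boot all_order all_algebra.
From mathcomp Require Import all_classical all_reals all_analysis.

Set Implicit Arguments.
Unset Strict Implicit.
Unset Printing Implicit Defensive.

Import Order.TTheory GRing.Theory Num.Theory.
Import numFieldNormedType.Exports.

Local Open Scope classical_set_scope.
Local Open Scope ring_scope.

Section Minkowski.
Context {R : realType}.

Definition mink (X Y : 'rV[R]_4) : R :=
  \sum_(i < 4 | i != ord_max) X 0 i * Y 0 i - X 0 ord_max * Y 0 ord_max.

End Minkowski.

Section Smoothness.
Context {R : realType} {V : normedModType R}.

Definition du (f : 'rV[R]_2 -> V) : 'rV[R]_2 -> V := 'D_(delta_mx 0 0) f.
Definition dv (f : 'rV[R]_2 -> V) : 'rV[R]_2 -> V := 'D_(delta_mx 0 1) f.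

Fixpoint Ck_on (k : nat) (U : set 'rV[R]_2) (f : 'rV[R]_2 -> V) : Prop :=
  {in U, continuous f} /\
  if k is k'.+1 then
    [/\ forall q, U q -> derivable f q (delta_mx 0 0),
        forall q, U q -> derivable f q (delta_mx 0 1),
        Ck_on k' U (du f) & Ck_on k' U (dv f)]
  else True.

Definition smooth_on (U : set 'rV[R]_2) (f : 'rV[R]_2 -> V) : Prop :=
  forall k, Ck_on k U f.

End Smoothness.

(* Local theory of a parametrized surface [w : 'rV_2 -> 'rV_4] at a parameter
   point [q].  The tangent vector at [q] with coordinates [a : 'rV_2] is
   ['D_a w q = a 0 0 *: du w q + a 0 1 *: dv w q], and tangent vectors are
   given by their coordinates below. *)
Section LocalTheory.
Context {R : realType}.
Variables (w : 'rV[R]_2 -> 'rV[R]_4) (q : 'rV[R]_2).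

Definition regular_at : Prop := forall a : 'rV[R]_2, 'D_a w q = 0 -> a = 0.

Definition tangent_vector (X : 'rV[R]_4) : Prop := exists a, X = 'D_a w q.

Definition normal_vector (N : 'rV[R]_4) : Prop :=
  forall a, mink N ('D_a w q) = 0.

Definition coefE : R := mink (du w q) (du w q).
Definition coefF : R := mink (du w q) (dv w q).
Definition coefG : R := mink (dv w q) (dv w q).

Definition orthonormal_tangent (a b : 'rV[R]_2) : Prop :=
  [/\ mink ('D_a w q) ('D_a w q) = -1,
      mink ('D_b w q) ('D_b w q) = 1
    & mink ('D_a w q) ('D_b w q) = 0].

Definition orthonormal_normal (e1 e2 : 'rV[R]_4) : Prop :=
  normal_vector e1 /\ normal_vector e2 /\
  [/\ mink e1 e1 = 1, mink e2 e2 = 1 & mink e1 e2 = 0].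

(* At a regular point the tangent plane is 2-dimensional, so such a pair is a
   basis in which the induced metric is diag(-1, 1). *)
Definition timelike_at : Prop := exists a b, orthonormal_tangent a b.

(* The vector with coordinates [b] is extended to the tangent field
   ['D_b w] with constant coordinates, whose flat derivative along the vector
   with coordinates [a] is ['D_a ('D_b w)]; [sigma a b] is the normal component
   of the latter, which exists and is unique where the tangent plane is
   nondegenerate, in particular at timelike points. *)
Definition sigma (a b : 'rV[R]_2) : 'rV[R]_4 :=
  get [set S | normal_vector S /\ tangent_vector ('D_a ('D_b w) q - S)].

Definition zero_mean_curvature_at : Prop :=
  forall a b, orthonormal_tangent a b ->
    2^-1 *: (- sigma a a + sigma b b) = 0.

Definition c11 (e : 'rV[R]_4) : R := mink (du (du w) q) e.
Definition c12 (e : 'rV[R]_4) : R := mink (dv (du w) q) e.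
Definition c22 (e : 'rV[R]_4) : R := mink (dv (dv w) q) e.

Definition Delta1 (e1 e2 : 'rV[R]_4) : R := c11 e1 * c12 e2 - c12 e1 * c11 e2.
Definition Delta2 (e1 e2 : 'rV[R]_4) : R := c11 e1 * c22 e2 - c22 e1 * c11 e2.
Definition Delta3 (e1 e2 : 'rV[R]_4) : R := c12 e1 * c22 e2 - c22 e1 * c12 e2.

(* A change of orthonormal normal frame multiplies the Delta_i by a common
   sign. *)
Definition flat_point : Prop :=
  exists e1 e2, orthonormal_normal e1 e2 /\
    (Delta1 e1 e2, Delta2 e1 e2, Delta3 e1 e2) = (0, 0, 0).

Definition geometric_frame (a b : 'rV[R]_2) (n1 n2 : 'rV[R]_4) (nu mu : R) :
    Prop :=
  orthonormal_tangent a b /\ orthonormal_normal n1 n2 /\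
  [/\ sigma a a = nu *: n1, sigma a b = mu *: n2, sigma b b = nu *: n1
    & nu * mu != 0].

End LocalTheory.

Section CanonicalCoordinates.
Context {R : realType}.
Variables (U : set 'rV[R]_2) (w : 'rV[R]_2 -> 'rV[R]_4).

Definition semi_canonical : Prop :=
  forall q, U q -> exists a b n1 n2 nu mu,
    [/\ geometric_frame w q a b n1 n2 nu mu,
        exists l, du w q = l *: 'D_a w q
      & exists l, dv w q = l *: 'D_b w q].

Definition canonical_parameters : Prop :=
  semi_canonical /\
  forall q, U q -> exists a b n1 n2 nu mu,
    geometric_frame w q a b n1 n2 nu mu /\
    [/\ coefE w q = - (Num.sqrt (mu ^+ 2 + nu ^+ 2))^-1,
        coefF w q = 0
      & coefG w q = (Num.sqrt (mu ^+ 2 + nu ^+ 2))^-1].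

End CanonicalCoordinates.

(* A surface is a topological 2-manifold [M] with a smooth immersion [z] into
   R^4_1; an embedded surface [M] in R^4_1 is the case where [z] is the
   inclusion of a subset carrying the subspace topology.  The smooth structure
   of [M] need not be given separately: the transition map between two
   parametrizations as below is automatically smooth, as it is continuous and
   the maps [z \o phi] are smooth immersions. *)
Section Surface.
Context {R : realType} {M : topologicalType}.
Variable z : M -> 'rV[R]_4.

Definition local_parametrization (U : set 'rV[R]_2) (phi : 'rV[R]_2 -> M) :
    Prop :=
  [/\ open U,
      {in U, continuous phi} /\ set_inj U phi,
      forall V, V `<=` U -> open V -> open (phi @` V),
      smooth_on U (z \o phi)
    & forall q, U q -> regular_at (z \o phi) q].

Definition smooth_surface : Prop :=
  [/\ hausdorff_space M, @second_countable M
    & forall p, exists U phi, local_parametrization U phi /\ (phi @` U) p].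

Definition timelike : Prop :=
  forall U phi, local_parametrization U phi ->
    forall q, U q -> timelike_at (z \o phi) q.

Definition zero_mean_curvature : Prop :=
  forall U phi, local_parametrization U phi ->
    forall q, U q -> zero_mean_curvature_at (z \o phi) q.

Definition free_of_flat_points : Prop :=
  forall U phi, local_parametrization U phi ->
    forall q, U q -> ~ flat_point (z \o phi) q.

End Surface.

(* Main.v *)
(* A surface with H = 0 carries two families of null directions.  If r1, r2 are
   the roots of E r^2 - 2 F r + G = 0, the tangent vectors split as
   w_x = a + b and w_y = r1 a + r2 b with a, b null; in null coordinates s, t
   one has w = alpha(s) + beta(t), and a, b are multiples of alpha', beta'.
   Without solving for s: H = 0 gives a_y = (r1 a)_x, whence D = <a_x, a_x>
   satisfies D_y = 4 D (r1)_x + r1 D_x, so that with p = (4 D)^(1/4) the form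
   p dx + r1 p dy is closed.  Here D > 0 because there are no flat points.  A
   primitive s is the null coordinate for which <alpha'', alpha''> = 1/4; let t
   be the analogue for b.  In the coordinates u = (s + t) / 2, v = (s - t) / 2
   (inverse function theorem) the normal components P, Q of alpha'', beta''
   have the same length 1/2, so sigma(w_u, w_u) = sigma(w_v, w_v) = P + Q is
   orthogonal to sigma(w_u, w_v) = P - Q, and mu^2 + nu^2 = 1 / E^2. *)
Require Import Defs.
From HB Require Import structures.
From mathcomp Require Import all_boot all_order all_algebra.
From mathcomp Require Import all_classical all_reals all_analysis.
From mathcomp Require Import ring lra.

Set Implicit Arguments.
Unset Strict Implicit.
Unset Printing Implicit Defensive.

Import Order.TTheory GRing.Theory Num.Theory.
Import numFieldNormedType.Exports.

Local Open Scope classical_set_scope.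
Local Open Scope ring_scope.

(** * Differential calculus in the parameter plane *)

Section Lines.
Context {R : realType}.

(** The canonical condition fixes the constant 1/4. With w_u = alpha' + beta' and w_v = alpha' -
    beta' one has F = 0 and -E = G = h, where h = -2 <alpha', beta'>, whatever the scale of s and t.
    Orthogonality of P + Q and P - Q forces |P| = |Q|. Since mu^2 + nu^2 = (|P + Q|^2 + |P - Q|^2) /
    h^2 = 2 (|P|^2 + |Q|^2) / h^2, the requirement mu^2 + nu^2 = 1 / h^2 then forces |P|^2 = |Q|^2 =
    1/4. The sign <alpha', beta'> < 0 makes u, rather than v, the timelike parameter. Solving for
    r1, r2 divides by E, which may vanish in the given parameters. A linear change of parameters
    makes E < 0 at the point, and shrinking keeps it so nearby. The curves alpha and beta are never
    constructed: it suffices that the gradient of a / p is proportional to that of s. Timelikeness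
    and absence of flat points are hypotheses on every local parametrization; once the new map is
    shown to be one, they apply to it directly, which replaces a proof of invariance under
    reparametrization. *)

Lemma is_derive_line (V W : normedModType R) (f : V -> W) (p v : V) (t : R) :
  derivable f (p + t *: v) v ->
  is_derive t 1 (fun s => f (p + s *: v)) ('D_v f (p + t *: v)).
Proof.
have E : (fun h : R => h^-1 *: (((fun s : R => f (p + s *: v)) \o shift t) (h *: 1)
    - f (p + t *: v))) =
  (fun h : R => h^-1 *: ((f \o shift (p + t *: v)) (h *: v) - f (p + t *: v))).
  rewrite funeqE => h /=; congr (_ *: (f _ - _)).
  by rewrite [h *: 1]mulr1 scalerDl addrCA.
by move=> df; split; rewrite /derivable /derive E.
Qed.

(** The segment is run through by a parameter in [0, 1] and the length [h] is kept as a factor, so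
    that [h] may have either sign. *)
Lemma mvt_line (V : normedModType R) (f : V -> R) (p v : V) (h : R) :
  (forall s, 0 <= s <= 1 -> derivable f (p + (s * h) *: v) v) ->
  exists2 c, 0 <= c <= 1 &
    f (p + h *: v) - f p = h * 'D_v f (p + (c * h) *: v).
Proof.
move=> df; pose g (s : R) := f (p + (s * h) *: v).
have dg (s : R) : 0 <= s <= 1 -> is_derive s 1 g (h * 'D_v f (p + (s * h) *: v)).
  move=> s01; have H := is_derive_line (df s s01).
  have dM : is_derive s 1 (fun s : R => s * h) h.
    have := @is_deriveZ R R R id h s 1 1 (is_derive_id _ _).
    rewrite [h *: 1]mulr1.
    by rewrite (_ : h \*: id = (fun s => s * h)) // funeqE => y; exact: mulrC.
  have := @is_derive1_comp R (fun s => f (p + s *: v)) (fun s : R => s * h) s _ _ H dM.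
  by rewrite mulrC.
have cg : {within `[0, 1], continuous g}.
  apply: derivable_within_continuous => s; rewrite in_itv /= => s01.
  by have [] := dg s s01.
have dg' (x : R) : x \in `]0, 1[ -> is_derive x 1 g (h * 'D_v f (p + (x * h) *: v)).
  by rewrite in_itv /= => /andP[x0 x1]; apply: dg; rewrite !ltW.
have [c c01] := @MVT_segment R g _ 0 1 ler01 dg' cg.
rewrite /g !mul1r mul0r scale0r addr0 subr0 mulr1 => E.
by exists c.
Qed.

Local Notation e0 := (delta_mx 0 0 : 'rV[R]_2).
Local Notation e1 := (delta_mx 0 1 : 'rV[R]_2).

Lemma row2E (x : 'rV[R]_2) : x = x 0 0 *: e0 + x 0 1 *: e1.
Proof.
by rewrite [LHS]row_sum_delta !big_ord_recl big_ord0 addr0; do 3 f_equal; apply/val_inj.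
Qed.

Lemma row2P (x y : 'rV[R]_2) : x 0 0 = y 0 0 -> x 0 1 = y 0 1 -> x = y.
Proof. by move=> h0 h1; rewrite (row2E x) (row2E y) h0 h1. Qed.

Lemma ball_row2 (q x : 'rV[R]_2) r :
  ball q r x <-> `|q 0 0 - x 0 0| < r /\ `|q 0 1 - x 0 1| < r.
Proof.
split=> [[r0 H]|[H0 H1]]; first by split; exact: H.
split=> [|i j]; first exact: le_lt_trans H0.
rewrite ord1; case: j => [[|[|//]] j]; rewrite /ball /=.
  by rewrite (_ : Ordinal j = 0) //; exact/val_inj.
by rewrite (_ : Ordinal j = 1) //; exact/val_inj.
Qed.

Lemma ball_segment (q x y r s : R) : 0 <= s <= 1 -> `|q - x| < r ->
  `|q - y| < r -> `|q - (x + s * (y - x))| < r.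
Proof.
move=> /andP[s0 s1]; rewrite !ltr_norml => /andP[a1 a2] /andP[b1 b2].
by case: (leP s 2^-1) => s2; apply/andP; split; nra.
Qed.

(** The points [x] and [y] are joined by a horizontal and a vertical segment meeting at [m]; both
    stay in the ball, which is a square. Each segment has its own intermediate point, which is
    harmless because only bounds valid on the whole ball are applied to them. *)
Lemma mvt2 (f : 'rV[R]_2 -> R) (q x y : 'rV[R]_2) r :
  ball q r x -> ball q r y ->
  (forall p, ball q r p -> derivable f p e0) ->
  (forall p, ball q r p -> derivable f p e1) ->
  exists xi eta, [/\ ball q r xi, ball q r eta &
    f y - f x = (y 0 0 - x 0 0) * du f xi + (y 0 1 - x 0 1) * dv f eta].
Proof.
move=> /ball_row2[x0 x1] /ball_row2[y0 y1] d0 d1.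
pose m := x + (y 0 0 - x 0 0) *: e0.
have B0 s : 0 <= s <= 1 -> ball q r (x + (s * (y 0 0 - x 0 0)) *: e0).
  move=> s01; apply/ball_row2; rewrite !mxE /= !mulr1 !mulr0 !addr0; split=> //.
  exact: ball_segment.
have B1 s : 0 <= s <= 1 -> ball q r (m + (s * (y 0 1 - x 0 1)) *: e1).
  move=> s01; apply/ball_row2; rewrite !mxE /= !mulr1 !mulr0 !addr0; split=> //.
    by rewrite addrC subrK.
  exact: ball_segment.
have [s s01 Es] := mvt_line (fun s s01 => d0 _ (B0 s s01)).
have [t t01 Et] := mvt_line (fun s s01 => d1 _ (B1 s s01)).
exists (x + (s * (y 0 0 - x 0 0)) *: e0), (m + (t * (y 0 1 - x 0 1)) *: e1).
split; [exact: B0|exact: B1|].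
rewrite /du /dv -Es -Et -/m [RHS]addrC subrKA; congr (f _ - _).
by apply: row2P; rewrite !mxE /=; ring.
Qed.

End Lines.

(** * Differentiability from continuous partial derivatives, and symmetry of mixed derivatives *)

Section C1.
Context {R : realType}.
Local Notation e0 := (delta_mx 0 0 : 'rV[R]_2).
Local Notation e1 := (delta_mx 0 1 : 'rV[R]_2).

Lemma coord_norm_le (h : 'rV[R]_2) i : `|h 0 i| <= `|h|.
Proof.
rewrite [leRHS]/Num.Def.normr/= mx_normrE.
exact: (le_bigmax _ (fun ij : 'I_1 * 'I_2 => `|h ij.1 ij.2|) (0, i)).
Qed.

Lemma continuous_near_le (V : normedModType R) (g : V -> R) (q : V) (e : R) :
  {for q, continuous g} -> 0 < e -> \forall p \near q, `|g q - g p| <= e.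
Proof. by move=> cg e0; move/cvgrPdist_le : cg; apply. Qed.

Lemma norm_comb2_le (a b c d e n : R) : `|a| <= n -> `|b| <= n ->
  `|c| <= e / 2 -> `|d| <= e / 2 -> `|a * c + b * d| <= e * n.
Proof.
move=> an bn ce de; apply: le_trans (ler_normD _ _) _; rewrite !normrM.
have := ler_pM (normr_ge0 _) (normr_ge0 _) an ce.
have := ler_pM (normr_ge0 _) (normr_ge0 _) bn de.
lra.
Qed.

Lemma dist_le_halves (x y z z' e : R) : `|x - z| <= e / 2 ->
  `|y - z'| <= e / 2 -> z = z' -> `|x - y| <= e.
Proof.
move=> xz yz zz; rewrite -zz distrC in yz.
by rewrite -(subrKA z) (le_trans (ler_normD _ _)) // [e]splitr lerD.
Qed.

(** The increment is split by [mvt2]; near [q] each partial derivative differs from its value at [q]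
    by at most half of the tolerance. *)
Lemma C1_differentiable (f : 'rV[R]_2 -> R) (q : 'rV[R]_2) :
  (\forall p \near q, derivable f p e0) -> (\forall p \near q, derivable f p e1) ->
  {for q, continuous (du f)} -> {for q, continuous (dv f)} ->
  differentiable f q.
Proof.
move=> d0 d1 c0 c1.
pose L (h : 'rV[R]_2) : R := h 0 0 * du f q + h 0 1 * dv f q.
have Llin : linear L by move=> k x y; rewrite /L !mxE /GRing.scale /=; ring.
pose LM := GRing.isLinear.Build _ _ _ _ _ Llin.
pose Lf : {linear 'rV[R]_2 -> R} := HB.pack L LM.
have Lc : continuous Lf.
  move=> x; apply: (@continuousD _ _ _ (fun h : 'rV[R]_2 => h 0 0 * du f q) (fun h => h 0 1 * dv f q)).
    exact: (cvgM (@coord_continuous _ 1 2 0 0 x) (cvg_cst _)).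
  exact: (cvgM (@coord_continuous _ 1 2 0 1 x) (cvg_cst _)).
have Hexp : f \o shift q = cst (f q) + Lf +o_ (0 : 'rV[R]_2) id.
  apply/eqaddoP => _/posnumP[eps].
  have e2 : 0 < eps%:num / 2 by rewrite divr_gt0.
  have {}c0 := continuous_near_le c0 e2.
  have {}c1 := continuous_near_le c1 e2.
  have /nbhs_ballP[r /= r0 Hr] : \forall p \near q, [/\ derivable f p e0, derivable f p e1,
     `|du f q - du f p| <= eps%:num / 2 & `|dv f q - dv f p| <= eps%:num / 2].
    apply: filterS (filterI (filterI d0 d1) (filterI c0 c1)) => p [[a1 a2] [a3 a4]].
    exact: And4 a1 a2 a3 a4.
  have : \forall h \near (0 : 'rV[R]_2), ball 0 r h by apply: nbhsx_ballx.
  apply: filterS => h hr.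
  have hq : ball q r (h + q).
    by move/ball_row2 : hr; rewrite !mxE => -[a b]; apply/ball_row2; rewrite !mxE;
     split; [move: a|move: b]; rewrite !sub0r opprD addrCA subrr addr0.
  have [xi [eta [/Hr[_ _ H1 _] /Hr[_ _ _ H2] E]]] := @mvt2 R f q q (h + q) r
     (ballxx _ r0) hq (fun p H => let: And4 a _ _ _ := Hr p H in a)
     (fun p H => let: And4 _ a _ _ := Hr p H in a).
  rewrite /= !fctE /= /L.
  rewrite (_ : _ - _ = h 0 0 * (du f xi - du f q) + h 0 1 * (dv f eta - dv f q)); last first.
    move: E; rewrite !mxE !addrK => E; rewrite opprD addrA E; ring.
  have {}H1 : `|du f xi - du f q| <= eps%:num / 2 by rewrite distrC.
  have {}H2 : `|dv f eta - dv f q| <= eps%:num / 2 by rewrite distrC.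
  exact: (norm_comb2_le (coord_norm_le h 0) (coord_norm_le h 1) H1 H2).
have dE := diff_unique Lc Hexp.
by apply/diff_locallyP; rewrite dE.
Unshelve. all: by end_near. Qed.

(** The second difference of [f] over a small square with corner [q] is evaluated in both orders by
    the mean value theorem. It equals h^2 times one mixed derivative at one point of the square and
    h^2 times the other at another point; on the square both are within e / 2 of their values at
    [q]. *)
Lemma Schwarz (f : 'rV[R]_2 -> R) (q : 'rV[R]_2) :
  (\forall p \near q, derivable f p e0) -> (\forall p \near q, derivable f p e1) ->
  (\forall p \near q, derivable (du f) p e1) -> (\forall p \near q, derivable (dv f) p e0) ->
  {for q, continuous (dv (du f))} -> {for q, continuous (du (dv f))} ->
  dv (du f) q = du (dv f) q.
Proof.
move=> d0 d1 d01 d10 c01 c10.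
apply/eqP; rewrite -subr_eq0 -normr_le0; apply/ler_addgt0Pl => e e_gt0.
rewrite addr0.
have e2 : 0 < e / 2 by rewrite divr_gt0.
have {}c01 := continuous_near_le c01 e2.
have {}c10 := continuous_near_le c10 e2.
have /nbhs_ballP[r /= r0 Hr] : \forall p \near q, [/\ derivable f p e0 /\ derivable f p e1,
     derivable (du f) p e1, derivable (dv f) p e0,
     `|dv (du f) q - dv (du f) p| <= e / 2 & `|du (dv f) q - du (dv f) p| <= e / 2].
  apply: filterS (filterI (filterI (filterI d0 d1) (filterI d01 d10)) (filterI c01 c10)).
  by move=> p [[[a1 a2] [a3 a4]] [a5 a6]]; exact: And5 (conj a1 a2) a3 a4 a5 a6.
(* Half the radius keeps the closed square with corner [q] and side [h] inside the ball. *)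
pose h := r / 2.
have h0 : 0 < h by rewrite divr_gt0.
have hr : h < r by rewrite /h; lra.
pose P s t := q + (s * h) *: e0 + (t * h) *: e1.
have B s t : 0 <= s <= 1 -> 0 <= t <= 1 -> ball q r (P s t).
  move=> /andP[s0 s1] /andP[t0 t1]; apply/ball_row2; rewrite !mxE /= !mulr1 !mulr0 !addr0.
  have a0 : 0 <= s * h by rewrite mulr_ge0 // ltW.
  have b0 : 0 <= t * h by rewrite mulr_ge0 // ltW.
  rewrite !opprD !addrA !subrr !sub0r !normrN (ger0_norm a0) (ger0_norm b0).
  by split; nra.
have m01 : 0 <= (0 : R) <= 1 by rewrite lexx ler01.
have m11 : 0 <= (1 : R) <= 1 by rewrite lexx ler01.
pose g0 p := f (p + h *: e1) - f p.
pose g1 p := f (p + h *: e0) - f p.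
have dsh (g : 'rV[R]_2 -> R) (p v w : 'rV[R]_2) : derivable g (p + w) v ->
   is_derive p v (fun p => g (p + w)) ('D_v g (p + w)).
  have E : (fun k : R => k^-1 *: (((fun p => g (p + w)) \o shift p) (k *: v) - g (p + w))) =
     (fun k : R => k^-1 *: ((g \o shift (p + w)) (k *: v) - g (p + w))).
    by rewrite funeqE => k /=; rewrite addrA.
  by move=> dg; split; rewrite /derivable /derive E.
have P1E (s : R) : P s 0 + h *: e1 = P s 1 by rewrite /P mul0r scale0r addr0 mul1r.
have P2E (t : R) : P 0 t + h *: e0 = P 1 t by rewrite /P mul0r scale0r addr0 mul1r addrAC.
have P3E (s t : R) : P 0 t + (s * h) *: e0 = P s t by rewrite /P mul0r scale0r addr0 addrAC.
have P4E (s t : R) : P s 0 + (t * h) *: e1 = P s t by rewrite /P mul0r scale0r addr0.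
clearbody P.
have H0 p : ball q r p -> derivable f p e0 by move=> /Hr[[]].
have H1 p : ball q r p -> derivable f p e1 by move=> /Hr[[]].
have dg0 (s : R) : 0 <= s <= 1 ->
    is_derive (P s 0) e0 g0 (du f (P s 1) - du f (P s 0)).
  move=> s01; rewrite -(P1E s); apply: is_deriveB.
    by apply: dsh; rewrite P1E; exact: H0 (B s 1 s01 m11).
  exact: derivableP (H0 _ (B s 0 s01 m01)).
have dg1 (t : R) : 0 <= t <= 1 ->
    is_derive (P 0 t) e1 g1 (dv f (P 1 t) - dv f (P 0 t)).
  move=> t01; rewrite -(P2E t); apply: is_deriveB.
    by apply: dsh; rewrite P2E; exact: H1 (B 1 t m11 t01).
  exact: derivableP (H1 _ (B 0 t m01 t01)).
have [|s s01] := @mvt_line R _ g0 (P 0 0) e0 h.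
  by move=> s s01; rewrite P3E; exact: (@ex_derive _ _ _ _ _ _ _ (dg0 s s01)).
rewrite P3E (derive_val (is_derive := dg0 s s01)) P2E.
have [|t t01] := @mvt_line R _ (du f) (P s 0) e1 h.
  by move=> t t01; rewrite P4E; have [_ D _ _ _] := Hr _ (B s t s01 t01); exact: D.
rewrite P1E => -> E0.
have [|t' t'01] := @mvt_line R _ g1 (P 0 0) e1 h.
  by move=> t' t'01; rewrite P4E; exact: (@ex_derive _ _ _ _ _ _ _ (dg1 t' t'01)).
rewrite P4E (derive_val (is_derive := dg1 t' t'01)) P1E.
have [|s' s'01] := @mvt_line R _ (dv f) (P 0 t') e0 h.
  by move=> s' s'01; rewrite P3E; have [_ _ D _ _] := Hr _ (B s' t' s'01 t'01); exact: D.
rewrite P2E => -> E1.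
have E : dv (du f) (P s t) = du (dv f) (P s' t').
  (* Both sides are the same alternating sum of [f] over the four corners. *)
  have : g0 (P 1 0) - g0 (P 0 0) = g1 (P 0 1) - g1 (P 0 0).
    by rewrite /g0 /g1 !P1E !P2E; ring.
  have hn0 : h != 0 by rewrite gt_eqF.
  by rewrite E0 E1 (P4E s t) (P3E s' t') => /(mulfI hn0) /(mulfI hn0).
have [_ _ _ a _] := Hr _ (B s t s01 t01).
have [_ _ _ _ b] := Hr _ (B s' t' s'01 t'01).
exact: (dist_le_halves a b E).
Qed.

End C1.

(** * Closure properties of the classes [Ck_on] *)

Section Ck.
Context {R : realType}.
Local Notation e0 := (delta_mx 0 0 : 'rV[R]_2).
Local Notation e1 := (delta_mx 0 1 : 'rV[R]_2).
Local Notation plane := 'rV[R]_2.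
Implicit Types (U W : set plane) (k : nat).

Lemma near_open U (q : plane) : open U -> U q -> \forall p \near q, U p.
Proof. by move=> oU Uq; exact: open_nbhs_nbhs. Qed.

Lemma continuous_near_eq (V : normedModType R) (f g : plane -> V) (q : plane) :
  (\forall p \near q, f p = g p) -> {for q, continuous f} -> {for q, continuous g}.
Proof.
move=> fg cf; rewrite /prop_for /continuous_at -(nbhs_singleton fg).
by apply: cvg_trans cf; apply: (near_eq_cvg fg).
Qed.

Lemma Ck_continuous (V : normedModType R) k U (f : plane -> V) q :
  Ck_on k U f -> U q -> {for q, continuous f}.
Proof. case: k => [|k] [cf _] Uq; apply: cf; rewrite inE; exact: Uq. Qed.

Lemma Ck_derivable0 (V : normedModType R) k U (f : plane -> V) q :
  Ck_on k.+1 U f -> U q -> derivable f q e0.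
Proof. move=> [_ [H _ _ _]]; exact: H. Qed.

Lemma Ck_derivable1 (V : normedModType R) k U (f : plane -> V) q :
  Ck_on k.+1 U f -> U q -> derivable f q e1.
Proof. move=> [_ [_ H _ _]]; exact: H. Qed.

Lemma Ck_du (V : normedModType R) k U (f : plane -> V) :
  Ck_on k.+1 U f -> Ck_on k U (du f).
Proof. move=> [_ [_ _ H _]]; exact: H. Qed.

Lemma Ck_dv (V : normedModType R) k U (f : plane -> V) :
  Ck_on k.+1 U f -> Ck_on k U (dv f).
Proof. move=> [_ [_ _ _ H]]; exact: H. Qed.

Lemma CkS (V : normedModType R) k U (f : plane -> V) :
  (forall q, U q -> {for q, continuous f}) ->
  (forall q, U q -> derivable f q e0) -> (forall q, U q -> derivable f q e1) ->
  Ck_on k U (du f) -> Ck_on k U (dv f) -> Ck_on k.+1 U f.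
Proof.
move=> cf d0 d1 k0 k1; split; last exact: And4 d0 d1 k0 k1.
move=> q; rewrite inE; exact: cf.
Qed.

Lemma C0P (V : normedModType R) U (f : plane -> V) :
  (forall q, U q -> {for q, continuous f}) -> Ck_on 0 U f.
Proof. move=> cf; apply: conj I => q; rewrite inE; exact: cf. Qed.

Lemma Ck_le1 (V : normedModType R) k U (f : plane -> V) :
  Ck_on k.+1 U f -> Ck_on k U f.
Proof.
elim: k f => [|k IH] f [cf [d0 d1 k0 k1]]; first exact: conj cf I.
exact: conj cf (And4 d0 d1 (IH _ k0) (IH _ k1)).
Qed.

Lemma Ck_sub (V : normedModType R) k U W (f : plane -> V) :
  W `<=` U -> Ck_on k U f -> Ck_on k W f.
Proof.
move=> WU; elim: k f => [|k IH] f Hf.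
  apply: C0P => q /WU; exact: Ck_continuous Hf.
apply: CkS => [q /WU|q /WU|q /WU||].
- exact: Ck_continuous Hf.
- exact: Ck_derivable0 Hf.
- exact: Ck_derivable1 Hf.
- exact: IH _ (Ck_du Hf).
- exact: IH _ (Ck_dv Hf).
Qed.

Lemma Ck_congr (V : normedModType R) k U (f g : plane -> V) : open U ->
  (forall q, U q -> f q = g q) -> Ck_on k U f -> Ck_on k U g.
Proof.
move=> oU; elim: k f g => [|k IH] f g fg Hf.
  apply: C0P => q Uq; apply: continuous_near_eq (Ck_continuous Hf Uq).
  apply: filterS (near_open oU Uq) => p; exact: fg.
have nfg q : U q -> \forall p \near q, f p = g p.
  move=> Uq; apply: filterS (near_open oU Uq) => p; exact: fg.
apply: CkS.
- move=> q Uq; apply: continuous_near_eq (nfg q Uq) (Ck_continuous Hf Uq).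
- move=> q Uq; apply: near_eq_derivable (nfg q Uq) (Ck_derivable0 Hf Uq).
- move=> q Uq; apply: near_eq_derivable (nfg q Uq) (Ck_derivable1 Hf Uq).
- apply: IH (Ck_du Hf) => q Uq; exact: near_eq_derive (nfg q Uq).
- apply: IH (Ck_dv Hf) => q Uq; exact: near_eq_derive (nfg q Uq).
Qed.

Lemma Ck_cst (V : normedModType R) k U (c : V) : Ck_on k U (fun=> c).
Proof.
elim: k c => [|k IH] c.
  apply: C0P => q _; exact: cst_continuous.
have E v : 'D_v (fun _ : plane => c) = fun=> 0.
  by rewrite funeqE => q; exact: derive_cst.
apply: CkS => [q _|q _|q _||]; [exact: cst_continuous|exact: derivable_cst|exact: derivable_cst|..].
- by rewrite /du E; exact: IH.
- by rewrite /dv E; exact: IH.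
Qed.

Lemma CkD (V : normedModType R) k U (f g : plane -> V) : open U ->
  Ck_on k U f -> Ck_on k U g -> Ck_on k U (fun q => f q + g q).
Proof.
move=> oU; elim: k f g => [|k IH] f g Hf Hg.
  apply: C0P => q Uq; apply: continuousD; [exact: Ck_continuous Hf Uq|exact: Ck_continuous Hg Uq].
apply: CkS => [q Uq|q Uq|q Uq||].
- apply: continuousD; [exact: Ck_continuous Hf Uq|exact: Ck_continuous Hg Uq].
- exact: derivableD (Ck_derivable0 Hf Uq) (Ck_derivable0 Hg Uq).
- exact: derivableD (Ck_derivable1 Hf Uq) (Ck_derivable1 Hg Uq).
- apply: Ck_congr oU _ (IH _ _ (Ck_du Hf) (Ck_du Hg)) => q Uq.
  by rewrite [RHS](deriveD (Ck_derivable0 Hf Uq) (Ck_derivable0 Hg Uq)).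
- apply: Ck_congr oU _ (IH _ _ (Ck_dv Hf) (Ck_dv Hg)) => q Uq.
  by rewrite [RHS](deriveD (Ck_derivable1 Hf Uq) (Ck_derivable1 Hg Uq)).
Qed.

Lemma CkM k U (f g : plane -> R) : open U ->
  Ck_on k U f -> Ck_on k U g -> Ck_on k U (fun q => f q * g q).
Proof.
move=> oU; elim: k f g => [|k IH] f g Hf Hg.
  apply: C0P => q Uq; apply: continuousM; [exact: Ck_continuous Hf Uq|exact: Ck_continuous Hg Uq].
apply: CkS => [q Uq|q Uq|q Uq||].
- apply: continuousM; [exact: Ck_continuous Hf Uq|exact: Ck_continuous Hg Uq].
- exact: derivableM (Ck_derivable0 Hf Uq) (Ck_derivable0 Hg Uq).
- exact: derivableM (Ck_derivable1 Hf Uq) (Ck_derivable1 Hg Uq).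
- apply: Ck_congr oU _ (CkD oU (IH _ _ (Ck_le1 Hf) (Ck_du Hg)) (IH _ _ (Ck_le1 Hg) (Ck_du Hf))) => q Uq.
  by rewrite [RHS](deriveM (Ck_derivable0 Hf Uq) (Ck_derivable0 Hg Uq)).
- apply: Ck_congr oU _ (CkD oU (IH _ _ (Ck_le1 Hf) (Ck_dv Hg)) (IH _ _ (Ck_le1 Hg) (Ck_dv Hf))) => q Uq.
  by rewrite [RHS](deriveM (Ck_derivable1 Hf Uq) (Ck_derivable1 Hg Uq)).
Qed.

Lemma CkN k U (f : plane -> R) : open U ->
  Ck_on k U f -> Ck_on k U (fun q => - f q).
Proof.
move=> oU Hf; apply: Ck_congr oU _ (CkM oU (Ck_cst k U (-1 : R)) Hf) => q _.
by rewrite mulN1r.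
Qed.

Lemma CkB k U (f g : plane -> R) : open U ->
  Ck_on k U f -> Ck_on k U g -> Ck_on k U (fun q => f q - g q).
Proof. by move=> oU Hf Hg; apply: CkD => //; exact: CkN. Qed.

(** The derivative of 1 / f is -(1 / f)^2 times that of f, so the induction hypothesis is applied to
    1 / f itself at order k. [Ck_sqrt] follows the same pattern. *)
Lemma CkV k U (f : plane -> R) : open U -> (forall q, U q -> f q != 0) ->
  Ck_on k U f -> Ck_on k U (fun q => (f q)^-1).
Proof.
move=> oU f0; elim: k => [|k IH] Hf.
  apply: C0P => q Uq; apply: continuousV; [exact: f0|exact: Ck_continuous Hf Uq].
have Hi := IH (Ck_le1 Hf); have Hi2 := CkN oU (CkM oU Hi Hi).
apply: CkS => [q Uq|q Uq|q Uq||].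
- apply: continuousV; [exact: f0|exact: Ck_continuous Hf Uq].
- exact: derivableV (f0 _ Uq) (Ck_derivable0 Hf Uq).
- exact: derivableV (f0 _ Uq) (Ck_derivable1 Hf Uq).
- apply: Ck_congr oU _ (CkM oU Hi2 (Ck_du Hf)) => q Uq.
  by rewrite [RHS](deriveV (f0 _ Uq) (Ck_derivable0 Hf Uq)) -exprVn expr2.
- apply: Ck_congr oU _ (CkM oU Hi2 (Ck_dv Hf)) => q Uq.
  by rewrite [RHS](deriveV (f0 _ Uq) (Ck_derivable1 Hf Uq)) -exprVn expr2.
Qed.

Lemma Ck_div k U (f g : plane -> R) : open U -> (forall q, U q -> g q != 0) ->
  Ck_on k U f -> Ck_on k U g -> Ck_on k U (fun q => f q / g q).
Proof. by move=> oU g0 Hf Hg; apply: CkM => //; exact: CkV. Qed.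

(** Only a directional derivative of [g] is assumed. Restriction to the line through [q] along [v]
    turns [g] into a function of one real variable, for which derivability is differentiability and
    the usual chain rule applies. *)
Lemma is_derive_comp_diff (X V' W' : normedModType R) (f : V' -> W') (g : X -> V') (q v : X) :
  differentiable f (g q) -> derivable g q v ->
  is_derive q v (f \o g) ('d f (g q) ('D_v g q)).
Proof.
move=> df dg.
have E (Z : normedModType R) (h : X -> Z) : (fun t : R => t^-1 *: ((h \o shift q) (t *: v) - h q)) =
    (fun t : R => t^-1 *: (((fun s : R => h (s *: v + q)) \o shift 0) (t *: 1) - h (0 *: v + q))).
  by rewrite funeqE => t /=; rewrite addr0 scale0r add0r [t *: 1]mulr1.
pose g1 (s : R) := g (s *: v + q).
have g10 : g1 0 = g q by rewrite /g1 scale0r add0r.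
have dg1 : differentiable g1 0.
  exact: (proj1 (derivable1_diffP _ _) (proj1 (derivable1P _ _ _) dg)).
have df1 : differentiable f (g1 0) by rewrite g10.
have dfg : differentiable (f \o g1) 0 by exact: differentiable_comp.
split.
  exact: (proj2 (derivable1P _ _ _) (proj2 (derivable1_diffP _ _) dfg)).
transitivity ('D_1 (f \o g1) 0); first by rewrite /derive E.
rewrite deriveE // (diff_comp dg1 df1) /= g10; congr ('d f (g q) _).
by rewrite -deriveE // /derive [in RHS]E.
Qed.

Lemma derive_dir (V : normedModType R) (f : plane -> V) (q a : plane) :
  differentiable f q -> 'D_a f q = a 0 0 *: du f q + a 0 1 *: dv f q.
Proof.
move=> df; rewrite /du /dv !deriveE // {1}(row2E a).
by rewrite linearD !linearZ.
Qed.

Lemma C1_differentiableR U (f : plane -> R) k q : open U -> Ck_on k.+1 U f -> U q ->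
  differentiable f q.
Proof.
move=> oU Hf Uq; apply: C1_differentiable.
- apply: filterS (near_open oU Uq) => p; exact: Ck_derivable0 Hf.
- apply: filterS (near_open oU Uq) => p; exact: Ck_derivable1 Hf.
- exact: Ck_continuous (Ck_du Hf) Uq.
- exact: Ck_continuous (Ck_dv Hf) Uq.
Qed.

(** The coordinates of [g] enter as separate hypotheses because the chain rule differentiates them
    one by one; [Ck_comp_row] obtains these hypotheses from the regularity of [g]. *)
Lemma Ck_comp k U W (f : plane -> R) (g : plane -> plane) : open U -> open W ->
  (forall q, W q -> U (g q)) -> Ck_on k U f -> Ck_on k W g ->
  (forall i, Ck_on k W (fun q => g q 0 i)) -> Ck_on k W (f \o g).
Proof.
move=> oU oW WU; elim: k f => [|k IH] f Hf Hg Hgi.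
  apply: C0P => q Wq; apply: continuous_comp; first exact: Ck_continuous Hg Wq.
  exact: Ck_continuous Hf (WU _ Wq).
have D q v : W q -> derivable g q v -> is_derive q v (f \o g)
   ('D_v (fun p => g p 0 0) q * du f (g q) + 'D_v (fun p => g p 0 1) q * dv f (g q)).
  move=> Wq dg; have df := C1_differentiableR oU Hf (WU _ Wq).
  have := is_derive_comp_diff df dg; rewrite -deriveE // derive_dir //.
  by rewrite derive_mx // !mxE.
apply: CkS => [q Wq|q Wq|q Wq||].
- apply: continuous_comp; first exact: Ck_continuous Hg Wq.
  exact: Ck_continuous Hf (WU _ Wq).
- exact: (@ex_derive _ _ _ _ _ _ _ (D q _ Wq (Ck_derivable0 Hg Wq))).
- exact: (@ex_derive _ _ _ _ _ _ _ (D q _ Wq (Ck_derivable1 Hg Wq))).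
- have H := IH _ (Ck_du Hf) (Ck_le1 Hg) (fun i => Ck_le1 (Hgi i)).
  have H' := IH _ (Ck_dv Hf) (Ck_le1 Hg) (fun i => Ck_le1 (Hgi i)).
  apply: Ck_congr oW _ (CkD oW (CkM oW (Ck_du (Hgi 0)) H) (CkM oW (Ck_du (Hgi 1)) H')) => q Wq.
  by rewrite [RHS](@derive_val _ _ _ _ _ _ _ (D q _ Wq (Ck_derivable0 Hg Wq))).
- have H := IH _ (Ck_du Hf) (Ck_le1 Hg) (fun i => Ck_le1 (Hgi i)).
  have H' := IH _ (Ck_dv Hf) (Ck_le1 Hg) (fun i => Ck_le1 (Hgi i)).
  apply: Ck_congr oW _ (CkD oW (CkM oW (Ck_dv (Hgi 0)) H) (CkM oW (Ck_dv (Hgi 1)) H')) => q Wq.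
  by rewrite [RHS](@derive_val _ _ _ _ _ _ _ (D q _ Wq (Ck_derivable1 Hg Wq))).
Qed.

End Ck.

(** * Square roots, vector-valued maps and the Minkowski product *)

Section CkV.
Context {R : realType}.
Local Notation e0 := (delta_mx 0 0 : 'rV[R]_2).
Local Notation e1 := (delta_mx 0 1 : 'rV[R]_2).
Local Notation plane := 'rV[R]_2.
Implicit Types (U W : set plane) (k : nat).

Lemma is_derive_sqrt_comp (V : normedModType R) (f : V -> R) (q v : V) :
  0 < f q -> derivable f q v ->
  is_derive q v (fun p => Num.sqrt (f p)) ('D_v f q * (2 * Num.sqrt (f q))^-1).
Proof.
move=> f0 df; have [ds Ds] := is_derive1_sqrt f0.
have dfs : differentiable (@Num.sqrt R) (f q) by apply/derivable1_diffP.
have H := is_derive_comp_diff dfs df.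
have E : 'd (@Num.sqrt R) (f q) ('D_v f q) = 'D_v f q * (2 * Num.sqrt (f q))^-1.
  rewrite -[in LHS](mulr1 ('D_v f q)) [X in 'd _ _ X]/('D_v f q *: 1) linearZ.
  by rewrite -deriveE // Ds.
by rewrite -E.
Qed.

Lemma Ck_sqrt k U (f : plane -> R) : open U -> (forall q, U q -> 0 < f q) ->
  Ck_on k U f -> Ck_on k U (fun q => Num.sqrt (f q)).
Proof.
move=> oU f0; elim: k => [|k IH] Hf.
  apply: C0P => q Uq; apply: continuous_comp; first exact: Ck_continuous Hf Uq.
  exact: sqrt_continuous.
have Hs := IH (Ck_le1 Hf).
have s0 q : U q -> 2 * Num.sqrt (f q) != 0.
  by move=> Uq; rewrite mulf_neq0 // gt_eqF // sqrtr_gt0 f0.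
have Hi := CkV oU s0 (CkM oU (Ck_cst k U (2 : R)) Hs).
apply: CkS => [q Uq|q Uq|q Uq||].
- apply: continuous_comp; first exact: Ck_continuous Hf Uq.
  exact: sqrt_continuous.
- exact: (@ex_derive _ _ _ _ _ _ _ (is_derive_sqrt_comp (f0 _ Uq) (Ck_derivable0 Hf Uq))).
- exact: (@ex_derive _ _ _ _ _ _ _ (is_derive_sqrt_comp (f0 _ Uq) (Ck_derivable1 Hf Uq))).
- apply: Ck_congr oU _ (CkM oU (Ck_du Hf) Hi) => q Uq.
  by rewrite [RHS](@derive_val _ _ _ _ _ _ _ (is_derive_sqrt_comp (f0 _ Uq) (Ck_derivable0 Hf Uq))).
- apply: Ck_congr oU _ (CkM oU (Ck_dv Hf) Hi) => q Uq.
  by rewrite [RHS](@derive_val _ _ _ _ _ _ _ (is_derive_sqrt_comp (f0 _ Uq) (Ck_derivable1 Hf Uq))).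
Qed.

Lemma continuous_row (T : topologicalType) n (f : T -> 'rV[R]_n) (q : T) :
  (forall i, {for q, continuous (fun p => f p 0 i)}) -> {for q, continuous f}.
Proof.
move=> cf.
have -> : f = \sum_(i < n) (fun p => f p 0 i *: (delta_mx 0 i : 'rV[R]_n)).
  by rewrite funeqE => p; rewrite fct_sumE; exact: row_sum_delta.
apply: (big_ind (fun g : T -> 'rV[R]_n => {for q, continuous g})).
- exact: cst_continuous.
- move=> g h; exact: continuousD.
- move=> i _; apply: continuousZr_tmp; exact: cf.
Qed.

Lemma derivable_row (V : normedModType R) n (f : V -> 'rV[R]_n) (q v : V) :
  (forall i, derivable (fun p => f p 0 i) q v) -> derivable f q v.
Proof. move=> df; apply/derivable_mxP => i j; rewrite ord1; exact: df. Qed.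

Lemma derivable_coord (V : normedModType R) n (f : V -> 'rV[R]_n) (q v : V) i :
  derivable f q v -> derivable (fun p => f p 0 i) q v.
Proof. move=> /derivable_mxP df; exact: df. Qed.

Lemma derive_coord (V : normedModType R) n (f : V -> 'rV[R]_n) (q v : V) i :
  derivable f q v -> ('D_v f q) 0 i = 'D_v (fun p => f p 0 i) q.
Proof. by move=> df; rewrite derive_mx // mxE. Qed.

Lemma Ck_row n k U (f : plane -> 'rV[R]_n) : open U ->
  (forall i, Ck_on k U (fun q => f q 0 i)) -> Ck_on k U f.
Proof.
move=> oU; elim: k f => [|k IH] f Hf.
  apply: C0P => q Uq; apply: continuous_row => i; exact: Ck_continuous (Hf i) Uq.
have d0 q : U q -> derivable f q e0.
  move=> Uq; apply: derivable_row => i; exact: Ck_derivable0 (Hf i) Uq.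
have d1 q : U q -> derivable f q e1.
  move=> Uq; apply: derivable_row => i; exact: Ck_derivable1 (Hf i) Uq.
apply: CkS => [q Uq|q Uq|q Uq||].
- apply: continuous_row => i; exact: Ck_continuous (Hf i) Uq.
- exact: d0.
- exact: d1.
- apply: IH => i; apply: Ck_congr oU _ (Ck_du (Hf i)) => q Uq.
  by rewrite [RHS]derive_coord //; exact: d0.
- apply: IH => i; apply: Ck_congr oU _ (Ck_dv (Hf i)) => q Uq.
  by rewrite [RHS]derive_coord //; exact: d1.
Qed.

Lemma Ck_coord n k U (f : plane -> 'rV[R]_n) i : open U ->
  Ck_on k U f -> Ck_on k U (fun q => f q 0 i).
Proof.
move=> oU; elim: k f => [|k IH] f Hf.
  apply: C0P => q Uq; apply: (@continuous_comp _ _ _ f (fun x : 'rV[R]_n => x 0 i)).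
    exact: Ck_continuous Hf Uq.
  exact: coord_continuous.
apply: CkS => [q Uq|q Uq|q Uq||].
- apply: (@continuous_comp _ _ _ f (fun x : 'rV[R]_n => x 0 i)).
    exact: Ck_continuous Hf Uq.
  exact: coord_continuous.
- exact: derivable_coord (Ck_derivable0 Hf Uq).
- exact: derivable_coord (Ck_derivable1 Hf Uq).
- apply: Ck_congr oU _ (IH _ (Ck_du Hf)) => q Uq.
  exact: derive_coord (Ck_derivable0 Hf Uq).
- apply: Ck_congr oU _ (IH _ (Ck_dv Hf)) => q Uq.
  exact: derive_coord (Ck_derivable1 Hf Uq).
Qed.

Lemma differentiable_row (V : normedModType R) n (f : V -> 'rV[R]_n) (q : V) :
  (forall i, differentiable (fun p => f p 0 i) q) -> differentiable f q.
Proof.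
move=> df.
have -> : f = \sum_(i < n) (fun p => f p 0 i *: (delta_mx 0 i : 'rV[R]_n)).
  by rewrite funeqE => p; rewrite fct_sumE; exact: row_sum_delta.
apply: differentiable_sum => i; apply: differentiableZl; exact: df.
Qed.

Lemma Ck_differentiable n k U (f : plane -> 'rV[R]_n) q : open U ->
  Ck_on k.+1 U f -> U q -> differentiable f q.
Proof.
move=> oU Hf Uq; apply: differentiable_row => i.
exact: C1_differentiableR oU (Ck_coord i oU Hf) Uq.
Qed.

Lemma Ck_comp_row n k U W (f : plane -> 'rV[R]_n) (g : plane -> plane) :
  open U -> open W -> (forall q, W q -> U (g q)) ->
  Ck_on k U f -> Ck_on k W g -> Ck_on k W (f \o g).
Proof.
move=> oU oW WU Hf Hg; apply: (Ck_row oW) => i.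
apply: (@Ck_comp _ k U W (fun p => f p 0 i) g oU oW WU _ Hg).
  exact: Ck_coord.
by move=> j; exact: Ck_coord.
Qed.

Lemma Ck_sum k U n (h : 'I_n -> plane -> R) : open U ->
  (forall i, Ck_on k U (h i)) -> Ck_on k U (fun q => \sum_(i < n) h i q).
Proof.
move=> oU; elim: n h => [|n IH] h Hh.
  by under eq_fun do rewrite big_ord0; exact: Ck_cst.
under eq_fun do rewrite big_ord_recl.
by apply: CkD => //; exact: IH.
Qed.

Lemma CkZ n k U (f : plane -> R) (g : plane -> 'rV[R]_n) : open U ->
  Ck_on k U f -> Ck_on k U g -> Ck_on k U (fun q => f q *: g q).
Proof.
move=> oU Hf Hg; apply: (Ck_row oU) => i; under eq_fun do rewrite mxE.
by apply: CkM => //; exact: Ck_coord.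
Qed.

Lemma is_derive_scale (V : normedModType R) n (f : V -> R) (g : V -> 'rV[R]_n) (q v : V) :
  derivable f q v -> derivable g q v ->
  is_derive q v (fun p => f p *: g p) ('D_v f q *: g q + f q *: 'D_v g q).
Proof.
move=> df dg.
have D i : is_derive q v (fun p => (f p *: g p) 0 i) (f q * ('D_v g q) 0 i + g q 0 i * 'D_v f q).
  have -> : (fun p => (f p *: g p) 0 i) = (fun p => f p * g p 0 i).
    by rewrite funeqE => p; rewrite mxE.
  rewrite (derive_coord i dg).
  have H := is_deriveM (derivableP df) (derivableP (derivable_coord (i:=i) dg)).
  exact H.
have dfg : derivable (fun p => f p *: g p) q v.
  apply: derivable_row => i; exact: (@ex_derive _ _ _ _ _ _ _ (D i)).
split; first exact: dfg.
apply/rowP => i; rewrite (derive_coord i dfg).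
by rewrite (@derive_val _ _ _ _ _ _ _ (D i)) !mxE addrC [_ * 'D_v f q]mulrC.
Qed.

Lemma minkE (X Y : 'rV[R]_4) :
  mink X Y = \sum_(i < 4) (if i == ord_max then -1 else 1) * (X 0 i * Y 0 i).
Proof.
rewrite /mink [in RHS](bigD1 ord_max) //= mulN1r addrC; congr (_ + _).
by apply: eq_bigr => i /negbTE ->; rewrite mul1r.
Qed.

Lemma is_derive_mink (V : normedModType R) (f g : V -> 'rV[R]_4) (q v : V) :
  derivable f q v -> derivable g q v ->
  is_derive q v (fun p => mink (f p) (g p)) (mink ('D_v f q) (g q) + mink (f q) ('D_v g q)).
Proof.
move=> df dg.
pose h (i : 'I_4) (p : V) : R := (if i == ord_max then -1 else 1) * (f p 0 i * g p 0 i).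
have D i : is_derive q v (h i) ((if i == ord_max then -1 else 1) *
   (f q 0 i * ('D_v g q) 0 i + g q 0 i * ('D_v f q) 0 i)).
  rewrite (derive_coord i df) (derive_coord i dg); apply: is_deriveZ.
  have H := is_deriveM (derivableP (derivable_coord (i:=i) df)) (derivableP (derivable_coord (i:=i) dg)).
  exact H.
have := is_derive_sum D.
have -> : \sum_(i < 4) h i = (fun p => mink (f p) (g p)).
  by rewrite funeqE => p; rewrite minkE fct_sumE.
suff -> : \sum_(i < 4) (if i == ord_max then -1 else 1) *
   (f q 0 i * ('D_v g q) 0 i + g q 0 i * ('D_v f q) 0 i) =
   mink ('D_v f q) (g q) + mink (f q) ('D_v g q) by [].
rewrite !minkE -big_split /=; apply: eq_bigr => i _.
by rewrite -mulrDr addrC [g q 0 i * _]mulrC.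
Qed.

Lemma Ck_mink k U (f g : plane -> 'rV[R]_4) : open U ->
  Ck_on k U f -> Ck_on k U g -> Ck_on k U (fun q => mink (f q) (g q)).
Proof.
move=> oU Hf Hg; under eq_fun do rewrite minkE.
apply: (Ck_sum oU) => i; apply: (CkM oU); first exact: Ck_cst.
by apply: (CkM oU); exact: Ck_coord.
Qed.

End CkV.

(** * Local primitives of closed 1-forms *)

Section Poincare.
Context {R : realType}.
Local Notation e0 := (delta_mx 0 0 : 'rV[R]_2).
Local Notation e1 := (delta_mx 0 1 : 'rV[R]_2).
Local Notation plane := 'rV[R]_2.

(** The fundamental theorem is applied on the segment from c - r / 2 to c + r / 2, which lies in the
    domain of continuity; hence the halved radius. Subtracting the value at [c] moves the base point
    there. *)
Lemma primitive_ball (f : R -> R) (c r : R) : 0 < r ->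
  (forall x, `|x - c| < r -> {for x, continuous f}) ->
  exists2 F : R -> R, F c = 0 &
    forall x, `|x - c| < r / 2 -> is_derive x 1 F (f x).
Proof.
move=> r0 cf; pose a := c - r / 2; pose u := c + r / 2.
have ca : {within `[a, u], continuous f}.
  apply: continuous_in_subspaceT => x; rewrite inE /= in_itv /= => /andP[ax xu].
  apply: cf; rewrite ltr_norml; move: ax xu; rewrite /a /u => ax xu.
  by apply/andP; split; lra.
have fi : lebesgue_measure.-integrable `[a, u] (EFin \o f).
  exact: continuous_compact_integrable (@segment_compact _ _ _) ca.
pose F x := (\int[lebesgue_measure]_(t in [set` `[a, x]]) (f t))%R.
exists (fun x => F x - F c); first by rewrite subrr.
move=> x xc.
have /andP[ax xu] : a < x < u.
  by move: xc; rewrite ltr_norml /a /u => /andP[? ?]; apply/andP; split; lra.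
have cx : {for x, continuous f} by apply: cf; lra.
have [dF EF] := continuous_FTC1_closed xu fi ax cx.
have H : is_derive x 1 F (f x) by split; [exact: dF|rewrite -derive1E].
have H2 := is_deriveB H (is_derive_cst (F c) x 1).
rewrite subr0 in H2; exact H2.
Qed.

Lemma is_derive_along (V W : normedModType R) (f : V -> W) (p v : V) (d : W) :
  is_derive (0 : R) (1 : R) (fun s : R => f (p + s *: v)) d -> is_derive p v f d.
Proof.
have E : (fun h : R => h^-1 *: (((fun s : R => f (p + s *: v)) \o shift 0) (h *: 1)
    - f (p + 0 *: v))) =
  (fun h : R => h^-1 *: ((f \o shift p) (h *: v) - f p)).
  rewrite funeqE => h /=; congr (_ *: (f _ - f _)).
    by rewrite [h *: 1]mulr1 addr0 addrC.
  by rewrite scale0r addr0.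
by case=> df Df; split; [move: df|rewrite -Df]; rewrite /derivable /derive E.
Qed.

Lemma is_derive_quadratic (g : R -> R) (C : R) :
  (\forall h \near (0 : R), `|g h| <= C * h ^+ 2) -> is_derive (0 : R) (1 : R) g (0 : R).
Proof.
move=> gC.
have g0 : g 0 = 0.
  by have := nbhs_singleton gC; rewrite expr0n mulr0 normr_le0 => /eqP.
have H : (fun h : R => h^-1 *: ((g \o shift 0) (h *: 1) - g 0)) @ 0^' --> (0 : R).
  apply/cvgr0Pnorm_le => e e_gt0.
  have C0 : 0 < `|C| + 1 by rewrite ltr_wpDl.
  have n1 : \forall h \near (0 : R)^', `|h| <= e / (`|C| + 1) :> R.
    by apply: dnbhs0_le; rewrite divr_gt0.
  near=> h.
  have hn0 : h != 0 by near: h; exact: nbhs_dnbhs_neq.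
  rewrite /= [h *: 1]mulr1 addr0 g0 subr0 [_ *: _]mulrC normrM normfV.
  rewrite ler_pdivrMr ?normr_gt0 //.
  have gh : `|g h| <= C * h ^+ 2 by near: h; exact: cvg_within gC.
  have he : `|h| <= e / (`|C| + 1) by near: h.
  apply: (le_trans gh); apply: (@le_trans _ _ ((`|C| + 1) * `|h| * `|h|)).
    rewrite -mulrA -expr2 real_normK ?num_real // ler_wpM2r ?sqr_ge0 //.
    by rewrite (le_trans (ler_norm _)) // lerDl.
  by rewrite ler_wpM2r // mulrC -ler_pdivlMr.
by split; [exact: (cvgP _ H)|exact: (cvg_lim _ H)].
Unshelve. all: by end_near. Qed.

Lemma mean_value_bound (k dk : R -> R) (a b M : R) :
  (forall s, 0 <= s <= 1 -> is_derive (a + s * (b - a)) 1 k (dk (a + s * (b - a)))) ->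
  (forall s, 0 <= s <= 1 -> `|dk (a + s * (b - a))| <= M) ->
  `|k b - k a| <= M * `|b - a|.
Proof.
move=> Dk Mk.
have S (x : R) : x *: (1 : R) = x by exact: mulr1.
have [|c c01] := @mvt_line R R k a 1 (b - a).
  move=> s s01; rewrite S; exact: (@ex_derive _ _ _ _ _ _ _ (Dk s s01)).
rewrite !S (@derive_val _ _ _ _ _ _ _ (Dk c c01)) [a + (b - a)]addrC subrK => ->.
by rewrite normrM mulrC ler_wpM2r // Mk.
Qed.

Definition pt (x y : R) : plane := x *: e0 + y *: e1.

Lemma pt0 x y : (pt x y) 0 0 = x.
Proof. by rewrite /pt !mxE /= mulr1 mulr0 addr0. Qed.

Lemma pt1 x y : (pt x y) 0 1 = y.
Proof. by rewrite /pt !mxE /= mulr1 mulr0 add0r. Qed.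

Lemma ptE (p : plane) : p = pt (p 0 0) (p 0 1).
Proof. exact: row2E. Qed.

Lemma pt_line0 x y s : pt x y + s *: e0 = pt (x + s) y.
Proof. by rewrite /pt scalerDl addrAC. Qed.

Lemma pt_line1 x y s : pt x y + s *: e1 = pt x (y + s).
Proof. by rewrite /pt scalerDl addrA. Qed.

Lemma ball_pt (q : plane) r x y :
  ball q r (pt x y) <-> `|q 0 0 - x| < r /\ `|q 0 1 - y| < r.
Proof. by rewrite ball_row2 pt0 pt1. Qed.

Lemma is_derive_pt0 (f : plane -> R) x y : derivable f (pt x y) e0 ->
  is_derive x 1 (fun s => f (pt s y)) (du f (pt x y)).
Proof.
have E s : pt s y = pt 0 y + s *: e0 by rewrite pt_line0 add0r.
have -> : (fun s => f (pt s y)) = (fun s => f (pt 0 y + s *: e0)).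
  by rewrite funeqE => s; rewrite E.
rewrite E; exact: is_derive_line.
Qed.

Lemma is_derive_pt1 (f : plane -> R) x y : derivable f (pt x y) e1 ->
  is_derive y 1 (fun s => f (pt x s)) (dv f (pt x y)).
Proof.
have E s : pt x s = pt x 0 + s *: e1 by rewrite pt_line1 add0r.
have -> : (fun s => f (pt x s)) = (fun s => f (pt x 0 + s *: e1)).
  by rewrite funeqE => s; rewrite E.
rewrite E; exact: is_derive_line.
Qed.

Lemma is_derive1_continuous (f : R -> R) (x d : R) :
  is_derive x 1 f d -> {for x, continuous f}.
Proof.
move=> Hf; apply: differentiable_continuous; apply/derivable1_diffP.
exact: (@ex_derive _ _ _ _ _ _ _ Hf).
Qed.

Lemma mvt_pt0 (f : plane -> R) x y h :
  (forall s, 0 <= s <= 1 -> derivable f (pt (x + s * h) y) e0) ->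
  exists2 c, 0 <= c <= 1 & f (pt (x + h) y) - f (pt x y) = h * du f (pt (x + c * h) y).
Proof.
move=> df.
have [|c c01] := @mvt_line R _ f (pt x y) e0 h.
  move=> s s01; rewrite pt_line0; exact: df.
by rewrite !pt_line0 => E; exists c.
Qed.

Lemma ball_shift_segment (q x h s r : R) : 0 <= s <= 1 -> `|q - x| < r ->
  `|q - (x + h)| < r -> `|q - (x + s * h)| < r.
Proof.
move=> s01 a b; have := ball_segment s01 a b.
by rewrite [x + h]addrC addrK.
Qed.

(** The mean value theorem is applied twice, the second time between 0 and the first intermediate
    point; this gives the constant [C], coarser than the Taylor constant C / 2. *)
Lemma second_order_bound (Q : plane -> R) (q : plane) (r C x y h : R) :
  (forall p, ball q r p -> derivable Q p e0) ->
  (forall p, ball q r p -> derivable (du Q) p e0) ->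
  (forall p, ball q r p -> `|du (du Q) p| <= C) ->
  ball q r (pt x y) -> ball q r (pt (x + h) y) ->
  `|Q (pt (x + h) y) - Q (pt x y) - h * du Q (pt x y)| <= C * h ^+ 2.
Proof.
move=> d1 d2 d2C /ball_pt[bx bY] /ball_pt[bxh _].
have B s : 0 <= s <= 1 -> ball q r (pt (x + s * h) y).
  by move=> s01; apply/ball_pt; split=> //; exact: ball_shift_segment.
have [s s01 ->] := mvt_pt0 (fun s s01 => d1 _ (B s s01)).
have B' t : 0 <= t <= 1 -> ball q r (pt (x + t * (s * h)) y).
  move=> /andP[t0 t1]; rewrite mulrA; apply: B; move/andP: s01 => [s0 s1].
  by rewrite mulr_ge0 //= mulr_ile1.
have [t t01 E] := mvt_pt0 (fun t t01 => d2 _ (B' t t01)).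
rewrite -mulrBr E.
have Cb := d2C _ (B' t t01); move: (du (du Q) _) Cb => D Cb.
have /andP[s0 s1] := s01.
have C0 : 0 <= C by exact: le_trans Cb.
rewrite (_ : h * (s * h * D) = s * D * h ^+ 2); last by ring.
rewrite normrM (ger0_norm (sqr_ge0 h)) ler_wpM2r ?sqr_ge0 //.
by rewrite normrM ger0_norm // -[C]mul1r ler_pM.
Qed.

(** The primitive integrates [P] along the horizontal line through [q] and then [Q] vertically: f(x,
    y) = A(x) + B(x, y). The derivative in y is immediate. For the one in x, differentiation under
    the integral sign is replaced by a bound of order h^2 on the error [E] of the expected
    first-order expansion of [B] in x. The y-derivative of this error is Q(x + h, y) - Q(x, y) - h
    Q_x(x, y), because P_y = Q_x; it is a Taylor remainder, hence the two derivatives of [Q]. *)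
Lemma Poincare (U : set plane) (P Q : plane -> R) (q : plane) :
  open U -> U q -> Ck_on 1 U P -> Ck_on 2 U Q ->
  (forall p, U p -> dv P p = du Q p) ->
  exists r (f : plane -> R), [/\ 0 < r, ball q r `<=` U &
    forall p, ball q r p -> is_derive p e0 f (P p) /\ is_derive p e1 f (Q p)].
Proof.
move=> oU Uq HP HQ PQ.
have HQ1 := Ck_du HQ.
have [r1 /= r10 Hr1] : exists2 r1, 0 < r1 & forall p, ball q r1 p ->
    U p /\ `|du (du Q) q - du (du Q) p| <= 1.
  have c := continuous_near_le (Ck_continuous (Ck_du HQ1) Uq) (@ltr01 R).
  have /nbhs_ballP[r /= r0 H] : \forall p \near q, U p /\ `|du (du Q) q - du (du Q) p| <= 1.
    exact: filterI (near_open oU Uq) c.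
  by exists r => // p /H.
pose C := `|du (du Q) q| + 1.
have bU p : ball q r1 p -> U p by move=> /Hr1[].
have bC p : ball q r1 p -> `|du (du Q) p| <= C.
  move=> /Hr1[_ H]; rewrite /C -lerBlDl; apply: le_trans H.
  by rewrite distrC lerB_dist.
pose x0 := q 0 0; pose y0 := q 0 1; pose r := r1 / 2.
have rr1 : r < r1 by rewrite /r; lra.
have r0 : 0 < r by rewrite /r; lra.
have Bq x y : `|x - x0| < r1 -> `|y - y0| < r1 -> ball q r1 (pt x y).
  by move=> a b; apply/ball_pt; rewrite distrC (distrC _ y).
have y0y0 : `|y0 - y0| < r1 by rewrite subrr normr0.
have [|A A0 dA] := @primitive_ball (fun x => P (pt x y0)) x0 r1 r10.
  move=> x xr; apply: is_derive1_continuous (is_derive_pt0 _).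
  exact: Ck_derivable0 HP (bU _ (Bq _ _ xr y0y0)).
(* Outside the ball the zero function is taken, so that [choice] yields one total family [B]. *)
have exB x : exists B : R -> R, `|x - x0| < r1 -> B y0 = 0 /\
    forall y, `|y - y0| < r1 / 2 -> is_derive y 1 B (Q (pt x y)).
  have [xr|] := ltP `|x - x0| r1; last by exists (fun=> 0) => //.
  have [|B B0 dB] := @primitive_ball (fun y => Q (pt x y)) y0 r1 r10.
    move=> y yr; apply: is_derive1_continuous (is_derive_pt1 _).
    exact: Ck_derivable1 HQ (bU _ (Bq _ _ xr yr)).
  by exists B => _; split.
have [B HB] := choice exB.
pose f (p : plane) := A (p 0 0) + B (p 0 0) (p 0 1).
exists r, f; split=> //; first by move=> p /(le_ball (ltW rr1)); exact: bU.
move=> p pr; rewrite [p]ptE.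
have /ball_pt[] : ball q r (pt (p 0 0) (p 0 1)) by rewrite -ptE.
rewrite -/x0 -/y0 distrC (distrC y0).
move: (p 0 0) (p 0 1) => x y xr yr.
have xr1 : `|x - x0| < r1 by exact: lt_trans rr1.
have yr1 : `|y - y0| < r1 by exact: lt_trans rr1.
split; last first.
  apply: is_derive_along.
  have -> : (fun s : R => f (pt x y + s *: e1)) = (fun s => A x + B x (s + y)).
    by rewrite funeqE => s; rewrite pt_line1 /f pt0 pt1 addrC [y + s]addrC addrC.
  have H1 : is_derive (0 + y) 1 (B x) (Q (pt x y)).
    by rewrite add0r; exact: (HB x xr1).2.
  have H2 : is_derive (0 : R) 1 (fun s => s + y) 1 by exact: is_derive_shift.
  have H3 := is_deriveD (is_derive_cst (A x) (0 : R) (1 : R))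
    (@is_derive1_comp R (B x) (fun s : R => s + y) 0 _ _ H1 H2).
  rewrite add0r mulr1 in H3; exact: H3.
apply: is_derive_along.
pose E (h : R) := B (x + h) y - B x y - h * (P (pt x y) - P (pt x y0)).
have -> : (fun s : R => f (pt x y + s *: e0)) =
   (fun s => A (s + x) + (E s + (B x y + s * (P (pt x y) - P (pt x y0))))).
  by rewrite funeqE => s; rewrite pt_line0 /f pt0 pt1 /E [s + x]addrC; congr (_ + _); ring.
have H1 : is_derive (0 + x) 1 A (P (pt x y0)).
  by rewrite add0r; exact: dA.
have H2 : is_derive (0 : R) 1 (fun s => s + x) 1 by exact: is_derive_shift.
have H3 := @is_derive1_comp R A (fun s : R => s + x) 0 _ _ H1 H2.
have H4 : is_derive (0 : R) 1 E (0 : R).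
  apply: (@is_derive_quadratic _ (C * r1)).
  have n1 : \forall h \near (0 : R), `|x + h - x0| < r.
    have : \forall h \near (0 : R), `|h| < r - `|x - x0|.
      by apply: nbhs0_lt; rewrite subr_gt0.
    apply: filterS => h hr; rewrite addrAC.
    apply: le_lt_trans (ler_normD _ _) _; rewrite -ltrBrDl.
    by [].
  apply: filterS n1 => h xhr.
  have xhr1 : `|x + h - x0| < r1 by exact: lt_trans rr1.
  (* The increment of [k] from y0 to y is E(h), because [B x] and [B (x + h)] vanish at y0. *)
  pose k t := B (x + h) t - B x t - h * P (pt x t).
  have segr s : 0 <= s <= 1 -> `|y0 + s * (y - y0) - y0| < r.
    move=> /andP[s0 s1]; rewrite [y0 + _]addrC addrK normrM ger0_norm //.
    by apply: le_lt_trans yr; rewrite -[leRHS]mul1r ler_wpM2r.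
  have := @mean_value_bound k
    (fun t => Q (pt (x + h) t) - Q (pt x t) - h * dv P (pt x t)) y0 y (C * h ^+ 2).
  have -> : k y - k y0 = E h.
    by rewrite /k /E (HB (x + h) xhr1).1 (HB x xr1).1; ring.
  move=> H; have {}H : `|E h| <= C * h ^+ 2 * `|y - y0|.
    apply: H => s s01.
      have sr := segr s s01; have sr1 : `|y0 + s * (y - y0) - y0| < r1 by exact: lt_trans rr1.
      have D1 := is_deriveB ((HB (x + h) xhr1).2 _ sr) ((HB x xr1).2 _ sr).
      have D2 := is_deriveZ h (is_derive_pt1 (Ck_derivable1 HP (bU _ (Bq _ _ xr1 sr1)))).
      exact: (is_deriveB D1 D2).
    have sr1 : `|y0 + s * (y - y0) - y0| < r1 by exact: lt_trans (segr s s01) rr1.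
    rewrite (PQ _ (bU _ (Bq _ _ xr1 sr1))).
    apply: (@second_order_bound Q q r1) => [p' /bU|p' /bU|p' /bC||]; last 2 first.
    - exact: Bq.
    - exact: Bq.
    - exact: Ck_derivable0 HQ.
    - exact: Ck_derivable0 HQ1.
    - exact.
  apply: (le_trans H); rewrite mulrAC ler_wpM2r ?sqr_ge0 //.
  by rewrite ler_wpM2l ?(ltW yr1) // /C addr_ge0.
have D0 : is_derive (0 : R) 1 (fun s : R => B x y + s * (P (pt x y) - P (pt x y0)))
    (P (pt x y) - P (pt x y0)).
  have := is_deriveD (is_derive_cst (B x y) (0 : R) (1 : R))
    (is_deriveM (is_derive_id (0 : R) (1 : R))
      (is_derive_cst (P (pt x y) - P (pt x y0)) (0 : R) (1 : R))).
  by rewrite scaler0 !add0r [_ *: 1]mulr1.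
have := is_deriveD H3 (is_deriveD H4 D0).
by rewrite mulr1 [0 + (_ - _)]add0r [P (pt x y0) + _]addrC subrK.
Qed.

End Poincare.

(** * The inverse function theorem in the plane *)

Section PerturbationOfIdentity.
Context {R : realType} {n : nat}.
Local Notation X := 'rV[R]_n.
Variables (T : X -> X) (D : set X).
Hypothesis TD : forall x y, D x -> D y -> `|(T x - x) - (T y - y)| <= 2^-1 * `|x - y|.

Lemma perturbed_id_expand x y : D x -> D y -> `|x - y| <= 2 * `|T x - T y|.
Proof.
move=> Dx Dy; have := TD Dx Dy.
have : `|x - y| <= `|T x - T y| + `|(T x - x) - (T y - y)|.
  have -> : x - y = (T x - T y) - ((T x - x) - (T y - y)).
    by apply/rowP => i; rewrite !mxE; ring.
  exact: ler_normB.
move: `|x - y| `|T x - T y| `|_ - _| => a b c; lra.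
Qed.

(** A solution of T x = y is a fixed point of the map y - (T x - x), which contracts by 1/2. It
    preserves the closed ball of radius [e]: the distance from [y] to [T p] contributes at most e /
    2, the contraction another e / 2. *)
Lemma perturbed_id_surj p e y : 0 < e -> (forall x, `|p - x| <= e -> D x) ->
  `|y - T p| <= e / 2 -> exists2 x, `|p - x| <= e & T x = y.
Proof.
move=> e0 eD yp; pose B := closed_ball_ (Num.norm : X -> R) p e.
have Dp : D p by apply: eD; rewrite subrr normr0 ltW.
have Bp : B p by rewrite /B /closed_ball_ /= subrr normr0 ltW.
pose f (x : X) := y - (T x - x).
have fB : {homo f : x / B x >-> B x}.
  move=> x Bx; rewrite /B /closed_ball_ /= distrC.
  have -> : f x - p = (y - T p) - ((T x - x) - (T p - p)).
    by apply/rowP => i; rewrite !mxE; ring.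
  apply: le_trans (ler_normB _ _) _.
  have Bx' : `|x - p| <= e by rewrite distrC.
  have := TD (eD _ Bx) Dp.
  by move: Bx' yp; move: `|x - p| `|y - T p| `|_ - _| => a b c; lra.
have ctr : is_contraction (mkfun_fun fB).
  exists 2^-1%:nng; split; first by rewrite /=; lra.
  move=> [x x'] [/= Bx Bx'].
  have -> : mkfun fB x - mkfun fB x' = (T x' - x') - (T x - x).
    by apply/rowP => i; rewrite /mkfun /f !mxE; ring.
  rewrite (distrC x); apply: TD; exact: eD.
pose Xc : completeNormedModType R := HB.pack X.
have [|x Bx xE] := @banach_fixed_point R Xc _ _ ctr (@closed_closed_ball_ _ _ _ _).
  by exists p; exact: Bp.
exists x; first exact: Bx.
move: xE; rewrite /= /mkfun /f => /rowP xE.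
by apply/rowP => i; have := xE i; rewrite !mxE; lra.
Qed.

End PerturbationOfIdentity.

Section InverseDerivative.
Context {R : realType}.

Lemma differentiable_near (V W : normedModType R) (f : V -> W) (p : V) (e : R) :
  differentiable f p -> 0 < e ->
  \forall h \near (0 : V), `|f (h + p) - f p - 'd f p h| <= e * `|h|.
Proof.
move=> df e0; have /eqaddoP H := diff_locally df.
have := H _ e0; apply: filterS => h /=.
by rewrite !fctE /= opprD addrA.
Qed.

(** Put D = g(y + h v) - g(y). As [f] inverts [g], h v = df(D) + o(|D|), and the Lipschitz bound on
    [g] turns the error into o(h). Applying [B] gives D = h B v + o(h). *)
Lemma is_derive_local_inverse (V W : normedModType R) (f : V -> W) (g : W -> V)
    (B : W -> V) (y v : W) (C K : R) :
  0 <= C -> 0 <= K -> differentiable f (g y) ->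
  linear B -> (forall w, `|B w| <= C * `|w|) ->
  (forall h, B ('d f (g y) h) = h) ->
  (\forall z \near y, f (g z) = z /\ `|g z - g y| <= K * `|z - y|) ->
  is_derive y v g (B v).
Proof.
move=> C0 K0 df linB BC Bd gK.
apply: is_derive_along.
have [fgy _] := nbhs_singleton gK.
suff H : (fun h : R => h^-1 *: (((fun s : R => g (y + s *: v)) \o shift 0) (h *: 1) - g (y + 0 *: v)))
    @ 0^' --> B v.
  split; [exact: (cvgP _ H)|exact: (cvg_lim _ H)].
apply/cvgrPdist_le => e e0.
(* The summand 1 keeps the divisor positive when [C], [K] or [v] vanishes; it has the same purpose
   in the two thresholds for [h] below. *)
pose M := C * K * `|v| + 1.
have M0 : 0 < M by rewrite ltr_wpDl // !mulr_ge0.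
have eM : 0 < e / M by rewrite divr_gt0.
have /nbhs_ballP[d1 /= d10 Hd1] := differentiable_near df eM.
move/nbhs_ballP : gK => [d2 /= d20 Hd2].
have v0 : 0 < `|v| + 1 by rewrite ltr_wpDl.
have Kv0 : 0 < K * `|v| + 1 by rewrite ltr_wpDl // mulr_ge0.
have n1 : \forall h \near (0 : R)^', `|h| < d2 / (`|v| + 1).
  by apply: dnbhs0_lt; rewrite divr_gt0.
have n2 : \forall h \near (0 : R)^', `|h| < d1 / (K * `|v| + 1).
  by apply: dnbhs0_lt; rewrite divr_gt0.
near=> h.
have h0 : h != 0 by near: h; exact: nbhs_dnbhs_neq.
have h1 : `|h| < d2 / (`|v| + 1) by near: h.
have h2 : `|h| < d1 / (K * `|v| + 1) by near: h.
have hp : 0 < `|h| by rewrite normr_gt0.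
rewrite /= [h *: 1]mulr1 addr0 scale0r addr0.
have hv : `|h| * `|v| < d2.
  move: h1; rewrite ltr_pdivlMr // mulrDr mulr1; apply: le_lt_trans.
  by rewrite lerDl ltW.
have [|fgz gz] := Hd2 (y + h *: v).
  by rewrite -ball_normE /= opprD addrA subrr sub0r normrN normrZ.
move: gz; rewrite [y + _ - y]addrC addKr normrZ => gz.
set D := g (y + h *: v) - g y in gz *.
have Dd1 : `|D| < d1.
  apply: le_lt_trans gz _; move: h2; rewrite ltr_pdivlMr //; apply: le_lt_trans.
  by rewrite mulrCA ler_wpM2l // lerDl.
have := Hd1 D; rewrite /ball_ /= -ball_normE /= sub0r normrN => /(_ Dd1).
rewrite {1}/D subrK fgz fgy [y + _ - y]addrC addKr => HD.
have BZ (k : R) w : B (k *: w) = k *: B w.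
  have B0 : B 0 = 0.
    by have := linB (-1) 0 0; rewrite scaler0 add0r scaleN1r addNr.
  by have := linB k w 0; rewrite B0 !addr0.
have BB w w' : B (w - w') = B w - B w'.
  by have := linB (-1) w' w; rewrite !scaleN1r (addrC (- w')) (addrC (- B w')).
have -> : B v - h^-1 *: D = h^-1 *: B (h *: v - 'd f (g y) D).
  by rewrite BB Bd BZ [RHS]scalerBr scalerA mulVf // scale1r.
rewrite normrZ normfV mulrC ler_pdivrMr //.
apply: le_trans (BC _) _; apply: le_trans (ler_wpM2l C0 HD) _.
apply: (@le_trans _ _ (C * (e / M * (K * (`|h| * `|v|))))).
  by rewrite ler_wpM2l // ler_wpM2l // ltW.
rewrite (_ : C * _ = (C * K * `|v|) / M * (e * `|h|)); last by ring.
rewrite -[leRHS]mul1r ler_wpM2r // ?mulr_ge0 // ?ltW //.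
by rewrite ltr_pdivrMr // mul1r /M ltrDl.
Unshelve. all: by end_near. Qed.

End InverseDerivative.

Section InverseFunction.
Context {R : realType}.
Local Notation e0 := (delta_mx 0 0 : 'rV[R]_2).
Local Notation e1 := (delta_mx 0 1 : 'rV[R]_2).
Local Notation plane := 'rV[R]_2.

Lemma row2_norm_le (h : plane) e : `|h 0 0| <= e -> `|h 0 1| <= e -> `|h| <= e.
Proof.
move=> H0 H1; have e_ge0 : 0 <= e by exact: le_trans H0.
rewrite [leLHS]/Num.Def.normr/= mx_normrE; apply: bigmax_le => // -[i j] _ /=.
rewrite ord1; case: j => [[|[|//]] j].
  by rewrite (_ : Ordinal j = 0) //; exact/val_inj.
by rewrite (_ : Ordinal j = 1) //; exact/val_inj.
Qed.

Lemma is_derive_coord (q v : plane) i : is_derive q v (fun p : plane => p 0 i) (v 0 i).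
Proof.
have d : derivable (fun p : plane => p) q v by exact: derivable_id.
split; first exact: derivable_coord.
by rewrite -(derive_coord i d) derive_id.
Qed.

Lemma small_gradient_lipschitz (f : plane -> R) (q x y : plane) r :
  ball q r x -> ball q r y ->
  (forall p, ball q r p -> derivable f p e0) ->
  (forall p, ball q r p -> derivable f p e1) ->
  (forall p, ball q r p -> `|du f p| <= 4^-1) ->
  (forall p, ball q r p -> `|dv f p| <= 4^-1) ->
  `|f x - f y| <= 2^-1 * `|x - y|.
Proof.
move=> bx bY d0 d1 b0 b1; have [xi [eta [bxi beta ->]]] := mvt2 bY bx d0 d1.
have n0 := coord_norm_le (x - y) 0; have n1 := coord_norm_le (x - y) 1.
rewrite !mxE in n0 n1.
have c0 : `|du f xi| <= 2^-1 / 2 by apply: le_trans (b0 _ bxi) _; lra.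
have c1 : `|dv f eta| <= 2^-1 / 2 by apply: le_trans (b1 _ beta) _; lra.
exact: norm_comb2_le n0 n1 c0 c1.
Qed.

Definition gradient_le (c : R) (f : plane -> R) (p : plane) : Prop :=
  [/\ derivable f p e0, derivable f p e1, `|du f p| <= c & `|dv f p| <= c].

Lemma small_gradient_near (s t : plane -> R) (U : set plane) (q : plane) (al be : R) i :
  open U -> U q -> Ck_on 1 U s -> Ck_on 1 U t ->
  al * du s q + be * du t q = e0 0 i -> al * dv s q + be * dv t q = e1 0 i ->
  let G := fun p : plane => al * s p + be * t p - p 0 i in
  \forall p \near q, gradient_le 4^-1 G p.
Proof.
move=> oU Uq Hs Ht E0 E1 G.
have DG p v : derivable s p v -> derivable t p v ->
    is_derive p v G (al * 'D_v s p + be * 'D_v t p - v 0 i).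
  move=> ds dt.
  have D1 := is_deriveD (is_deriveZ al (derivableP ds)) (is_deriveZ be (derivableP dt)).
  exact (is_deriveB D1 (is_derive_coord p v i)).
have near1 (F1 F2 : plane -> R) (c : R) : Ck_on 0 U F1 -> Ck_on 0 U F2 ->
   al * F1 q + be * F2 q = c -> \forall p \near q, `|al * F1 p + be * F2 p - c| <= 4^-1.
  move=> H1 H2 E.
  have H : Ck_on 0 U (fun p => al * F1 p + be * F2 p).
    exact: CkD oU (CkM oU (Ck_cst 0 U al) H1) (CkM oU (Ck_cst 0 U be) H2).
  have l4 : 0 < 4^-1 :> R by rewrite invr_gt0.
  have := continuous_near_le (Ck_continuous H Uq) l4.
  by apply: filterS => p; rewrite E distrC.
apply: filterS (filterI (near_open oU Uq) (filterI
  (near1 _ _ _ (Ck_du Hs) (Ck_du Ht) E0) (near1 _ _ _ (Ck_dv Hs) (Ck_dv Ht) E1))).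
move=> p [Up [b0 b1]].
have D0 := DG p e0 (Ck_derivable0 Hs Up) (Ck_derivable0 Ht Up).
have D1 := DG p e1 (Ck_derivable1 Hs Up) (Ck_derivable1 Ht Up).
split; [exact: (@ex_derive _ _ _ _ _ _ _ D0)|exact: (@ex_derive _ _ _ _ _ _ _ D1)| |].
- by rewrite /du (@derive_val _ _ _ _ _ _ _ D0).
- by rewrite /dv (@derive_val _ _ _ _ _ _ _ D1).
Qed.

Definition jac (s t : plane -> R) (p : plane) : R :=
  du s p * dv t p - dv s p * du t p.

(** Cramer's formula for the inverse of the Jacobian matrix of (s, t) at [p], applied to [w]. *)
Definition inv_jac (s t : plane -> R) (p w : plane) : plane :=
  pt ((dv t p * w 0 0 - dv s p * w 0 1) / jac s t p)
     ((du s p * w 0 1 - du t p * w 0 0) / jac s t p).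

Lemma inv_jac_linear s t p : linear (inv_jac s t p).
Proof.
by move=> k x y; apply: row2P; rewrite !mxE ?pt0 ?pt1 /= /GRing.scale /=;
  rewrite ?(mulr1, mulr0, addr0, add0r) ?mxE; ring.
Qed.

Lemma inv_jac_bound s t p : exists2 C, 0 <= C &
  forall w, `|inv_jac s t p w| <= C * `|w|.
Proof.
pose C := (`|dv t p| + `|dv s p| + `|du t p| + `|du s p|) * `|(jac s t p)^-1|.
exists C; first by rewrite mulr_ge0 // !addr_ge0.
move=> w; have n0 := coord_norm_le w 0; have n1 := coord_norm_le w 1.
have B (a b : R) x y : `|x| <= `|w| -> `|y| <= `|w| ->
    `|a| + `|b| <= `|dv t p| + `|dv s p| + `|du t p| + `|du s p| ->
    `|(a * x - b * y) / jac s t p| <= C * `|w|.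
  move=> xw yw ab; rewrite normrM /C mulrAC ler_wpM2r //.
  apply: le_trans (ler_normB _ _) _; rewrite !normrM.
  apply: (@le_trans _ _ ((`|a| + `|b|) * `|w|)).
    by rewrite mulrDl lerD // ler_wpM2l.
  by rewrite ler_wpM2r.
have := normr_ge0 (dv t p); have := normr_ge0 (dv s p).
have := normr_ge0 (du t p); have := normr_ge0 (du s p) => g1 g2 g3 g4.
apply: row2_norm_le; rewrite /inv_jac ?pt0 ?pt1; apply: B => //.
  by rewrite -addrA lerDl addr_ge0.
by rewrite [leLHS]addrC -addrA lerDr addr_ge0.
Qed.

Lemma inv_jacK s t p (h : plane) : jac s t p != 0 ->
  inv_jac s t p (pt (h 0 0 * du s p + h 0 1 * dv s p) (h 0 0 * du t p + h 0 1 * dv t p)) = h.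
Proof.
rewrite /jac => J0.
by apply: row2P; rewrite /inv_jac !pt0 !pt1 /jac; field; exact: J0.
Qed.

Lemma inv_jac_inj s t p : jac s t p != 0 -> injective (inv_jac s t p).
Proof.
move=> J0 w w' E; have E0 := congr1 (fun h : plane => h 0 0) E.
have E1 := congr1 (fun h : plane => h 0 1) E.
rewrite !pt0 in E0; rewrite !pt1 in E1.
have {}E0 := mulIf (invr_neq0 J0) E0; have {}E1 := mulIf (invr_neq0 J0) E1.
apply: row2P; apply: (mulfI J0); rewrite /jac.
  transitivity (du s p * (dv t p * w 0 0 - dv s p * w 0 1) +
    dv s p * (du s p * w 0 1 - du t p * w 0 0)); first by ring.
  by rewrite E0 E1; ring.
transitivity (du t p * (dv t p * w 0 0 - dv s p * w 0 1) +
  dv t p * (du s p * w 0 1 - du t p * w 0 0)); first by ring.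
by rewrite E0 E1; ring.
Qed.

Lemma diff_pt (s t : plane -> R) (U : set plane) k (p h : plane) : open U ->
  Ck_on k.+1 U s -> Ck_on k.+1 U t -> U p ->
  differentiable (fun p => pt (s p) (t p)) p /\
  'd (fun p => pt (s p) (t p)) p h =
    pt (h 0 0 * du s p + h 0 1 * dv s p) (h 0 0 * du t p + h 0 1 * dv t p).
Proof.
move=> oU Hs Ht Up.
have ds := C1_differentiableR oU Hs Up; have dt := C1_differentiableR oU Ht Up.
have D : differentiable (fun p => pt (s p) (t p)) p.
  by apply: differentiableD; apply: differentiableZl.
split=> //; rewrite -deriveE // -!derive_dir //.
have dsh := diff_derivable (v := h) ds; have dth := diff_derivable (v := h) dt.
have H := is_deriveD (is_derive_scale dsh (derivable_cst e0 p h))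
  (is_derive_scale dth (derivable_cst e1 p h)).
rewrite [LHS](@derive_val _ _ _ _ _ _ _ H) !derive_cst !scaler0 !addr0.
by rewrite /pt !derive_dir.
Qed.

(** Composition with the inverse Jacobian at [q] makes [T] a perturbation of the identity on a ball
    [W]. This gives injectivity with a Lipschitz inverse, and openness by the fixed point argument.
    The derivative of [g] is the inverse Jacobian evaluated along [g]; so if [g] is of class k, its
    derivatives are too, and [g] is of class k + 1. *)
Lemma inverse_function (s t : plane -> R) (U : set plane) (q : plane) :
  open U -> U q -> smooth_on U s -> smooth_on U t -> jac s t q != 0 ->
  exists (W V : set plane) (g : plane -> plane),
  [/\ [/\ open W, W q, W `<=` U & forall p, W p -> jac s t p != 0],
      open V /\ smooth_on V g,
      forall y, V y -> W (g y) /\ pt (s (g y)) (t (g y)) = y &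
      forall p, W p -> V (pt (s p) (t p)) /\ g (pt (s p) (t p)) = p].
Proof.
move=> oU Uq Hs Ht J0.
pose Psi p := pt (s p) (t p).
pose L := inv_jac s t q.
pose T p := L (Psi p).
pose J := jac s t q.
have HJ k : Ck_on k U (jac s t).
  exact: CkB oU (CkM oU (Ck_du (Hs k.+1)) (Ck_dv (Ht k.+1)))
    (CkM oU (Ck_dv (Hs k.+1)) (Ck_du (Ht k.+1))).
have nJ : \forall p \near q, jac s t p != 0.
  have c := Ck_continuous (HJ 0%N) Uq.
  have JJ : 0 < `|jac s t q| / 2 by rewrite divr_gt0 // normr_gt0.
  apply: filterS (continuous_near_le c JJ) => p; apply: contraTneq => ->.
  by rewrite subr0 -ltNge ltr_pdivrMr // ltr_pMr ?normr_gt0 // ltr1n.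
have T0 p : T p 0 0 = dv t q / J * s p + - (dv s q / J) * t p.
  by rewrite /T /L /inv_jac /Psi !pt0 !pt1 -/J; ring.
have T1 p : T p 0 1 = - (du t q / J) * s p + du s q / J * t p.
  by rewrite /T /L /inv_jac /Psi !pt0 !pt1 -/J; ring.
have [r /= r0 Hr] : exists2 r, 0 < r & forall p, ball q r p ->
  [/\ U p, jac s t p != 0,
  gradient_le 4^-1 (fun p => T p 0 0 - p 0 0) p &
  gradient_le 4^-1 (fun p => T p 0 1 - p 0 1) p].
  have E0 : (fun p => T p 0 0 - p 0 0) =
      (fun p : plane => dv t q / J * s p + - (dv s q / J) * t p - p 0 0).
    by rewrite funeqE => p; rewrite T0.
  have E1 : (fun p => T p 0 1 - p 0 1) =
      (fun p : plane => - (du t q / J) * s p + du s q / J * t p - p 0 1).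
    by rewrite funeqE => p; rewrite T1.
  have n0 := @small_gradient_near s t U q (dv t q / J) (- (dv s q / J)) 0 oU Uq (Hs 1%N) (Ht 1%N).
  have n1 := @small_gradient_near s t U q (- (du t q / J)) (du s q / J) 1 oU Uq (Hs 1%N) (Ht 1%N).
  rewrite /= -E0 in n0; rewrite /= -E1 in n1.
  have J0' : du s q * dv t q - dv s q * du t q != 0 by [].
  have {}n0 : \forall p \near q, gradient_le 4^-1 (fun p => T p 0 0 - p 0 0) p.
    by apply: n0; rewrite !mxE /= /J /jac; field.
  have {}n1 : \forall p \near q, gradient_le 4^-1 (fun p => T p 0 1 - p 0 1) p.
    by apply: n1; rewrite !mxE /= /J /jac; field.
  have /nbhs_ballP[r /= r0 H] : \forall p \near q, U p /\ jac s t p != 0 /\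
      gradient_le 4^-1 (fun p => T p 0 0 - p 0 0) p /\
      gradient_le 4^-1 (fun p => T p 0 1 - p 0 1) p.
    exact: filterI (near_open oU Uq) (filterI nJ (filterI n0 n1)).
  by exists r => // p /H[a [b [c d]]]; exact: And4 a b c d.
pose W : set plane := ball q r; pose V := Psi @` W.
have WU p : W p -> U p by move=> /Hr[].
have Lip x y : W x -> W y -> `|(T x - x) - (T y - y)| <= 2^-1 * `|x - y|.
  move=> Wx Wy; apply: row2_norm_le.
    have -> : ((T x - x) - (T y - y)) 0 0 = (T x 0 0 - x 0 0) - (T y 0 0 - y 0 0) by rewrite !mxE.
    by apply: (@small_gradient_lipschitz (fun p => T p 0 0 - p 0 0) q x y r Wx Wy);
      move=> p /Hr[_ _ [a b c d] _]; [exact: a|exact: b|exact: c|exact: d].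
  have -> : ((T x - x) - (T y - y)) 0 1 = (T x 0 1 - x 0 1) - (T y 0 1 - y 0 1) by rewrite !mxE.
  by apply: (@small_gradient_lipschitz (fun p => T p 0 1 - p 0 1) q x y r Wx Wy);
    move=> p /Hr[_ _ _ [a b c d]]; [exact: a|exact: b|exact: c|exact: d].
have [K K0 LK] := inv_jac_bound s t q.
have LB w w' : L (w - w') = L w - L w'.
  have := inv_jac_linear s t q (-1) w' w; rewrite !scaleN1r.
  by rewrite (addrC (- w')) (addrC (- inv_jac s t q w')).
have expand x y : W x -> W y -> `|x - y| <= 2 * K * `|Psi x - Psi y|.
  move=> Wx Wy; apply: le_trans (perturbed_id_expand Lip Wx Wy) _.
  by rewrite -mulrA ler_wpM2l // /T -LB; exact: LK.
have injPsi x y : W x -> W y -> Psi x = Psi y -> x = y.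
  move=> Wx Wy E; have := expand x y Wx Wy.
  by rewrite E subrr normr0 mulr0 normr_le0 subr_eq0 => /eqP.
have openPsi (W' : set plane) : open W' -> W' `<=` W -> open (Psi @` W').
  rewrite !openE => oW' W'W _ [p W'p <-].
  have /nbhs_ballP[e /= e_gt0 pe] := oW' p W'p.
  have e2 : 0 < e / 2 by rewrite divr_gt0.
  have eD x : `|p - x| <= e / 2 -> W' x.
    move=> px; apply: pe; rewrite -ball_normE /=; apply: le_lt_trans px _.
    by rewrite ltr_pdivrMr // ltr_pMr // ltr1n.
  (* One factor 1/2 passes from the open ball to a closed one inside it, the other is lost in
     [perturbed_id_surj], and K + 1 bounds the operator [L]. *)
  apply/nbhs_ballP; exists (e / 2 / 2 / (K + 1)) => /=.
    by rewrite !divr_gt0 // ltr_wpDl.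
  move=> y; rewrite -ball_normE /= distrC => yp.
  have LyT : `|L y - T p| <= e / 2 / 2.
    rewrite /T -LB; apply: le_trans (LK _) _.
    move: yp; rewrite ltr_pdivlMr ?ltr_wpDl // mulrDr mulr1 => yp.
    by rewrite mulrC; apply: ltW; apply: le_lt_trans yp; rewrite lerDl.
  have [x px Tx] := perturbed_id_surj Lip e2 (fun x px => W'W _ (eD x px)) LyT.
  by exists x; [exact: eD|exact: (inv_jac_inj J0 Tx)].
(* The default value [q] is taken outside [V]; every property of [g] is claimed on [V] only. *)
pose g y := xget q [set p | W p /\ Psi p = y].
have gV y : V y -> W (g y) /\ Psi (g y) = y.
  by case=> p Wp E; exact: (@xgetPex _ q [set p | W p /\ Psi p = y] (ex_intro _ p (conj Wp E))).
have gK p : W p -> g (Psi p) = p.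
  move=> Wp; have [Wg E] := gV _ (imageP Psi Wp); exact: injPsi.
have oW : open W by exact: ball_open.
have oV : open V by exact: openPsi.
have dg y v : V y -> is_derive y v g (inv_jac s t (g y) v).
  move=> Vy; have [Wgy E] := gV y Vy; have [C C0 HC] := inv_jac_bound s t (g y).
  have Df h := diff_pt h oU (Hs 1%N) (Ht 1%N) (WU _ Wgy).
  have K2 : 0 <= 2 * K by rewrite mulr_ge0.
  have := @is_derive_local_inverse R plane plane Psi g (inv_jac s t (g y)) y v C (2 * K)
    C0 K2 (Df 0).1 (@inv_jac_linear s t (g y)) HC.
  apply.
  - by move=> h; rewrite (Df h).2 inv_jacK //; have [] := Hr _ Wgy.
  - apply: filterS (near_open oV Vy) => z Vz; have [Wgz Ez] := gV z Vz.
    by split=> //; apply: le_trans (expand _ _ Wgz Wgy) _; rewrite Ez E.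
have cg y : V y -> {for y, continuous g}.
  move=> Vy N /= /nbhs_ballP[e /= e_gt0 Ne]; have [Wgy E] := gV y Vy.
  pose N' : set plane := ball (g y) e `&` W.
  have oN' : open N' by apply: openI oW; exact: ball_open.
  have oI : open (Psi @` N') by apply: openPsi oN' _ => p [].
  have Iy : (Psi @` N') y by exists (g y) => //; split=> //; exact: ballxx.
  apply: filterS (near_open oI Iy) => z [p [pe Wp] <-] /=.
  by rewrite gK //; exact: Ne.
have Hg k : Ck_on k V g.
  elim: k => [|k IH]; first exact: C0P.
  have gi (f : plane -> R) : Ck_on k U f -> Ck_on k V (fun y => f (g y)).
    move=> Hf; apply: (@Ck_comp _ k W V f g oW oV _ (Ck_sub WU Hf) IH).
      by move=> y /gV[].
    by move=> i; exact: Ck_coord.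
  have HJV : Ck_on k V (fun y => jac s t (g y)) by exact: gi.
  have J0V y : V y -> jac s t (g y) != 0 by move=> /gV[/Hr[]].
  have D v : Ck_on k V (fun y => inv_jac s t (g y) v).
    have A (a b : plane -> R) (x y : R) : Ck_on k U a -> Ck_on k U b ->
        Ck_on k V (fun z => (a (g z) * x - b (g z) * y) / jac s t (g z)).
      move=> Ha Hb; apply: (Ck_div oV J0V _ HJV); apply: (CkB oV).
        exact: CkM oV (gi _ Ha) (Ck_cst k V x).
      exact: CkM oV (gi _ Hb) (Ck_cst k V y).
    by apply: (CkD oV); apply: (CkZ oV _ (Ck_cst k V _)); apply: A;
      [exact: Ck_dv (Ht k.+1)|exact: Ck_dv (Hs k.+1)|exact: Ck_du (Hs k.+1)|exact: Ck_du (Ht k.+1)].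
  apply: CkS.
  - exact: cg.
  - move=> y Vy; exact: (@ex_derive _ _ _ _ _ _ _ (dg y e0 Vy)).
  - move=> y Vy; exact: (@ex_derive _ _ _ _ _ _ _ (dg y e1 Vy)).
  - apply: Ck_congr oV _ (D e0) => y Vy; exact: esym (@derive_val _ _ _ _ _ _ _ (dg y e0 Vy)).
  - apply: Ck_congr oV _ (D e1) => y Vy; exact: esym (@derive_val _ _ _ _ _ _ _ (dg y e1 Vy)).
exists W, V, g; split.
- by split=> //; [exact: ballxx|move=> p /Hr[]].
- by split.
- exact: gV.
- by move=> p Wp; split; [exact: imageP|exact: gK].
Qed.

End InverseFunction.

(** * Minkowski space and the second fundamental form *)

Section Mink.
Context {R : realType}.
Implicit Types X Y Z N : 'rV[R]_4.

Lemma minkC X Y : mink X Y = mink Y X.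
Proof. by rewrite !minkE; apply: eq_bigr => i _; rewrite (mulrC (X 0 i)). Qed.

Lemma minkDl X Y Z : mink (X + Y) Z = mink X Z + mink Y Z.
Proof.
rewrite !minkE -big_split /=; apply: eq_bigr => i _; rewrite mxE.
by rewrite mulrDl mulrDr.
Qed.

Lemma minkZl k X Y : mink (k *: X) Y = k * mink X Y.
Proof.
rewrite !minkE mulr_sumr; apply: eq_bigr => i _; rewrite mxE.
by rewrite -mulrA mulrCA.
Qed.

Lemma minkDr X Y Z : mink X (Y + Z) = mink X Y + mink X Z.
Proof. by rewrite minkC minkDl !(minkC X). Qed.

Lemma minkZr k X Y : mink X (k *: Y) = k * mink X Y.
Proof. by rewrite minkC minkZl (minkC X). Qed.

Lemma minkNl X Y : mink (- X) Y = - mink X Y.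
Proof. by rewrite -scaleN1r minkZl mulN1r. Qed.

Lemma minkNr X Y : mink X (- Y) = - mink X Y.
Proof. by rewrite minkC minkNl minkC. Qed.

Lemma mink0l X : mink 0 X = 0.
Proof. by rewrite -(scale0r 0) minkZl mul0r. Qed.

Lemma mink0r X : mink X 0 = 0.
Proof. by rewrite minkC mink0l. Qed.

Definition minkL := (minkDl, minkDr, minkNl, minkNr, minkZl, minkZr, mink0l, mink0r).

Lemma mink4 : exists i0 i1 i2 i3 : 'I_4,
  (forall i, [\/ i = i0, i = i1, i = i2 | i = i3]) /\
  forall X Y, mink X Y = X 0 i0 * Y 0 i0 + X 0 i1 * Y 0 i1 + X 0 i2 * Y 0 i2 - X 0 i3 * Y 0 i3.
Proof.
exists ord0, (lift ord0 ord0), (lift ord0 (lift ord0 ord0)), ord_max; split.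
  by case=> [[|[|[|[|//]]]]] Hi; [constructor 1|constructor 2|constructor 3|constructor 4]; exact/val_inj.
move=> X Y; rewrite minkE !big_ord_recl big_ord0 /= !mul1r addr0 !addrA mulN1r.
by do ?f_equal; apply/val_inj.
Qed.

Lemma orthogonal_to_timelike X N : mink X X = -1 -> mink N X = 0 ->
  0 <= mink N N /\ (mink N N = 0 -> N = 0).
Proof.
have [i0 [i1 [i2 [i3 [all_i E]]]]] := mink4.
rewrite !E => XX NX.
set x0 := X 0 i0 in XX NX; set x1 := X 0 i1 in XX NX; set x2 := X 0 i2 in XX NX.
set x3 := X 0 i3 in XX NX.
set a0 := N 0 i0 in NX *; set a1 := N 0 i1 in NX *; set a2 := N 0 i2 in NX *.
set a3 := N 0 i3 in NX *.
(* Cauchy-Schwarz in the three spacelike coordinates, as a Lagrange identity. *)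
have key : x3 ^+ 2 * (a0 * a0 + a1 * a1 + a2 * a2 - a3 * a3) =
    (a0 * a0 + a1 * a1 + a2 * a2) + ((a0 * x1 - a1 * x0) ^+ 2 +
    (a0 * x2 - a2 * x0) ^+ 2 + (a1 * x2 - a2 * x1) ^+ 2).
  have E3 : x3 * x3 = 1 + x0 * x0 + x1 * x1 + x2 * x2 by lra.
  have E4 : a3 * x3 = a0 * x0 + a1 * x1 + a2 * x2 by lra.
  rewrite (_ : _ * _ = (x3 * x3) * (a0 * a0 + a1 * a1 + a2 * a2) - (a3 * x3) * (a3 * x3)); last by ring.
  by rewrite E3 E4; ring.
have x3p : 0 < x3 ^+ 2 by have : x3 * x3 = 1 + x0 * x0 + x1 * x1 + x2 * x2 by [lra]; nra.
have h0 := sqr_ge0 (a0 * x1 - a1 * x0); have h1 := sqr_ge0 (a0 * x2 - a2 * x0).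
have h2 := sqr_ge0 (a1 * x2 - a2 * x1).
have g0 := sqr_ge0 a0; have g1 := sqr_ge0 a1; have g2 := sqr_ge0 a2.
rewrite !expr2 in g0 g1 g2.
split.
  by rewrite -(pmulr_rge0 _ x3p) key; lra.
move=> NN; rewrite NN mulr0 in key.
have /eqP z0 : a0 == 0 by rewrite -sqrf_eq0 expr2; apply/eqP; lra.
have /eqP z1 : a1 == 0 by rewrite -sqrf_eq0 expr2; apply/eqP; lra.
have /eqP z2 : a2 == 0 by rewrite -sqrf_eq0 expr2; apply/eqP; lra.
have /eqP z3 : a3 == 0.
  by move: NN; rewrite z0 z1 z2 => NN; rewrite -sqrf_eq0 expr2; apply/eqP; lra.
by apply/rowP => i; rewrite mxE; case: (all_i i) => ->.
Qed.

(** These are three linear equations in four unknowns: orthogonality reads N A = 0 for a 4 by 3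
    matrix with the signature built in. *)
Lemma exists_orthogonal X Y Z : exists2 N, N != 0 &
  [/\ mink N X = 0, mink N Y = 0 & mink N Z = 0].
Proof.
pose s (i : 'I_4) : R := if i == ord_max then -1 else 1.
pose A : 'M[R]_(4, 3) := \matrix_(i, j) (s i * (if j == 0 then X else if j == 1 then Y else Z) 0 i).
have : kermx A != 0.
  rewrite kermx_eq0; apply/negP => /eqP rA.
  by have := rank_leq_col A; rewrite rA.
move=> /rowV0Pn[N /sub_kermxP NA N0]; exists N => //.
have H j : mink N (if j == 0 then X else if j == 1 then Y else Z) = (N *m A) 0 j.
  by rewrite minkE !mxE; apply: eq_bigr => i _; rewrite mxE mulrCA.
by split; [have := H 0|have := H 1|have := H (lift ord0 (lift ord0 ord0))]; rewrite NA mxE.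
Qed.

End Mink.

(** * Tangent and normal vectors at a timelike point *)

Section Pointwise.
Context {R : realType}.
Local Notation e0 := (delta_mx 0 0 : 'rV[R]_2).
Local Notation e1 := (delta_mx 0 1 : 'rV[R]_2).
Local Notation plane := 'rV[R]_2.
(* [du w q] and [dv w q] are named by variables: trying to unify one with the
   other unfolds both and diverges in practice. *)
Variables (w : plane -> 'rV[R]_4) (q : plane) (wx wy : 'rV[R]_4).
Hypotheses (dw : differentiable w q) (Hx : du w q = wx) (Hy : dv w q = wy).
Local Notation E := (mink wx wx).
Local Notation F := (mink wx wy).
Local Notation G := (mink wy wy).

Lemma tangent_comb (a : plane) : exists al be, 'D_a w q = al *: wx + be *: wy.
Proof. by exists (a 0 0), (a 0 1); rewrite -Hx -Hy; exact: derive_dir. Qed.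

Lemma tangent_of_comb al be : 'D_(al *: e0 + be *: e1) w q = al *: wx + be *: wy.
Proof.
rewrite -Hx -Hy [LHS]derive_dir // /du /dv; congr (_ *: _ + _ *: _).
  by rewrite !mxE /= mulr1 mulr0 addr0.
by rewrite !mxE /= mulr1 mulr0 add0r.
Qed.

Lemma normal_vectorP N : normal_vector w q N <-> mink N wx = 0 /\ mink N wy = 0.
Proof.
split=> [H|[H0 H1] a]; first by rewrite -Hx -Hy; split; exact: H.
have [al [be ->]] := tangent_comb a.
by rewrite minkDr !minkZr H0 H1 !mulr0 addr0.
Qed.

Lemma tangent_vectorP X :
  tangent_vector w q X <-> exists al be, X = al *: wx + be *: wy.
Proof.
split=> [[a ->]|[al [be ->]]].
  exact: tangent_comb.
by exists (al *: e0 + be *: e1); rewrite tangent_of_comb.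
Qed.

Lemma tangent_vectorD X Y :
  tangent_vector w q X -> tangent_vector w q Y -> tangent_vector w q (X + Y).
Proof.
move=> /tangent_vectorP[a [b ->]] /tangent_vectorP[c [d ->]].
by apply/tangent_vectorP; exists (a + c), (b + d); rewrite !scalerDl addrACA.
Qed.

Lemma tangent_vectorZ k X : tangent_vector w q X -> tangent_vector w q (k *: X).
Proof.
move=> /tangent_vectorP[a [b ->]]; apply/tangent_vectorP.
by exists (k * a), (k * b); rewrite scalerDr !scalerA.
Qed.

Lemma tangent_vectorB X Y :
  tangent_vector w q X -> tangent_vector w q Y -> tangent_vector w q (X - Y).
Proof.
by move=> TX TY; rewrite -scaleN1r; apply: tangent_vectorD => //; exact: tangent_vectorZ.
Qed.

Hypothesis tw : timelike_at w q.

(** A change of basis multiplies the Gram determinant by the square of its own determinant, and for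
    an orthonormal frame the Gram determinant is -1. *)
Lemma timelike_disc : E * G - F ^+ 2 < 0.
Proof.
have [a [b []]] := tw.
have [A0 [A1 ->]] := tangent_comb a; have [B0 [B1 ->]] := tangent_comb b.
rewrite !minkL (minkC wy wx) => aa bb ab.
have : (E * G - F ^+ 2) * (A0 * B1 - A1 * B0) ^+ 2 = -1.
  transitivity ((A0 * (A0 * E + A1 * F) + A1 * (A0 * F + A1 * G)) *
    (B0 * (B0 * E + B1 * F) + B1 * (B0 * F + B1 * G)) -
    (A0 * (B0 * E + B1 * F) + A1 * (B0 * F + B1 * G)) ^+ 2); first by ring.
  have -> : A0 * (A0 * E + A1 * F) + A1 * (A0 * F + A1 * G) = -1 by rewrite -aa; ring.
  have -> : B0 * (B0 * E + B1 * F) + B1 * (B0 * F + B1 * G) = 1 by rewrite -bb; ring.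
  have -> : A0 * (B0 * E + B1 * F) + A1 * (B0 * F + B1 * G) = 0 by rewrite -ab; ring.
  by ring.
move=> H; rewrite ltNge; apply/negP => D0.
by have := mulr_ge0 D0 (sqr_ge0 (A0 * B1 - A1 * B0)); rewrite H; lra.
Qed.

Lemma tangent_projection X : exists2 Y, tangent_vector w q Y & normal_vector w q (X - Y).
Proof.
have D0 : E * G - F ^+ 2 != 0 by rewrite lt_eqF // timelike_disc.
pose x0 := mink X (wx); pose x1 := mink X (wy).
exists ((x0 * G - x1 * F) / (E * G - F ^+ 2) *: wx +
        (x1 * E - x0 * F) / (E * G - F ^+ 2) *: wy).
  by apply/tangent_vectorP; eexists; eexists.
apply/normal_vectorP; rewrite !minkL (minkC (wy) (wx)) -/x0 -/x1.
by split; field.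
Qed.

Lemma tangent_normal0 X : tangent_vector w q X -> normal_vector w q X -> X = 0.
Proof.
move=> /tangent_vectorP[a [b ->]] /normal_vectorP[].
rewrite !minkL (minkC (wy) (wx)) => H0 H1.
have D0 : E * G - F ^+ 2 != 0 by rewrite lt_eqF // timelike_disc.
have a0 : a = 0.
  by apply: (mulfI D0); rewrite mulr0; transitivity (G * (a * E + b * F) - F * (a * F + b * G));
    [ring|rewrite H0 H1; ring].
have b0 : b = 0.
  by apply: (mulfI D0); rewrite mulr0; transitivity (E * (a * F + b * G) - F * (a * E + b * F));
    [ring|rewrite H0 H1; ring].
by rewrite a0 b0 !scale0r addr0.
Qed.

Lemma normal_vectorB X Y : normal_vector w q X -> normal_vector w q Y ->
  normal_vector w q (X - Y).
Proof. by move=> NX NY a; rewrite !minkL NX NY subrr. Qed.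

Lemma sigmaP a b : normal_vector w q (sigma w q a b) /\
  tangent_vector w q ('D_a ('D_b w) q - sigma w q a b).
Proof.
have [Y TY NY] := tangent_projection ('D_a ('D_b w) q).
have := @getPex _ [set S | normal_vector w q S /\ tangent_vector w q ('D_a ('D_b w) q - S)].
apply; exists ('D_a ('D_b w) q - Y); split=> //.
by rewrite opprB addrC subrK.
Qed.

Lemma sigma_eq a b S : normal_vector w q S ->
  tangent_vector w q ('D_a ('D_b w) q - S) -> sigma w q a b = S.
Proof.
move=> NS TS; have [Ns Ts] := sigmaP a b.
apply/eqP; rewrite -subr_eq0; apply/eqP; apply: tangent_normal0.
  have -> : sigma w q a b - S = ('D_a ('D_b w) q - S) - ('D_a ('D_b w) q - sigma w q a b).
    by rewrite opprB [RHS]addrC addrA subrK.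
  exact: tangent_vectorB.
exact: normal_vectorB.
Qed.

Lemma normal_norm_gt0 N : normal_vector w q N -> N != 0 -> 0 < mink N N.
Proof.
have [a [_ [aa _ _]]] := tw => NN N0.
have [ge0 eq0] := orthogonal_to_timelike aa (NN a).
by rewrite lt_def ge0 andbT; apply: contra_neq N0.
Qed.

Lemma normal_normalize N : normal_vector w q N -> N != 0 ->
  exists2 e, normal_vector w q e /\ mink e e = 1 & N = Num.sqrt (mink N N) *: e.
Proof.
move=> NN N0; have gt0 := normal_norm_gt0 NN N0.
have s0 : Num.sqrt (mink N N) != 0 by rewrite gt_eqF // sqrtr_gt0.
exists ((Num.sqrt (mink N N))^-1 *: N).
  split; first by move=> a; rewrite minkL NN mulr0.
  rewrite !minkL -{3}(sqr_sqrtr (ltW gt0)).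
  by field.
by rewrite scalerA mulfV // scale1r.
Qed.

Lemma exists_normal_frame : exists e1 e2, orthonormal_normal w q e1 e2.
Proof.
(* The vector 0 leaves only the two conditions of normality; the third slot is used for the second
   normal vector. *)
have [N1 N10 [N1u N1v _]] := exists_orthogonal (wx) (wy) 0.
have NN1 : normal_vector w q N1 by apply/normal_vectorP.
have [f1 [Nf1 f11] N1E] := normal_normalize NN1 N10.
have [N2 N20 [N2u N2v N2f]] := exists_orthogonal (wx) (wy) f1.
have NN2 : normal_vector w q N2 by apply/normal_vectorP.
have [f2 [Nf2 f22] N2E] := normal_normalize NN2 N20.
exists f1, f2; split=> //; split=> //; split=> //.
have s0 : Num.sqrt (mink N2 N2) != 0 by rewrite gt_eqF // sqrtr_gt0 normal_norm_gt0.
by apply: (mulfI s0); rewrite mulr0 -minkZr -N2E minkC.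
Qed.

(** When the normal parts of the second derivatives are all multiples of that of a single vector,
    the three minors vanish. Absence of flat points is used in this form: a degenerate case is
    refuted by exhibiting [V]. *)
Lemma flat_pointI V k1 k2 k3 :
  (forall e, normal_vector w q e -> [/\ c11 w q e = k1 * mink V e,
     c12 w q e = k2 * mink V e & c22 w q e = k3 * mink V e]) ->
  flat_point w q.
Proof.
move=> H; have [f1 [f2 fr]] := exists_normal_frame.
exists f1, f2; split=> //; have [N1 [N2 _]] := fr.
rewrite /Delta1 /Delta2 /Delta3.
have [-> -> ->] := H f1 N1; have [-> -> ->] := H f2 N2.
by congr (_, _, _); ring.
Qed.

End Pointwise.

(** * Mean curvature and geometric frame in terms of second derivatives *)

Section SecondOrder.
Context {R : realType}.
Local Notation e0 := (delta_mx 0 0 : 'rV[R]_2).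
Local Notation e1 := (delta_mx 0 1 : 'rV[R]_2).
Local Notation plane := 'rV[R]_2.
Variables (w : plane -> 'rV[R]_4) (U : set plane) (q : plane).
Variables (wx wy wxx wxy wyy : 'rV[R]_4).
Hypotheses (oU : open U) (Uq : U q) (Hw : smooth_on U w).
Hypotheses (Hx : du w q = wx) (Hy : dv w q = wy).
Hypotheses (Hxx : du (du w) q = wxx) (Hxy : du (dv w) q = wxy).
Hypotheses (Hyx : dv (du w) q = wxy) (Hyy : dv (dv w) q = wyy).
Hypothesis tw : timelike_at w q.

Lemma second_derive al be ga de :
  'D_(al *: e0 + be *: e1) ('D_(ga *: e0 + de *: e1) w) q =
  ga *: (al *: wxx + be *: wxy) + de *: (al *: wxy + be *: wyy).
Proof.
have dw p : U p -> differentiable w p by exact: Ck_differentiable oU (Hw 1%N).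
have dx := Ck_differentiable oU (Ck_du (Hw 2%N)) Uq.
have dy := Ck_differentiable oU (Ck_dv (Hw 2%N)) Uq.
set a := al *: e0 + be *: e1.
transitivity ('D_a (fun p => ga *: du w p + de *: dv w p) q).
  apply: near_eq_derive; apply: filterS (near_open oU Uq) => p Up.
  exact: (tangent_of_comb (dw p Up) erefl erefl).
have D := is_deriveD (is_deriveZ ga (derivableP (diff_derivable (v := a) dx)))
  (is_deriveZ de (derivableP (diff_derivable (v := a) dy))).
rewrite [LHS](@derive_val _ _ _ _ _ _ _ D).
exact: (congr2 (fun X Y => ga *: X + de *: Y)
  (tangent_of_comb dx Hxx Hyx al be) (tangent_of_comb dy Hxy Hyy al be)).
Qed.

Let dw : differentiable w q := Ck_differentiable oU (Hw 1%N) Uq.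

(** The hypothesis is tested on the frame that Gram-Schmidt produces from w_x, which is timelike as
    E < 0: a = w_x / sqrt(-E), and b is a multiple of w_y - (F / E) w_x. H = 0 makes the difference
    of the two second derivatives tangent, and multiplication by EG - F^2 clears the
    denominators. *)
Lemma mean_curvature_tangent : mink wx wx < 0 -> zero_mean_curvature_at w q ->
  tangent_vector w q (mink wx wx *: wyy - (2 * mink wx wy) *: wxy + mink wy wy *: wxx).
Proof.
move=> E0 Hmc; have := timelike_disc dw Hx Hy tw.
set E := mink wx wx in E0 *; set F := mink wx wy; set G := mink wy wy => D0.
pose k := Num.sqrt (- E^-1); pose m := Num.sqrt (E / (E * G - F ^+ 2)).
have kk : k ^+ 2 = - E^-1 by rewrite sqr_sqrtr // oppr_ge0 invr_le0 ltW.
have mm : m ^+ 2 = E / (E * G - F ^+ 2).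
  by rewrite sqr_sqrtr // -mulrNN; apply: mulr_ge0; rewrite oppr_ge0 ?invr_le0 ltW.
have En : E != 0 by rewrite lt_eqF.
have Dn : E * G - F ^+ 2 != 0 by rewrite lt_eqF.
pose a : plane := k *: e0 + 0 *: e1; pose b : plane := (- (m * F / E)) *: e0 + m *: e1.
have ab : orthonormal_tangent w q a b.
  rewrite /orthonormal_tangent !(tangent_of_comb dw Hx Hy) !minkL (minkC wy wx) -/E -/F -/G.
  split.
  - by rewrite (_ : _ + _ = k ^+ 2 * E); [rewrite kk mulNr mulVf|ring].
  - rewrite (_ : _ + _ = m ^+ 2 * (G - F ^+ 2 / E)); last by field.
    by rewrite mm; field; rewrite En Dn.
  - by field.
have := Hmc a b ab.
move/(congr1 (fun X => 2 *: X)); rewrite scalerA mulfV ?pnatr_eq0 // scale1r scaler0.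
have [_ Ta] := sigmaP dw Hx Hy tw a a; have [_ Tb] := sigmaP dw Hx Hy tw b b.
move=> /eqP; rewrite addrC subr_eq0 => /eqP Sab.
rewrite Sab in Tb.
have Daa : 'D_a ('D_a w) q = _ := second_derive k 0 k 0.
have Dbb : 'D_b ('D_b w) q = _ := second_derive (- (m * F / E)) m (- (m * F / E)) m.
rewrite Daa in Ta; rewrite Dbb in Tb.
have := tangent_vectorB dw Hx Hy Tb Ta.
rewrite opprB addrA subrK => /(tangent_vectorZ dw Hx Hy (E * G - F ^+ 2)).
congr tangent_vector; apply/rowP => i; rewrite !mxE.
move: (wxx 0 i) (wxy 0 i) (wyy 0 i) => X Y Z.
rewrite [X in _ * X](_ : _ = m ^+ 2 * (Z - 2 * (F / E) * Y + F ^+ 2 / E ^+ 2 * X) - k ^+ 2 * X);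
  last by field.
by rewrite mm kk; field; rewrite En Dn.
Qed.

(** Here [L], [N], [La], [K] stand for alpha', beta', alpha'', beta'' at the point, and the
    parameters are u and v. Subtracting a multiple of [L] from [La] and one of [N] from [K] gives
    the normal components [P] and [Q]. This preserves the lengths, as [L] is null and orthogonal to
    [La], and likewise [N] to [K]. *)
Lemma canonical_frame (L N La K : 'rV[R]_4) : ~ flat_point w q ->
  mink L L = 0 -> mink N N = 0 -> mink L N < 0 -> mink La L = 0 -> mink K N = 0 ->
  mink La La = 4^-1 -> mink K K = 4^-1 ->
  wx = L + N -> wy = L - N -> wxx = La + K -> wxy = La - K -> wyy = La + K ->
  exists a b n1 n2 nu mu,
    [/\ geometric_frame w q a b n1 n2 nu mu,
      (exists l, du w q = l *: 'D_a w q) /\ (exists l, dv w q = l *: 'D_b w q) &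
      [/\ Defs.coefE w q = - (Num.sqrt (mu ^+ 2 + nu ^+ 2))^-1, coefF w q = 0
      & coefG w q = (Num.sqrt (mu ^+ 2 + nu ^+ 2))^-1]].
Proof.
move=> nfl LL NN LN0 LaL KN LaLa KK wxE wyE wxxE wxyE wyyE.
set lam := mink L N in LN0; pose h := - 2 * lam.
have h0 : 0 < h by rewrite /h; lra.
have ln : lam != 0 by rewrite lt_eqF.
have Ewx : mink wx wx = - h by rewrite wxE !minkL (minkC N L) LL NN -/lam /h; ring.
have Ewy : mink wy wy = h by rewrite wyE !minkL (minkC N L) LL NN -/lam /h; ring.
have Exy : mink wx wy = 0 by rewrite wxE wyE !minkL (minkC N L) LL NN; ring.
pose P := La - (mink La N / lam) *: L; pose Q := K - (mink K L / lam) *: N.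
have NP : mink P L = 0 /\ mink P N = 0.
  by rewrite !minkL LaL LL -/lam; split; [ring|field].
have NQ : mink Q L = 0 /\ mink Q N = 0.
  by rewrite !minkL KN NN (minkC N L) -/lam; split; [field|ring].
have PP : mink P P = 4^-1 by rewrite !minkL (minkC L La) LaL LL LaLa; ring.
have QQ : mink Q Q = 4^-1 by rewrite !minkL (minkC N K) KN NN KK; ring.
have nrm X : mink X L = 0 -> mink X N = 0 -> normal_vector w q X.
  by move=> XL XN; apply/(normal_vectorP dw Hx Hy); rewrite wxE wyE !minkL XL XN; split; ring.
have tanL : tangent_vector w q L.
  apply/(tangent_vectorP dw Hx Hy); exists 2^-1, 2^-1; rewrite wxE wyE.
  by apply/rowP => i; rewrite !mxE; field.
have tanN : tangent_vector w q N.
  apply/(tangent_vectorP dw Hx Hy); exists 2^-1, (- 2^-1); rewrite wxE wyE.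
  by apply/rowP => i; rewrite !mxE; field.
have c11E e : c11 w q e = mink (La + K) e by rewrite /c11 Hxx wxxE.
have c12E e : c12 w q e = mink (La - K) e by rewrite /c12 Hyx wxyE.
have c22E e : c22 w q e = mink (La + K) e by rewrite /c22 Hyy wyyE.
(* If P + Q were 0, the normal parts of w_uu and w_vv would vanish and that of w_uv would be twice
   that of [La], so the point would be flat. For P - Q the roles are exchanged. *)
have nPQ : P + Q != 0.
  apply/eqP => PQ0; apply: nfl; apply: (flat_pointI dw Hx Hy tw (V := La) (k1 := 0) (k2 := 2) (k3 := 0)).
  move=> e /(normal_vectorP dw Hx Hy)[]; rewrite wxE wyE !minkL => eL eN.
  have eL0 : mink L e = 0 by rewrite minkC; lra.
  have eN0 : mink N e = 0 by rewrite minkC; lra.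
  have Ke : mink K e = - mink La e.
    have : mink (P + Q) e = 0 by rewrite PQ0 mink0l.
    by rewrite !minkL eL0 eN0; lra.
  by rewrite c11E c12E c22E !minkL Ke; split; ring.
have nPmQ : P - Q != 0.
  apply/eqP => PQ0; apply: nfl; apply: (flat_pointI dw Hx Hy tw (V := La) (k1 := 2) (k2 := 0) (k3 := 2)).
  move=> e /(normal_vectorP dw Hx Hy)[]; rewrite wxE wyE !minkL => eL eN.
  have eL0 : mink L e = 0 by rewrite minkC; lra.
  have eN0 : mink N e = 0 by rewrite minkC; lra.
  have Ke : mink K e = mink La e.
    have : mink (P - Q) e = 0 by rewrite PQ0 mink0l.
    by rewrite !minkL eL0 eN0; lra.
  by rewrite c11E c12E c22E !minkL Ke; split; ring.
have NPQ : normal_vector w q (P + Q).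
  by apply: nrm; rewrite minkDl ?NP.1 ?NP.2 ?NQ.1 ?NQ.2 addr0.
have NPmQ : normal_vector w q (P - Q).
  by apply: nrm; rewrite minkDl minkNl ?NP.1 ?NP.2 ?NQ.1 ?NQ.2 subr0.
have tanPQ : tangent_vector w q (La + K - (P + Q)).
  have -> : La + K - (P + Q) = (mink La N / lam) *: L + (mink K L / lam) *: N.
    by apply/rowP => i; rewrite !mxE; ring.
  by apply: (tangent_vectorD dw Hx Hy); apply: (tangent_vectorZ dw Hx Hy).
have tanPmQ : tangent_vector w q (La - K - (P - Q)).
  have -> : La - K - (P - Q) = (mink La N / lam) *: L - (mink K L / lam) *: N.
    by apply/rowP => i; rewrite !mxE; ring.
  by apply: (tangent_vectorB dw Hx Hy); apply: (tangent_vectorZ dw Hx Hy).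
clearbody P Q.
have [n1 [Nn1 n11] PQE] := normal_normalize tw NPQ nPQ.
have [n2 [Nn2 n22] PmQE] := normal_normalize tw NPmQ nPmQ.
have g1 := normal_norm_gt0 tw NPQ nPQ; have g2 := normal_norm_gt0 tw NPmQ nPmQ.
set x := mink (P + Q) (P + Q) in PQE g1; set y := mink (P - Q) (P - Q) in PmQE g2.
have x0 : Num.sqrt x != 0 by rewrite gt_eqF // sqrtr_gt0.
have y0 : Num.sqrt y != 0 by rewrite gt_eqF // sqrtr_gt0.
(* Orthogonality of P + Q and P - Q amounts to equal lengths of [P] and [Q]. *)
have n12 : mink n1 n2 = 0.
  apply: (mulfI x0); apply: (mulfI y0); rewrite !mulr0 mulrA.
  rewrite [_ * Num.sqrt x]mulrC -mulrA -minkZr -minkZl -PQE -PmQE.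
  by rewrite !minkL (minkC Q P) PP QQ; ring.
(* The coordinate vectors have squares -h and h, so the same factor normalizes both. *)
pose k := Num.sqrt h^-1.
have kk : k ^+ 2 = h^-1 by rewrite sqr_sqrtr // invr_ge0 ltW.
have k0 : k != 0 by rewrite gt_eqF // sqrtr_gt0 invr_gt0.
pose a : plane := k *: e0 + 0 *: e1; pose b : plane := 0 *: e0 + k *: e1.
have Da : 'D_a w q = k *: wx by rewrite (tangent_of_comb dw Hx Hy) scale0r addr0.
have Db : 'D_b w q = k *: wy by rewrite (tangent_of_comb dw Hx Hy) scale0r add0r.
exists a, b, n1, n2, (k ^+ 2 * Num.sqrt x), (k ^+ 2 * Num.sqrt y).
have sig c d X Y : 'D_c ('D_d w) q = k ^+ 2 *: X -> normal_vector w q Y ->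
    tangent_vector w q (X - Y) -> sigma w q c d = k ^+ 2 *: Y.
  move=> DX NY TX; apply: (sigma_eq dw Hx Hy tw).
    by move=> c'; rewrite minkZl NY mulr0.
  by rewrite DX -scalerBr; apply: (tangent_vectorZ dw Hx Hy).
have hn : h != 0 by rewrite gt_eqF.
have munu : (k ^+ 2 * Num.sqrt y) ^+ 2 + (k ^+ 2 * Num.sqrt x) ^+ 2 = h^-1 ^+ 2.
  rewrite kk !exprMn (sqr_sqrtr (ltW g1)) (sqr_sqrtr (ltW g2)) -mulrDr.
  (* By the parallelogram law the sum is 2 (1/4 + 1/4). *)
  have -> : y + x = 1 by rewrite /x /y !minkL (minkC Q P) PP QQ; field.
  by rewrite mulr1.
rewrite /Defs.coefE /coefF /coefG Hx Hy munu sqrtr_sqr (ger0_norm (ltW _)) ?invr_gt0 // invrK.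
split=> //.
- split; first by rewrite /orthonormal_tangent Da Db !minkL Ewx Ewy Exy; split;
    [rewrite mulrA -expr2 kk mulrN mulVf|rewrite mulrA -expr2 kk mulVf|rewrite !mulr0].
  split; first by [].
  split.
  + rewrite -scalerA -PQE; apply: (sig _ _ (La + K)) => //.
    rewrite second_derive wxxE wxyE wyyE; apply/rowP => i; rewrite !mxE; ring.
  + rewrite -scalerA -PmQE; apply: (sig _ _ (La - K)) => //.
    rewrite second_derive wxxE wxyE wyyE; apply/rowP => i; rewrite !mxE; ring.
  + rewrite -scalerA -PQE; apply: (sig _ _ (La + K)) => //.
    rewrite second_derive wxxE wxyE wyyE; apply/rowP => i; rewrite !mxE; ring.
  + by rewrite !mulf_neq0 // expf_neq0.
- by rewrite Da Db; split; exists k^-1; rewrite scalerA mulVf // scale1r.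
Qed.

End SecondOrder.

(** * Null frames of a surface of zero mean curvature *)

Section NullDirections.
Context {R : realType}.
Local Notation e0 := (delta_mx 0 0 : 'rV[R]_2).
Local Notation e1 := (delta_mx 0 1 : 'rV[R]_2).
Local Notation plane := 'rV[R]_2.
Implicit Types (U : set plane).

Lemma derive_congr (V : normedModType R) U (f g : plane -> V) (q v : plane) :
  open U -> U q -> (forall p, U p -> f p = g p) -> 'D_v f q = 'D_v g q.
Proof.
move=> oU Uq fg; apply: near_eq_derive.
by apply: filterS (near_open oU Uq) => p; exact: fg.
Qed.

Lemma Ck_derivable (V : normedModType R) k U (f : plane -> V) q v :
  Ck_on k.+1 U f -> U q -> v = e0 \/ v = e1 -> derivable f q v.
Proof.
move=> Hf Uq [->|->]; first exact: Ck_derivable0 Hf Uq.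
exact: Ck_derivable1 Hf Uq.
Qed.

Lemma null_derive U (a : plane -> 'rV[R]_4) q v : open U -> U q ->
  (forall p, U p -> mink (a p) (a p) = 0) -> derivable a q v ->
  mink (a q) ('D_v a q) = 0.
Proof.
move=> oU Uq aa da.
have D := is_derive_mink da da.
have E : 'D_v (fun p => mink (a p) (a p)) q = 0.
  by rewrite (derive_congr (g := fun=> 0) v oU Uq aa) derive_cst.
move: E; rewrite (@derive_val _ _ _ _ _ _ _ D) (minkC ('D_v a q)).
by move: (mink _ _) => x; lra.
Qed.

(** Let X = a_y - (r1 a)_x. Symmetry of the mixed derivatives of w makes X equal also to -(b_y - (r2
    b)_x). A null field is orthogonal to its derivatives, so the first form shows that X is
    orthogonal to [a], the second that it is orthogonal to [b]. The last hypothesis, which expresses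
    H = 0, makes (r1 - r2) X a combination of [a] and [b]. On their span the product is
    nondegenerate, so X = 0. *)
Lemma null_codazzi_alg (a b ax ay bx b_y : 'rV[R]_4) (r1 r2 r1x r1y r2x r2y la ka : R) :
  mink a a = 0 -> mink b b = 0 -> mink a b != 0 -> r1 != r2 ->
  mink a ax = 0 -> mink a ay = 0 -> mink b bx = 0 -> mink b b_y = 0 ->
  ay + b_y = (r1x *: a + r1 *: ax) + (r2x *: b + r2 *: bx) ->
  ((r1y *: a + r1 *: ay) + (r2y *: b + r2 *: b_y)) - (r1 + r2) *: (ay + b_y) +
    (r1 * r2) *: (ax + bx) = la *: a + ka *: b ->
  ay = r1x *: a + r1 *: ax.
Proof.
move=> aa bb ab r12 aax aay bbx bby S H.
pose X := ay - (r1x *: a + r1 *: ax).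
have XS : X = - (b_y - (r2x *: b + r2 *: bx)).
  by apply/rowP => i; have /rowP/(_ i) := S; rewrite !mxE; lra.
have Xa : mink X a = 0 by rewrite !minkL aa (minkC ay) (minkC ax) aay aax; ring.
have Xb : mink X b = 0 by rewrite XS !minkL bb (minkC b_y) (minkC bx) bby bbx; ring.
have r0 : r1 - r2 != 0 by rewrite subr_eq0.
have [l [k XE]] : exists l k, X = l *: a + k *: b.
  exists ((la - r1y + r1 * r1x) / (r1 - r2) - r1x), ((ka - r2y + r1 * r2x) / (r1 - r2)).
  apply/rowP => i; have /rowP/(_ i) := S; have /rowP/(_ i) := H; rewrite !mxE.
  move: (a 0 i) (b 0 i) (ax 0 i) (ay 0 i) (bx 0 i) (b_y 0 i) => A B Ax Ay Bx By H1 S1.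
  apply: (mulfI r0).
  transitivity ((la * A + ka * B) - r1y * A - r2y * B + r1 * (r1x * A + r2x * B) - r1x * (r1 - r2) * A);
    last by field.
  have EB : By = r1x * A + r1 * Ax + (r2x * B + r2 * Bx) - Ay by lra.
  by rewrite -H1 EB; ring.
have k0 : k = 0.
  by apply: (mulIf ab); move: Xa; rewrite XE !minkL aa (minkC b a); lra.
have l0 : l = 0.
  by apply: (mulIf ab); move: Xb; rewrite XE !minkL bb; lra.
apply/eqP; rewrite -subr_eq0 -/X XE k0 l0 !scale0r addr0 //.
Qed.

Lemma Schwarz_row n U (f : plane -> 'rV[R]_n) q : open U -> smooth_on U f -> U q ->
  dv (du f) q = du (dv f) q.
Proof.
move=> oU Hf Uq; apply/rowP => i.
pose fi (p : plane) := f p 0 i.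
have Hfi k : Ck_on k U fi by exact: Ck_coord.
have Ex p : U p -> (du f p) 0 i = du fi p.
  by move=> Up; exact: derive_coord (Ck_derivable0 (Hf 1%N) Up).
have Ey p : U p -> (dv f p) 0 i = dv fi p.
  by move=> Up; exact: derive_coord (Ck_derivable1 (Hf 1%N) Up).
have n0 := near_open oU Uq.
rewrite [LHS](derive_coord _ (Ck_derivable1 (Ck_du (Hf 2%N)) Uq)).
rewrite [RHS](derive_coord _ (Ck_derivable0 (Ck_dv (Hf 2%N)) Uq)).
transitivity (dv (du fi) q); first exact: (derive_congr e1 oU Uq Ex).
transitivity (du (dv fi) q); last exact: (esym (derive_congr e0 oU Uq Ey)).
apply: (@Schwarz R fi q).
- apply: filterS n0 => p; exact: Ck_derivable0 (Hfi 1%N).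
- apply: filterS n0 => p; exact: Ck_derivable1 (Hfi 1%N).
- apply: filterS n0 => p; exact: Ck_derivable1 (Ck_du (Hfi 2%N)).
- apply: filterS n0 => p; exact: Ck_derivable0 (Ck_dv (Hfi 2%N)).
- exact: Ck_continuous (Ck_dv (Ck_du (Hfi 2%N))) Uq.
- exact: Ck_continuous (Ck_du (Ck_dv (Hfi 2%N))) Uq.
Qed.

Lemma derive_sum_eq n U (f a b : plane -> 'rV[R]_n) q v : open U -> U q ->
  (forall p, U p -> f p = a p + b p) -> derivable a q v -> derivable b q v ->
  'D_v f q = 'D_v a q + 'D_v b q.
Proof.
move=> oU Uq E da db; rewrite (derive_congr v oU Uq E).
exact: (@derive_val _ _ _ _ _ _ _ (is_deriveD (derivableP da) (derivableP db))).
Qed.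

Lemma derive_comb_eq n U (f a b : plane -> 'rV[R]_n) (r1 r2 : plane -> R) q v :
  open U -> U q -> (forall p, U p -> f p = r1 p *: a p + r2 p *: b p) ->
  derivable a q v -> derivable b q v -> derivable r1 q v -> derivable r2 q v ->
  'D_v f q = ('D_v r1 q *: a q + r1 q *: 'D_v a q) + ('D_v r2 q *: b q + r2 q *: 'D_v b q).
Proof.
move=> oU Uq E da db d1 d2; rewrite (derive_congr v oU Uq E).
exact: (@derive_val _ _ _ _ _ _ _ (is_deriveD (is_derive_scale d1 da) (is_derive_scale d2 db))).
Qed.

(** The last clause is the equation H = 0 divided by E, as r1 + r2 = 2F / E and r1 r2 = G / E. In
    this form the predicate is symmetric in (a, r1) and (b, r2), so that results proved for [a] pass
    to [b] by [null_frame_sym]. *)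
Definition null_frame (U : set plane) (w a b : plane -> 'rV[R]_4) (r1 r2 : plane -> R) : Prop :=
  [/\ smooth_on U w, smooth_on U a /\ smooth_on U b, smooth_on U r1 /\ smooth_on U r2,
    forall p, U p -> du w p = a p + b p /\ dv w p = r1 p *: a p + r2 p *: b p &
    forall p, U p -> [/\ mink (a p) (a p) = 0, mink (b p) (b p) = 0,
      mink (a p) (b p) != 0, r1 p != r2 p &
      tangent_vector w p (dv (dv w) p - (r1 p + r2 p) *: du (dv w) p +
        (r1 p * r2 p) *: du (du w) p)]].

Lemma null_frame_sym U w a b r1 r2 : null_frame U w a b r1 r2 -> null_frame U w b a r2 r1.
Proof.
move=> [Hw [Ha Hb] [H1 H2] E F]; split=> //.
  by move=> p /E[-> ->]; split; rewrite addrC.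
move=> p /F[aa bb ab r12 T]; split=> //; first by rewrite minkC.
  by rewrite eq_sym.
by rewrite (addrC (r2 p)) (mulrC (r2 p)).
Qed.

Lemma null_frame_second U w a b r1 r2 q : open U -> null_frame U w a b r1 r2 -> U q ->
  [/\ du (du w) q = du a q + du b q, dv (du w) q = dv a q + dv b q,
    du (dv w) q = (du r1 q *: a q + r1 q *: du a q) + (du r2 q *: b q + r2 q *: du b q) &
    dv (dv w) q = (dv r1 q *: a q + r1 q *: dv a q) + (dv r2 q *: b q + r2 q *: dv b q)].
Proof.
move=> oU [Hw [Ha Hb] [H1 H2] E F] Uq.
have Eu p : U p -> du w p = a p + b p by move=> /E[].
have Ev p : U p -> dv w p = r1 p *: a p + r2 p *: b p by move=> /E[].
have d0 (V : normedModType R) (f : plane -> V) : smooth_on U f -> derivable f q e0.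
  by move=> Hf; exact: Ck_derivable0 (Hf 1%N) Uq.
have d1 (V : normedModType R) (f : plane -> V) : smooth_on U f -> derivable f q e1.
  by move=> Hf; exact: Ck_derivable1 (Hf 1%N) Uq.
split.
- exact: (derive_sum_eq oU Uq Eu (d0 _ _ Ha) (d0 _ _ Hb)).
- exact: (derive_sum_eq oU Uq Eu (d1 _ _ Ha) (d1 _ _ Hb)).
- exact: (derive_comb_eq oU Uq Ev (d0 _ _ Ha) (d0 _ _ Hb) (d0 _ _ H1) (d0 _ _ H2)).
- exact: (derive_comb_eq oU Uq Ev (d1 _ _ Ha) (d1 _ _ Hb) (d1 _ _ H1) (d1 _ _ H2)).
Qed.

Lemma eq_subst3 (T : Type) (P : T -> T -> T -> Prop) (x y z x' y' z' : T) :
  x = x' -> y = y' -> z = z' -> P x y z -> P x' y' z'.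
Proof. by move=> -> -> ->. Qed.

(** Equivalently, the vector-valued form a dx + r1 a dy is closed: it is d alpha, one of the two
    summands of dw. *)
Lemma null_codazzi U w a b r1 r2 q : open U -> null_frame U w a b r1 r2 -> U q ->
  dv a q = du r1 q *: a q + r1 q *: du a q.
Proof.
move=> oU nf Uq; have [Exx Eyx Exy Eyy] := null_frame_second oU nf Uq.
have [Hw [Ha Hb] _ E F] := nf.
have [Eu Ev] := E q Uq; have [aa bb ab r12 T] := F q Uq.
have dw := Ck_differentiable oU (Hw 1%N) Uq.
have /(tangent_vectorP dw Eu Ev)[la [ka {}T]] := T.
have S := Schwarz_row oU Hw Uq; rewrite Eyx Exy in S.
have na p : U p -> mink (a p) (a p) = 0 by move=> /F[].
have nb p : U p -> mink (b p) (b p) = 0 by move=> /F[].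
have ax := null_derive oU Uq na (Ck_derivable0 (Ha 1%N) Uq).
have ay := null_derive oU Uq na (Ck_derivable1 (Ha 1%N) Uq).
have bx := null_derive oU Uq nb (Ck_derivable0 (Hb 1%N) Uq).
have bY := null_derive oU Uq nb (Ck_derivable1 (Hb 1%N) Uq).
(* The coefficients are the coordinates of la w_x + ka w_y in the basis (a, b). *)
apply: (null_codazzi_alg aa bb ab r12 ax ay bx bY S
  (la := la + ka * r1 q) (ka := la + ka * r2 q) (r1y := dv r1 q) (r2y := dv r2 q)).
have {}T : _ - (r1 q + r2 q) *: _ + (r1 q * r2 q) *: _ = _ :=
  @eq_subst3 'rV[R]_4 (fun X Y Z => Z - (r1 q + r2 q) *: Y + (r1 q * r2 q) *: X =
    la *: (a q + b q) + ka *: (r1 q *: a q + r2 q *: b q)) _ _ _ _ _ _ Exx (etrans Exy (esym S)) Eyy T.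
rewrite T.
rewrite scalerDr scalerDr !scalerA !scalerDl; exact: addrACA.
Qed.

(** The tangential part of a_x is orthogonal to [a], hence a multiple of the null vector [a]; it
    contributes nothing to <a_x, a_x>, which is therefore the square of the normal part. If the
    normal part were zero, all second derivatives of [w] would be multiples of b_x modulo tangent
    vectors. *)
Lemma null_accel_gt0 U w a b r1 r2 q : open U -> null_frame U w a b r1 r2 -> U q ->
  timelike_at w q -> ~ flat_point w q -> 0 < mink (du a q) (du a q).
Proof.
move=> oU nf Uq tw nfl; have [Exx Eyx Exy Eyy] := null_frame_second oU nf Uq.
have [Hw [Ha Hb] _ E F] := nf.
have [Eu Ev] := E q Uq; have [aa bb ab r12 T] := F q Uq.
have dw := Ck_differentiable oU (Hw 1%N) Uq.
have na p : U p -> mink (a p) (a p) = 0 by move=> /F[].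
have aax := null_derive oU Uq na (Ck_derivable0 (Ha 1%N) Uq).
have ayE := null_codazzi oU nf Uq; have byE := null_codazzi oU (null_frame_sym nf) Uq.
have {aax} aax : mink (a q) (du a q) = 0 by exact: aax.
have c11E e : c11 w q e = mink (du a q + du b q) e by rewrite /c11 Exx.
have c12E e : c12 w q e = mink (dv a q + dv b q) e by rewrite /c12 Eyx.
have c22E e : c22 w q e = mink ((dv r1 q *: a q + r1 q *: dv a q) +
  (dv r2 q *: b q + r2 q *: dv b q)) e by rewrite /c22 Eyy.
move: (dv a q) (dv b q) ayE byE c12E c22E => ay b_y -> -> c12E c22E.
move: (du a q) (du b q) aax c11E c12E c22E => ax bx aax c11E c12E c22E {Exx Eyx Exy Eyy}.
have norm_ab N : normal_vector w q N -> mink N (a q) = 0 /\ mink N (b q) = 0.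
  move=> /(normal_vectorP dw Eu Ev)[]; rewrite !minkL.
  move: (mink N (a q)) (mink N (b q)) => x y H1 H2.
  have r0 : r1 q - r2 q != 0 by rewrite subr_eq0.
  have x0 : x = 0 by apply: (mulfI r0); rewrite mulr0 -H2 (_ : y = - x); [ring|lra].
  by rewrite x0 in H1 *; split=> //; lra.
have [Y /(tangent_vectorP dw Eu Ev)[l [k YE]] NY] := tangent_projection dw Eu Ev tw ax.
have [Na Nb] := norm_ab _ NY.
have {}YE : Y = (l + k * r1 q) *: a q + (l + k * r2 q) *: b q.
  by rewrite YE; apply/rowP => i; rewrite !mxE; ring.
set l' := l + k * r1 q in YE; set k' := l + k * r2 q in YE.
have k0 : k' = 0.
  apply: (mulIf ab); rewrite mul0r.
  by move: Na; rewrite YE !minkL (minkC ax) aax (minkC (b q)) aa; lra.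
rewrite k0 scale0r addr0 in YE.
have [N0|N0] := eqVneq (ax - Y) 0; last first.
  have := normal_norm_gt0 tw NY N0; congr (0 < _).
  by rewrite YE !minkL (minkC ax) aax aa; ring.
case: nfl; have axE : ax = l' *: a q by apply/eqP; rewrite -subr_eq0 -YE N0.
(* By [null_codazzi], w_xx, w_xy and w_yy are b_x, r2 b_x and r2^2 b_x modulo tangent vectors. *)
apply: (flat_pointI dw Eu Ev tw (V := bx) (k1 := 1) (k2 := r2 q) (k3 := r2 q ^+ 2)).
move=> e /norm_ab[ea eb].
have ae : mink (a q) e = 0 by rewrite minkC.
have be : mink (b q) e = 0 by rewrite minkC.
by rewrite c11E c12E c22E axE !minkL ae be; split; ring.
Qed.

End NullDirections.

(** * The null curve generated by one null direction *)

Section NullCurve.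
Context {R : realType}.
Local Notation e0 := (delta_mx 0 0 : 'rV[R]_2).
Local Notation e1 := (delta_mx 0 1 : 'rV[R]_2).
Local Notation plane := 'rV[R]_2.
Variables (U : set plane) (a : plane -> 'rV[R]_4) (r : plane -> R).
Hypotheses (oU : open U) (Ha : smooth_on U a) (Hr : smooth_on U r).
Hypothesis aa : forall p, U p -> mink (a p) (a p) = 0.
Hypothesis codazzi : forall p, U p -> dv a p = du r p *: a p + r p *: du a p.
Hypothesis accel : forall p, U p -> 0 < mink (du a p) (du a p).

(** This is p = s_x, and [unit_null] is alpha' as a function of (x, y). The fourth root comes from
    alpha'' = a_x / p^2 modulo [a], so that <alpha'', alpha''> = D / p^4; the factor 4 makes this
    1/4. *)
Definition null_speed (p : plane) : R := Num.sqrt (Num.sqrt (4 * mink (du a p) (du a p))).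
Definition unit_null (p : plane) : 'rV[R]_4 := (null_speed p)^-1 *: a p.

Lemma null_accel_smooth : smooth_on U (fun p => 4 * mink (du a p) (du a p)).
Proof.
move=> k; exact: (CkM oU (Ck_cst k U (4 : R)) (Ck_mink oU (Ck_du (Ha k.+1)) (Ck_du (Ha k.+1)))).
Qed.

Lemma accel4 p : U p -> 0 < 4 * mink (du a p) (du a p).
Proof. by move=> Up; rewrite mulr_gt0 // accel. Qed.

Lemma null_speed_gt0 p : U p -> 0 < null_speed p.
Proof. by move=> Up; rewrite !sqrtr_gt0 accel4. Qed.

Lemma null_speed_smooth : smooth_on U null_speed.
Proof.
move=> k; apply: (Ck_sqrt oU); first by move=> p Up; rewrite sqrtr_gt0 accel4.
by apply: (Ck_sqrt oU) (null_accel_smooth k) => p; exact: accel4.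
Qed.

Lemma null_speed_pow4 p : U p -> null_speed p ^+ 4 = 4 * mink (du a p) (du a p).
Proof.
move=> Up; rewrite (exprM _ 2 2) sqr_sqrtr ?sqrtr_ge0 // sqr_sqrtr // ltW //.
exact: accel4.
Qed.

Lemma unit_null_smooth : smooth_on U unit_null.
Proof.
move=> k; apply: (CkZ oU _ (Ha k)); apply: (CkV oU _ (null_speed_smooth k)).
by move=> p Up; rewrite gt_eqF // null_speed_gt0.
Qed.

Lemma derive_null_speed p v : U p -> derivable (du a) p v ->
  'D_v null_speed p = 2 * mink (du a p) ('D_v (du a) p) / null_speed p ^+ 3.
Proof.
move=> Up da; have D4 := accel4 Up.
have D := is_deriveZ 4 (is_derive_mink da da).
have s1 : 0 < Num.sqrt (4 * mink (du a p) (du a p)) by rewrite sqrtr_gt0.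
have H1 := is_derive_sqrt_comp (f := fun p => 4 * mink (du a p) (du a p)) D4
  (@ex_derive _ _ _ _ _ _ _ D).
have H2 := is_derive_sqrt_comp (f := fun p => Num.sqrt (4 * mink (du a p) (du a p))) s1
  (@ex_derive _ _ _ _ _ _ _ H1).
rewrite [LHS](@derive_val _ _ _ _ _ _ _ H2)
  (@derive_val _ _ _ _ _ _ _ H1) (@derive_val _ _ _ _ _ _ _ D).
rewrite -[X in _ = X / _]/(2 * mink (du a p) ('D_v (du a) p)) -/(null_speed p).
have sp := null_speed_gt0 Up.
have -> : Num.sqrt (4 * mink (du a p) (du a p)) = null_speed p ^+ 2.
  by rewrite sqr_sqrtr // sqrtr_ge0.
rewrite (minkC ('D_v (du a) p)); move: (mink (du a p) ('D_v (du a) p)) => m.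
rewrite [4 *: _](_ : _ = 4 * (m + m)) //; field; rewrite gt_eqF //.
Qed.

Lemma unit_null_null p : U p -> mink (unit_null p) (unit_null p) = 0.
Proof. by move=> Up; rewrite !minkL aa // !mulr0. Qed.

(** Differentiating [codazzi] in x and pairing with a_x removes the term in r_xx, since [a] is
    orthogonal to a_x. The fourth root then turns the coefficient 4 of D r_x into 1, as p^3 p_y =
    D_y. *)
Lemma null_speed_closed p : U p ->
  dv null_speed p = du r p * null_speed p + r p * du null_speed p.
Proof.
move=> Up.
have dx := Ck_derivable0 (Ck_du (Ha 2%N)) Up.
have dy := Ck_derivable1 (Ck_du (Ha 2%N)) Up.
have dax := Ck_derivable0 (Ha 1%N) Up.
have drx := Ck_derivable0 (Ck_du (Hr 2%N)) Up.
have dr := Ck_derivable0 (Hr 1%N) Up.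
have Exy : dv (du a) p = (du (du r) p *: a p + du r p *: du a p) +
    (du r p *: du a p + r p *: du (du a) p).
  rewrite (Schwarz_row oU Ha Up) [LHS](derive_congr e0 oU Up codazzi).
  exact: (@derive_val _ _ _ _ _ _ _ (is_deriveD (is_derive_scale drx dax) (is_derive_scale dr dx))).
have aax : mink (a p) (du a p) = 0 := null_derive oU Up aa dax.
have Ey : dv null_speed p = _ := derive_null_speed Up dy.
have Ex : du null_speed p = _ := derive_null_speed Up dx.
rewrite Ey Ex -/(dv (du a) p) Exy -/(du (du a) p).
have E4 := null_speed_pow4 Up; have sp := null_speed_gt0 Up.
move: (du (du a) p) (du a p) aax E4 => axx ax aax E4.
rewrite !minkL (minkC ax) aax.
have -> : mink ax ax = null_speed p ^+ 4 / 4 by rewrite E4; field.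
by field; rewrite gt_eqF.
Qed.

Lemma derive_unit_null p v : U p -> derivable null_speed p v -> derivable a p v ->
  'D_v unit_null p = (- ('D_v null_speed p / null_speed p ^+ 2)) *: a p +
    (null_speed p)^-1 *: 'D_v a p.
Proof.
move=> Up ds da; have s0 : null_speed p != 0 by rewrite gt_eqF // null_speed_gt0.
have D := is_derive_scale (derivableV s0 ds) da.
rewrite [LHS](@derive_val _ _ _ _ _ _ _ D) (deriveV s0 ds); congr (_ *: _ + _).
by rewrite /GRing.scale /= mulNr mulrC.
Qed.

Lemma unit_null_alg (A Ax : 'rV[R]_4) (s sx rx r' : R) : s != 0 ->
  (- ((rx * s + r' * sx) / s ^+ 2)) *: A + s^-1 *: (rx *: A + r' *: Ax) =
  r' *: ((- (sx / s ^+ 2)) *: A + s^-1 *: Ax).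
Proof. by move=> s0; apply/rowP => i; rewrite !mxE; field. Qed.

(** Division by p cancels the term r_x a. The gradient of [unit_null] becomes proportional to (1,
    r), as is the gradient (p, r p) of s: [unit_null] is a function of s alone. *)
Lemma unit_null_codazzi p : U p -> dv unit_null p = r p *: du unit_null p.
Proof.
move=> Up; have s0 : null_speed p != 0 by rewrite gt_eqF // null_speed_gt0.
have Ex := derive_unit_null Up
  (Ck_derivable0 (null_speed_smooth 1%N) Up) (Ck_derivable0 (Ha 1%N) Up).
have Ey := derive_unit_null Up
  (Ck_derivable1 (null_speed_smooth 1%N) Up) (Ck_derivable1 (Ha 1%N) Up).
have Ey' := congr2 (fun x Y => (- (x / null_speed p ^+ 2)) *: a p + (null_speed p)^-1 *: Y)
  (null_speed_closed Up) (codazzi Up).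
apply: (etrans Ey); apply: (etrans Ey'); apply: (etrans (unit_null_alg _ _ _ _ _ s0)).
exact: (congr1 (fun X => r p *: X) (esym Ex)).
Qed.

(** On functions of s, p^-1 d/dx is differentiation with respect to s. The term where 1 / p is
    differentiated is a multiple of [a], null and orthogonal to a_x, so only D / p^4 remains. *)
Lemma unit_null_accel p : U p ->
  mink (unit_null p) (du unit_null p) = 0 /\
  mink ((null_speed p)^-1 *: du unit_null p) ((null_speed p)^-1 *: du unit_null p) = 4^-1.
Proof.
move=> Up; split.
  exact: (null_derive oU Up unit_null_null (Ck_derivable0 (unit_null_smooth 1%N) Up)).
have Ex : du unit_null p = _ := derive_unit_null Up
  (Ck_derivable0 (null_speed_smooth 1%N) Up) (Ck_derivable0 (Ha 1%N) Up).
have aax : mink (a p) (du a p) = 0 := null_derive oU Up aa (Ck_derivable0 (Ha 1%N) Up).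
have E4 := null_speed_pow4 Up; have sp := null_speed_gt0 Up.
rewrite Ex -/(du a p) -/(du null_speed p); move: (du null_speed p) => sx.
rewrite !minkL (minkC (du a p) (a p)) aax (aa Up).
have -> : mink (du a p) (du a p) = null_speed p ^+ 4 / 4 by rewrite E4; field.
by field; rewrite gt_eqF.
Qed.

End NullCurve.

(** * Canonical coordinates *)

Section NullFrame.
Context {R : realType}.
Local Notation e0 := (delta_mx 0 0 : 'rV[R]_2).
Local Notation e1 := (delta_mx 0 1 : 'rV[R]_2).
Local Notation plane := 'rV[R]_2.
Implicit Types (U : set plane).

Lemma CkB_row n k U (f g : plane -> 'rV[R]_n) : open U ->
  Ck_on k U f -> Ck_on k U g -> Ck_on k U (fun q => f q - g q).
Proof.
move=> oU Hf Hg.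
apply: Ck_congr oU _ (CkD oU Hf (CkZ oU (Ck_cst k U (-1 : R)) Hg)) => q _.
by rewrite scaleN1r.
Qed.

(** The polynomial E r^2 - 2F r + G is the square of the vector r w_x - w_y, so each root gives a
    null direction; W^2 is a quarter of the discriminant. The value <a, b> = E / 2 provides the sign
    that makes u timelike. *)
Lemma null_pair_alg (wx wy : 'rV[R]_4) (W : R) :
  let E := mink wx wx in let F := mink wx wy in let G := mink wy wy in
  let r1 := (F - W) / E in let r2 := (F + W) / E in
  let a := (r2 - r1)^-1 *: (r2 *: wx - wy) in
  let b := (r2 - r1)^-1 *: (wy - r1 *: wx) in
  E < 0 -> W != 0 -> W ^+ 2 = F ^+ 2 - E * G ->
  [/\ wx = a + b, wy = r1 *: a + r2 *: b &
    [/\ mink a a = 0, mink b b = 0, mink a b < 0, r1 != r2 &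
      2 * F = E * (r1 + r2) /\ G = E * (r1 * r2)]].
Proof.
move=> E F G r1 r2 a b E0 W0 WW.
have En : E != 0 by rewrite lt_eqF.
have r12 : r2 - r1 = 2 * W / E by rewrite /r1 /r2; field.
have rn : r2 - r1 != 0 by rewrite r12 !mulf_neq0 ?invr_eq0 // pnatr_eq0.
have WW' : W * W = F * F - E * G by rewrite -expr2 WW expr2.
(* Eliminating [G] in favour of [W] leaves rational identities in independent quantities. *)
have HG : G = (F * F - W * W) / E by rewrite WW'; field.
have Hab : mink a b = E / 2.
  rewrite /a /b !minkL (minkC wy wx) -/E -/F -/G r12 HG /r1 /r2; field.
  by rewrite W0 En.
split.
- by apply/rowP => i; rewrite !mxE; field.
- by apply/rowP => i; rewrite !mxE; field.
- split.
  + rewrite /a !minkL (minkC wy wx) -/E -/F -/G r12 HG /r1 /r2; field.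
    by rewrite W0 En.
  + rewrite /b !minkL (minkC wy wx) -/E -/F -/G r12 HG /r1 /r2; field.
    by rewrite W0 En.
  + by rewrite Hab; lra.
  + by rewrite eq_sym -subr_eq0.
  + by split; [rewrite /r1 /r2; field|rewrite HG /r1 /r2; field].
Qed.

Lemma rescale_combination (X Y Z : 'rV[R]_4) (e f g s m : R) : e != 0 ->
  2 * f = e * s -> g = e * m ->
  e^-1 *: (e *: Z - (2 * f) *: Y + g *: X) = Z - s *: Y + m *: X.
Proof. by move=> en -> ->; apply/rowP => i; rewrite !mxE; field. Qed.

Lemma exists_null_frame U (w : plane -> 'rV[R]_4) : open U -> smooth_on U w ->
  (forall p, U p -> timelike_at w p) ->
  (forall p, U p -> zero_mean_curvature_at w p) ->
  (forall p, U p -> mink (du w p) (du w p) < 0) ->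
  exists a b r1 r2, null_frame U w a b r1 r2 /\ forall p, U p -> mink (a p) (b p) < 0.
Proof.
move=> oU Hw tw hw E0.
pose E p := mink (du w p) (du w p); pose F p := mink (du w p) (dv w p).
pose G p := mink (dv w p) (dv w p); pose W p := Num.sqrt (F p * F p - E p * G p).
pose r1 p := (F p - W p) / E p; pose r2 p := (F p + W p) / E p.
pose a p := (r2 p - r1 p)^-1 *: (r2 p *: du w p - dv w p).
pose b p := (r2 p - r1 p)^-1 *: (dv w p - r1 p *: du w p).
have disc p : U p -> 0 < F p * F p - E p * G p.
  move=> Up; have : E p * G p - F p ^+ 2 < 0.
    exact: (timelike_disc (Ck_differentiable oU (Hw 1%N) Up) erefl erefl (tw p Up)).
  by rewrite expr2; move: (E p) (F p) (G p) => ? ? ?; lra.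
have W0 p : U p -> W p != 0 by move=> Up; rewrite gt_eqF // sqrtr_gt0 disc.
have WW p : U p -> W p ^+ 2 = F p ^+ 2 - E p * G p.
  by move=> Up; rewrite sqr_sqrtr ?expr2 // ltW // disc.
have En p : U p -> E p != 0 by move=> Up; rewrite lt_eqF // E0.
have A p (Up : U p) := null_pair_alg (E0 p Up) (W0 p Up) (WW p Up).
have r0 p : U p -> r2 p - r1 p != 0.
  by move=> Up; have [_ _ [_ _ _ r12 _]] := A p Up; rewrite subr_eq0 eq_sym.
have Hx k := Ck_du (Hw k.+1); have Hy k := Ck_dv (Hw k.+1).
have HE k : Ck_on k U E by exact: (Ck_mink oU (Hx k) (Hx k)).
have HF k : Ck_on k U F by exact: (Ck_mink oU (Hx k) (Hy k)).
have HG k : Ck_on k U G by exact: (Ck_mink oU (Hy k) (Hy k)).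
have HW k : Ck_on k U W.
  apply: (Ck_sqrt oU disc); exact: (CkB oU (CkM oU (HF k) (HF k)) (CkM oU (HE k) (HG k))).
have H1 k : Ck_on k U r1 by exact: (Ck_div oU En (CkB oU (HF k) (HW k)) (HE k)).
have H2 k : Ck_on k U r2 by exact: (Ck_div oU En (CkD oU (HF k) (HW k)) (HE k)).
have Hr k := CkV oU r0 (CkB oU (H2 k) (H1 k)).
have Ha k : Ck_on k U a by exact: (CkZ oU (Hr k) (CkB_row oU (CkZ oU (H2 k) (Hx k)) (Hy k))).
have Hb k : Ck_on k U b by exact: (CkZ oU (Hr k) (CkB_row oU (Hy k) (CkZ oU (H1 k) (Hx k)))).
exists a, b, r1, r2; split; last by move=> p Up; have [_ _ []] := A p Up.
split=> //; first by move=> p Up; have [] := A p Up.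
move=> p Up; have [_ _ [aa bb ab r12 [S Pr]]] := A p Up; split=> //.
  by rewrite lt_eqF.
have dw := Ck_differentiable oU (Hw 1%N) Up.
have := mean_curvature_tangent oU Up Hw erefl erefl erefl erefl
  (Schwarz_row oU Hw Up) erefl (tw p Up) (E0 p Up) (hw p Up).
move=> /(tangent_vectorZ dw erefl erefl (E p)^-1); congr tangent_vector.
exact: (rescale_combination _ _ _ (En p Up) S Pr).
Qed.

(** Partial derivatives alone do not make [f] continuous; continuity comes from differentiability,
    which follows from the continuity of [P] and [Q]. *)
Lemma smooth_of_gradient U (f P Q : plane -> R) : open U ->
  (forall p, U p -> is_derive p e0 f (P p) /\ is_derive p e1 f (Q p)) ->
  smooth_on U P -> smooth_on U Q -> smooth_on U f.
Proof.
move=> oU D HP HQ.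
have Ex p : U p -> P p = du f p by move=> /D[D0 _]; rewrite -(@derive_val _ _ _ _ _ _ _ D0).
have Ey p : U p -> Q p = dv f p by move=> /D[_ D1]; rewrite -(@derive_val _ _ _ _ _ _ _ D1).
have d0 p : U p -> derivable f p e0 by move=> /D[D0 _]; exact: (@ex_derive _ _ _ _ _ _ _ D0).
have d1 p : U p -> derivable f p e1 by move=> /D[_ D1]; exact: (@ex_derive _ _ _ _ _ _ _ D1).
have Cx k : Ck_on k U (du f) by apply: Ck_congr oU Ex (HP k).
have Cy k : Ck_on k U (dv f) by apply: Ck_congr oU Ey (HQ k).
have cf p : U p -> {for p, continuous f}.
  move=> Up; apply: differentiable_continuous; apply: C1_differentiable.
  - apply: filterS (near_open oU Up); exact: d0.
  - apply: filterS (near_open oU Up); exact: d1.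
  - exact: Ck_continuous (Cx 0%N) Up.
  - exact: Ck_continuous (Cy 0%N) Up.
by case=> [|k]; [exact: (C0P cf)|exact: (CkS cf d0 d1 (Cx k) (Cy k))].
Qed.

End NullFrame.

Section CanonicalCoordinates.
Context {R : realType}.
Local Notation e0 := (delta_mx 0 0 : 'rV[R]_2).
Local Notation e1 := (delta_mx 0 1 : 'rV[R]_2).
Local Notation plane := 'rV[R]_2.
Implicit Types (U : set plane).

Lemma derive_coord_sum (y v : plane) : is_derive y v (fun z : plane => z 0 0 + z 0 1) (v 0 0 + v 0 1).
Proof. exact: (is_deriveD (is_derive_coord y v 0) (is_derive_coord y v 1)). Qed.

Lemma derive_coord_diff (y v : plane) : is_derive y v (fun z : plane => z 0 0 - z 0 1) (v 0 0 - v 0 1).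
Proof. exact: (is_deriveB (is_derive_coord y v 0) (is_derive_coord y v 1)). Qed.

Lemma derive_comp_plane n U (f : plane -> 'rV[R]_n) (g : plane -> plane) y v : open U ->
  smooth_on U f -> U (g y) -> derivable g y v ->
  'D_v (f \o g) y = ('D_v g y) 0 0 *: du f (g y) + ('D_v g y) 0 1 *: dv f (g y).
Proof.
move=> oU Hf Ugy dg; have df := Ck_differentiable oU (Hf 1%N) Ugy.
rewrite (@derive_val _ _ _ _ _ _ _ (is_derive_comp_diff df dg)) -deriveE //.
exact: derive_dir.
Qed.

Lemma derive_comp_planeR U (f : plane -> R) (g : plane -> plane) y v : open U ->
  smooth_on U f -> U (g y) -> derivable g y v ->
  'D_v (f \o g) y = ('D_v g y) 0 0 * du f (g y) + ('D_v g y) 0 1 * dv f (g y).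
Proof.
move=> oU Hf Ugy dg; have df := C1_differentiableR oU (Hf 1%N) Ugy.
rewrite (@derive_val _ _ _ _ _ _ _ (is_derive_comp_diff df dg)) -deriveE //.
exact: derive_dir.
Qed.

(* A function whose gradient is proportional to that of the null coordinate [s]
   depends on [s] only. *)
Lemma derive_null_comp n U (f : plane -> 'rV[R]_n) (s p r : plane -> R)
    (g : plane -> plane) y v :
  open U -> smooth_on U f -> smooth_on U s -> U (g y) -> derivable g y v ->
  du s (g y) = p (g y) -> dv s (g y) = r (g y) * p (g y) -> p (g y) != 0 ->
  dv f (g y) = r (g y) *: du f (g y) ->
  'D_v (f \o g) y = 'D_v (s \o g) y *: ((p (g y))^-1 *: du f (g y)).
Proof.
move=> oU Hf Hs Ugy dg sx sy p0 fy.
have Ef := derive_comp_plane oU Hf Ugy dg.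
have Es := derive_comp_planeR oU Hs Ugy dg.
rewrite Ef Es fy sx sy.
move: (('D_v g y) 0 0) (('D_v g y) 0 1) (du f (g y)) (p (g y)) p0 (r (g y)) => al be X q0 qn r0.
by apply/rowP => i; rewrite !mxE; field.
Qed.

Lemma smooth_comp n U V (f : plane -> 'rV[R]_n) (g : plane -> plane) :
  open U -> open V -> (forall y, V y -> U (g y)) -> smooth_on U f -> smooth_on V g ->
  smooth_on V (f \o g).
Proof. by move=> oU oV VU Hf Hg k; apply: (Ck_comp_row oU oV VU (Hf k) (Hg k)). Qed.

Lemma null_independent (X Y : 'rV[R]_4) (x y : R) : mink X X = 0 -> mink Y Y = 0 ->
  mink X Y < 0 -> x *: X + y *: Y = 0 -> x = 0 /\ y = 0.
Proof.
move=> XX YY XY H.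
have := congr1 (mink X) H; have := congr1 (mink Y) H.
rewrite !minkL (minkC Y X) XX YY !mulr0 addr0 add0r.
move=> /eqP; rewrite mulf_eq0 (lt_eqF XY) orbF => /eqP A.
by move=> /eqP; rewrite mulf_eq0 (lt_eqF XY) orbF => /eqP B.
Qed.

Lemma scale_eq1D (X Y : 'rV[R]_4) (x y : R) : x = 1 -> y = 1 -> x *: X + y *: Y = X + Y.
Proof. by move=> -> ->; rewrite !scale1r. Qed.

Lemma scale_eq1B (X Y : 'rV[R]_4) (x y : R) : x = 1 -> y = 1 -> x *: X - y *: Y = X - Y.
Proof. by move=> -> ->; rewrite !scale1r. Qed.

(** * The surface in the coordinates u and v, with s = u + v and t = u - v *)

Section PullBack.
Variables (U V : set plane) (w a b : plane -> 'rV[R]_4) (r1 r2 s t : plane -> R).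
Variable g : plane -> plane.
Hypotheses (oU : open U) (oV : open V) (VU : forall y, V y -> U (g y)).
Hypotheses (Hg : smooth_on V g) (nf : null_frame U w a b r1 r2).
Hypothesis ab : forall p, U p -> mink (a p) (b p) < 0.
Hypotheses (pa : forall p, U p -> 0 < mink (du a p) (du a p)).
Hypotheses (pb : forall p, U p -> 0 < mink (du b p) (du b p)).
Hypotheses (Hs : smooth_on U s) (Ht : smooth_on U t).
Hypothesis ds : forall p, U p -> du s p = null_speed a p /\ dv s p = r1 p * null_speed a p.
Hypothesis dt : forall p, U p -> du t p = null_speed b p /\ dv t p = r2 p * null_speed b p.
Hypothesis sg : forall y, V y -> s (g y) = y 0 0 + y 0 1.
Hypothesis tg : forall y, V y -> t (g y) = y 0 0 - y 0 1.

Let Hw : smooth_on U w. Proof. by case: nf. Qed.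
Let Ha : smooth_on U a. Proof. by case: nf => _ []. Qed.
Let Hb : smooth_on U b. Proof. by case: nf => _ []. Qed.
Let H1 : smooth_on U r1. Proof. by case: nf => _ _ []. Qed.
Let H2 : smooth_on U r2. Proof. by case: nf => _ _ []. Qed.
Let aa p : U p -> mink (a p) (a p) = 0. Proof. by case: nf => _ _ _ _ F /F[]. Qed.
Let bb p : U p -> mink (b p) (b p) = 0. Proof. by case: nf => _ _ _ _ F /F[]. Qed.
Let ca p : U p -> dv a p = du r1 p *: a p + r1 p *: du a p.
Proof. exact: null_codazzi nf. Qed.
Let cb p : U p -> dv b p = du r2 p *: b p + r2 p *: du b p.
Proof. exact: null_codazzi (null_frame_sym nf). Qed.

Local Notation L := (unit_null a).
Local Notation N := (unit_null b).
Local Notation La := (fun p => (null_speed a p)^-1 *: du L p).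
Local Notation K := (fun p => (null_speed b p)^-1 *: du N p).

Let derivable_g y v : V y -> derivable g y v.
Proof. by move=> Vy; apply: diff_derivable; exact: Ck_differentiable oV (Hg 1%N) Vy. Qed.

Let dsg y v : V y -> 'D_v (s \o g) y = v 0 0 + v 0 1.
Proof.
move=> Vy; rewrite (derive_congr v oV Vy sg).
exact: (@derive_val _ _ _ _ _ _ _ (derive_coord_sum y v)).
Qed.

Let dtg y v : V y -> 'D_v (t \o g) y = v 0 0 - v 0 1.
Proof.
move=> Vy; rewrite (derive_congr v oV Vy tg).
exact: (@derive_val _ _ _ _ _ _ _ (derive_coord_diff y v)).
Qed.

Let na p : U p -> null_speed a p != 0.
Proof. by move=> Up; rewrite gt_eqF // (null_speed_gt0 pa). Qed.
Let nb p : U p -> null_speed b p != 0.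
Proof. by move=> Up; rewrite gt_eqF // (null_speed_gt0 pb). Qed.

(** This is the chain rule for alpha'(s): along [v] the function s = u + v changes at the rate
    [v 0 0 + v 0 1], and [La] is alpha''. *)
Lemma pull_L y v : V y -> 'D_v (L \o g) y = (v 0 0 + v 0 1) *: La (g y).
Proof.
move=> Vy; have Ugy := VU Vy; have [sx sy] := ds Ugy.
rewrite -(dsg v Vy).
exact: (derive_null_comp (f := unit_null a) (s := s) (p := null_speed a) (r := r1) oU
  (unit_null_smooth oU Ha pa) Hs Ugy (@derivable_g y v Vy) sx sy (na Ugy)
  (unit_null_codazzi oU Ha H1 aa ca pa Ugy)).
Qed.

Lemma pull_N y v : V y -> 'D_v (N \o g) y = (v 0 0 - v 0 1) *: K (g y).
Proof.
move=> Vy; have Ugy := VU Vy; have [tx ty] := dt Ugy.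
rewrite -(dtg v Vy).
exact: (derive_null_comp (f := unit_null b) (s := t) (p := null_speed b) (r := r2) oU
  (unit_null_smooth oU Hb pb) Ht Ugy (@derivable_g y v Vy) tx ty (nb Ugy)
  (unit_null_codazzi oU Hb H2 bb cb pb Ugy)).
Qed.

(** One has a dx + r1 a dy = (a / p) (p dx + r1 p dy) = L ds, and similarly for [b], whence dw = L
    ds + N dt. *)
Lemma pull_w y v : V y ->
  'D_v (w \o g) y = (v 0 0 + v 0 1) *: L (g y) + (v 0 0 - v 0 1) *: N (g y).
Proof.
move=> Vy; have Ugy := VU Vy; have [sx sy] := ds Ugy; have [tx ty] := dt Ugy.
have Ew := derive_comp_plane oU Hw Ugy (@derivable_g y v Vy).
have [wx wy] : du w (g y) = a (g y) + b (g y) /\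
  dv w (g y) = r1 (g y) *: a (g y) + r2 (g y) *: b (g y) by case: nf => _ _ _ E _; exact: E.
have Es := derive_comp_planeR oU Hs Ugy (@derivable_g y v Vy).
have Et := derive_comp_planeR oU Ht Ugy (@derivable_g y v Vy).
rewrite (dsg v Vy) sx sy in Es; rewrite (dtg v Vy) tx ty in Et.
rewrite Ew wx wy Es Et /unit_null.
move: (('D_v g y) 0 0) (('D_v g y) 0 1) (na Ugy) (nb Ugy) => al be p0 q0.
move: (null_speed a _) (null_speed b _) p0 q0 (a (g y)) (b (g y)) (r1 (g y)) (r2 (g y)) =>
  p q p0 q0 A B r r'.
by apply/rowP => i; rewrite !mxE; field; rewrite p0 q0.
Qed.

Let Hwg : smooth_on V (w \o g). Proof. exact: smooth_comp oU oV VU Hw Hg. Qed.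
Let HLg : smooth_on V (L \o g).
Proof. exact: smooth_comp oU oV VU (unit_null_smooth oU Ha pa) Hg. Qed.
Let HNg : smooth_on V (N \o g).
Proof. exact: smooth_comp oU oV VU (unit_null_smooth oU Hb pb) Hg. Qed.

Let c0 : e0 0 0 + e0 0 1 = 1 :> R. Proof. by rewrite !mxE /= addr0. Qed.
Let d0 : e0 0 0 - e0 0 1 = 1 :> R. Proof. by rewrite !mxE /= subr0. Qed.
Let c1 : e1 0 0 + e1 0 1 = 1 :> R. Proof. by rewrite !mxE /= add0r. Qed.
Let d1 : e1 0 0 - e1 0 1 = -1 :> R. Proof. by rewrite !mxE /= add0r. Qed.

Let du_wg y : V y -> du (w \o g) y = (L \o g) y + (N \o g) y.
Proof. by move=> Vy; rewrite [LHS](pull_w e0 Vy) c0 d0 !scale1r. Qed.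

Let dv_wg y : V y -> dv (w \o g) y = (L \o g) y - (N \o g) y.
Proof. by move=> Vy; rewrite [LHS](pull_w e1 Vy) c1 d1 scale1r scaleN1r. Qed.

Lemma LN_lt0 p : U p -> mink (L p) (N p) < 0.
Proof.
move=> Up; rewrite /unit_null minkZl minkZr mulrA.
have ia : 0 < (null_speed a p)^-1 by rewrite invr_gt0; exact: (null_speed_gt0 pa).
have ib : 0 < (null_speed b p)^-1 by rewrite invr_gt0; exact: (null_speed_gt0 pb).
by rewrite (pmulr_rlt0 _ (mulr_gt0 ia ib)); exact: ab.
Qed.

Lemma pull_regular y : V y -> regular_at (w \o g) y.
Proof.
move=> Vy c; rewrite (pull_w c Vy) => H; have Ugy := VU Vy.
have [A B] := null_independent (unit_null_null aa Ugy) (unit_null_null bb Ugy) (LN_lt0 Ugy) H.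
apply: row2P; rewrite mxE; move: A B; move: (c 0 0) (c 0 1) => x y' A B; lra.
Qed.

Lemma pull_canonical y : V y -> timelike_at (w \o g) y -> ~ flat_point (w \o g) y ->
  exists a b n1 n2 nu mu,
    [/\ geometric_frame (w \o g) y a b n1 n2 nu mu,
      (exists l, du (w \o g) y = l *: 'D_a (w \o g) y) /\
      (exists l, dv (w \o g) y = l *: 'D_b (w \o g) y) &
      [/\ Defs.coefE (w \o g) y = - (Num.sqrt (mu ^+ 2 + nu ^+ 2))^-1, coefF (w \o g) y = 0
      & coefG (w \o g) y = (Num.sqrt (mu ^+ 2 + nu ^+ 2))^-1]].
Proof.
move=> Vy tw nfl; have Ugy := VU Vy.
have dL v : derivable (L \o g) y v.
  by apply: diff_derivable; exact: Ck_differentiable oV (HLg 1%N) Vy.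
have dN v : derivable (N \o g) y v.
  by apply: diff_derivable; exact: Ck_differentiable oV (HNg 1%N) Vy.
have Eu v : 'D_v (du (w \o g)) y = 'D_v (L \o g) y + 'D_v (N \o g) y.
  exact: (derive_sum_eq oV Vy du_wg (dL v) (dN v)).
have Ev v : 'D_v (dv (w \o g)) y = 'D_v (L \o g) y - 'D_v (N \o g) y.
  rewrite (derive_congr v oV Vy dv_wg).
  exact: (@derive_val _ _ _ _ _ _ _ (is_deriveB (derivableP (dL v)) (derivableP (dN v)))).
have Exx : du (du (w \o g)) y = La (g y) + K (g y).
  apply: (etrans (Eu e0) (etrans (congr2 (fun X Y => X + Y) (pull_L e0 Vy) (pull_N e0 Vy)) _)).
  exact: scale_eq1D c0 d0.
have Eyx : dv (du (w \o g)) y = La (g y) - K (g y).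
  apply: (etrans (Eu e1) (etrans (congr2 (fun X Y => X + Y) (pull_L e1 Vy) (pull_N e1 Vy)) _)).
  by rewrite c1 d1 scale1r scaleN1r.
have Exy : du (dv (w \o g)) y = La (g y) - K (g y).
  apply: (etrans (Ev e0) (etrans (congr2 (fun X Y => X - Y) (pull_L e0 Vy) (pull_N e0 Vy)) _)).
  exact: scale_eq1B c0 d0.
have Eyy : dv (dv (w \o g)) y = La (g y) + K (g y).
  apply: (etrans (Ev e1) (etrans (congr2 (fun X Y => X - Y) (pull_L e1 Vy) (pull_N e1 Vy)) _)).
  by rewrite c1 d1 scale1r scaleN1r opprK.
have [LaL LaLa] := unit_null_accel oU Ha aa pa Ugy.
have [KN KK] := unit_null_accel oU Hb bb pb Ugy.
have LaL' : mink (La (g y)) (L (g y)) = 0 by rewrite minkZl minkC LaL mulr0.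
have KN' : mink (K (g y)) (N (g y)) = 0 by rewrite minkZl minkC KN mulr0.
exact: (canonical_frame oV Vy Hwg (du_wg Vy) (dv_wg Vy) Exx Exy Eyx Eyy tw nfl
  (unit_null_null aa Ugy) (unit_null_null bb Ugy) (LN_lt0 Ugy) LaL' KN' LaLa KK
  erefl erefl erefl erefl erefl).
Qed.

End PullBack.

Lemma null_frame_sub U B w a b r1 r2 : B `<=` U -> null_frame U w a b r1 r2 ->
  null_frame B w a b r1 r2.
Proof.
move=> BU [Hw [Ha Hb] [H1 H2] E F].
have S (X : normedModType R) (f : plane -> X) : smooth_on U f -> smooth_on B f.
  by move=> Hf k; exact: Ck_sub BU (Hf k).
split; [exact: S|by split; exact: S|by split; exact: S|..].
  by move=> p /BU; exact: E.
by move=> p /BU; exact: F.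
Qed.

Lemma exists_null_coordinate U (a : plane -> 'rV[R]_4) (r : plane -> R) (q : plane) :
  open U -> U q -> smooth_on U a -> smooth_on U r ->
  (forall p, U p -> mink (a p) (a p) = 0) ->
  (forall p, U p -> dv a p = du r p *: a p + r p *: du a p) ->
  (forall p, U p -> 0 < mink (du a p) (du a p)) ->
  exists B (s : plane -> R), [/\ open B, B q, B `<=` U, smooth_on B s &
    forall p, B p -> du s p = null_speed a p /\ dv s p = r p * null_speed a p].
Proof.
move=> oU Uq Ha Hr aa ca pa.
have Hp := null_speed_smooth oU Ha pa.
have Hrp k := CkM oU (Hr k) (Hp k).
have closed p : U p -> dv (null_speed a) p = du (fun p => r p * null_speed a p) p.
  move=> Up; rewrite (null_speed_closed oU Ha Hr aa ca pa Up).
  have D := is_deriveM (derivableP (Ck_derivable0 (Hr 1%N) Up)) (derivableP (Ck_derivable0 (Hp 1%N) Up)).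
  rewrite [RHS](@derive_val _ _ _ _ _ _ _ D) addrC; congr (_ + _); exact: mulrC.
have [e [s [e_gt0 eU D]]] := Poincare oU Uq (Hp 1%N) (Hrp 2%N) closed.
have oB : open (ball q e) by exact: ball_open.
exists (ball q e), s; split=> //; first exact: ballxx.
  apply: (smooth_of_gradient oB D) => k; [exact: Ck_sub eU (Hp k)|exact: Ck_sub eU (Hrp k)].
by move=> p /D[D0 D1]; split; [exact: (@derive_val _ _ _ _ _ _ _ D0)|exact: (@derive_val _ _ _ _ _ _ _ D1)].
Qed.

(** In terms of 2-forms, du dv = -(1/2) ds dt; where it is applied, the distinct roots [r] and [r']
    make it nonzero. *)
Lemma jac_half_sum_diff (u v : plane -> R) q A B r r' :
  du u q = 2^-1 * (A + B) -> dv u q = 2^-1 * (r * A + r' * B) ->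
  du v q = 2^-1 * (A - B) -> dv v q = 2^-1 * (r * A - r' * B) ->
  jac u v q = 2^-1 * ((r - r') * A * B).
Proof. by rewrite /jac => -> -> -> ->; field. Qed.

(** The frame is promised conditionally: timelikeness and absence of flat points for [w \o g] become
    available once [g] is known to yield a local parametrization, and the other conclusions serve to
    show that. *)
Lemma canonical_coordinates U (w : plane -> 'rV[R]_4) (q : plane) :
  open U -> U q -> smooth_on U w ->
  (forall p, U p -> timelike_at w p) -> (forall p, U p -> zero_mean_curvature_at w p) ->
  (forall p, U p -> ~ flat_point w p) -> (forall p, U p -> mink (du w p) (du w p) < 0) ->
  exists (W V : set plane) (g Psi : plane -> plane),
  [/\ [/\ open W, W q, W `<=` U & forall p, W p -> {for p, continuous Psi}],
      open V /\ smooth_on V g,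
      forall y, V y -> W (g y) /\ Psi (g y) = y,
      forall p, W p -> V (Psi p) /\ g (Psi p) = p &
      forall y, V y -> regular_at (w \o g) y /\
        (timelike_at (w \o g) y -> ~ flat_point (w \o g) y ->
        exists a b n1 n2 nu mu,
        [/\ geometric_frame (w \o g) y a b n1 n2 nu mu,
        (exists l, du (w \o g) y = l *: 'D_a (w \o g) y) /\
        (exists l, dv (w \o g) y = l *: 'D_b (w \o g) y) &
        [/\ Defs.coefE (w \o g) y = - (Num.sqrt (mu ^+ 2 + nu ^+ 2))^-1, coefF (w \o g) y = 0
        & coefG (w \o g) y = (Num.sqrt (mu ^+ 2 + nu ^+ 2))^-1]])].
Proof.
move=> oU Uq Hw tw hw nfl E0.
have [a [b [r1 [r2 [nf ab]]]]] := exists_null_frame oU Hw tw hw E0.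
have nf' := null_frame_sym nf.
have pa p (Up : U p) := null_accel_gt0 oU nf Up (tw p Up) (nfl p Up).
have pb p (Up : U p) := null_accel_gt0 oU nf' Up (tw p Up) (nfl p Up).
have [_ [Ha Hb] [H1 H2] _ F] := nf.
have aa p : U p -> mink (a p) (a p) = 0 by move=> /F[].
have bb p : U p -> mink (b p) (b p) = 0 by move=> /F[].
have r12 p : U p -> r1 p != r2 p by move=> /F[].
have ca p (Up : U p) := null_codazzi oU nf Up.
have cb p (Up : U p) := null_codazzi oU nf' Up.
have [B1 [s [oB1 B1q B1U Hs ds]]] := exists_null_coordinate oU Uq Ha H1 aa ca pa.
have [B2 [t [oB2 B2q B2U Ht dt]]] := exists_null_coordinate oU Uq Hb H2 bb cb pb.
pose B := B1 `&` B2.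
have oB : open B by exact: openI.
have Bq : B q by [].
have Hs' : smooth_on B s by move=> k; apply: Ck_sub (Hs k) => p [].
have Ht' : smooth_on B t by move=> k; apply: Ck_sub (Ht k) => p [].
pose u p := 2^-1 * (s p + t p); pose v p := 2^-1 * (s p - t p).
have Hu : smooth_on B u.
  move=> k; exact: (CkM oB (Ck_cst k B (2^-1 : R)) (CkD oB (Hs' k) (Ht' k))).
have Hv : smooth_on B v.
  move=> k; exact: (CkM oB (Ck_cst k B (2^-1 : R)) (CkB oB (Hs' k) (Ht' k))).
have Jq : jac u v q != 0.
  have [sx sy] := ds q B1q; have [tx ty] := dt q B2q.
  have Du c (Hc : c = e0 \/ c = e1) : 'D_c u q = 2^-1 * ('D_c s q + 'D_c t q).
    exact: (@derive_val _ _ _ _ _ _ _ (is_deriveZ 2^-1 (is_deriveD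
      (derivableP (Ck_derivable (Hs 1%N) B1q Hc)) (derivableP (Ck_derivable (Ht 1%N) B2q Hc))))).
  have Dv c (Hc : c = e0 \/ c = e1) : 'D_c v q = 2^-1 * ('D_c s q - 'D_c t q).
    exact: (@derive_val _ _ _ _ _ _ _ (is_deriveZ 2^-1 (is_deriveB
      (derivableP (Ck_derivable (Hs 1%N) B1q Hc)) (derivableP (Ck_derivable (Ht 1%N) B2q Hc))))).
  have ux : du u q = 2^-1 * (null_speed a q + null_speed b q).
    by rewrite -sx -tx; apply: Du; left.
  have uy : dv u q = 2^-1 * (r1 q * null_speed a q + r2 q * null_speed b q).
    by rewrite -sy -ty; apply: Du; right.
  have vx : du v q = 2^-1 * (null_speed a q - null_speed b q).
    by rewrite -sx -tx; apply: Dv; left.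
  have vy : dv v q = 2^-1 * (r1 q * null_speed a q - r2 q * null_speed b q).
    by rewrite -sy -ty; apply: Dv; right.
  rewrite (jac_half_sum_diff ux uy vx vy).
  have na : null_speed a q != 0 by rewrite gt_eqF //; exact: (null_speed_gt0 pa).
  have nb : null_speed b q != 0 by rewrite gt_eqF //; exact: (null_speed_gt0 pb).
  have r0 : r1 q - r2 q != 0 by rewrite subr_eq0; exact: r12.
  have h2 : 2^-1 != 0 :> R by rewrite invr_eq0 pnatr_eq0.
  exact: (mulf_neq0 h2 (mulf_neq0 (mulf_neq0 r0 na) nb)).
have [W [V [g [[oW Wq WB _] [oV Hg] gV gW]]]] := inverse_function oB Bq Hu Hv Jq.
have WU : W `<=` U by move=> p /WB[/B1U].
have cPsi p : W p -> {for p, continuous (fun p => pt (u p) (v p))}.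
  move=> /WB Bp; apply: (@Ck_continuous _ _ 0%N B) Bp.
  exact: (CkD oB (CkZ oB (Hu 0%N) (Ck_cst 0 B e0)) (CkZ oB (Hv 0%N) (Ck_cst 0 B e1))).
exists W, V, g, (fun p => pt (u p) (v p)).
split; [exact: And4 oW Wq WU cPsi|exact: conj oV Hg|exact: gV|exact: gW|].
have BU : B `<=` U by move=> p [/B1U].
have VB y : V y -> B (g y) by move=> /gV[/WB].
have ug y : V y -> u (g y) = y 0 0.
  by move=> /gV[_ E]; rewrite -[in RHS]E pt0.
have vg y : V y -> v (g y) = y 0 1.
  by move=> /gV[_ E]; rewrite -[in RHS]E pt1.
have sg y : V y -> s (g y) = y 0 0 + y 0 1.
  by move=> Vy; rewrite -(ug y Vy) -(vg y Vy) /u /v; field.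
have tg y : V y -> t (g y) = y 0 0 - y 0 1.
  by move=> Vy; rewrite -(ug y Vy) -(vg y Vy) /u /v; field.
have nfB := null_frame_sub BU nf.
have abB p (Bp : B p) := ab p (BU p Bp).
have paB p (Bp : B p) := pa p (BU p Bp).
have pbB p (Bp : B p) := pb p (BU p Bp).
have dsB p (Bp : B p) := ds p Bp.1.
have dtB p (Bp : B p) := dt p Bp.2.
move=> y Vy; split.
  exact: (pull_regular oB oV VB Hg nfB abB paB pbB Hs' Ht' dsB dtB sg tg Vy).
exact: (pull_canonical oB oV VB Hg nfB abB paB pbB Hs' Ht' dsB dtB sg tg Vy).
Qed.

End CanonicalCoordinates.

(** * Changes of parameters on the surface *)

Section Reparametrization.
Context {R : realType} {M : topologicalType}.
Local Notation e0 := (delta_mx 0 0 : 'rV[R]_2).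
Local Notation e1 := (delta_mx 0 1 : 'rV[R]_2).
Local Notation plane := 'rV[R]_2.
Variable z : M -> 'rV[R]_4.
Implicit Types (U : set plane).

(** The continuous inverse [Psi] supplies openness: the image of V' under [g] is the part of its
    preimage under [Psi] that lies in [W]. *)
Lemma local_parametrization_comp U W V (phi : plane -> M) (g Psi : plane -> plane) :
  local_parametrization z U phi -> open W -> W `<=` U -> open V -> smooth_on V g ->
  (forall p, W p -> {for p, continuous Psi}) ->
  (forall y, V y -> W (g y) /\ Psi (g y) = y) ->
  (forall p, W p -> V (Psi p) /\ g (Psi p) = p) ->
  (forall y, V y -> regular_at (z \o (phi \o g)) y) ->
  local_parametrization z V (phi \o g).
Proof.
move=> [oU [cphi iphi] ophi Hw _] oW WU oV Hg cPsi gV gW reg.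
have VU y : V y -> U (g y) by move=> /gV[/WU].
split; [exact: oV| | | |exact: reg].
- split.
    move=> y; rewrite inE => Vy; apply: continuous_comp.
      exact: Ck_continuous (Hg 0%N) Vy.
    by apply: cphi; rewrite inE; exact: VU.
  move=> y y'; rewrite !inE => Vy Vy' E.
  have [_ <-] := gV y Vy; have [_ <-] := gV y' Vy'.
  by congr Psi; apply: iphi E; rewrite inE; exact: VU.
- move=> V' V'V oV'.
  have -> : (phi \o g) @` V' = phi @` (g @` V') by rewrite image_comp.
  have E : g @` V' = W `&` Psi @^-1` V'.
    rewrite eqEsubset; split=> [_ [y V'y <-]|p [Wp V'p]].
      by have [Wgy E] := gV y (V'V y V'y); split=> //; rewrite /= E.
    by have [_ E] := gW p Wp; exists (Psi p).
  have oE : open (g @` V').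
    rewrite E openE => p [Wp V'p]; apply: filterI; first exact: near_open oW Wp.
    exact: (cPsi p Wp _ (near_open oV' V'p)).
  by apply: ophi oE => _ [y V'y <-]; apply: VU; exact: V'V.
- move=> k; exact: (Ck_comp_row oU oV VU (Hw k) (Hg k)).
Qed.

Lemma coord_smooth U i : open U -> smooth_on U (fun y : plane => y 0 i).
Proof.
move=> oU; apply: (smooth_of_gradient oU (P := fun=> e0 0 i) (Q := fun=> e1 0 i)).
- by move=> y _; split; exact: is_derive_coord.
- by move=> k; exact: Ck_cst.
- by move=> k; exact: Ck_cst.
Qed.

Lemma is_derive_pt (y v : plane) (s t : plane -> R) ds dt :
  is_derive y v s ds -> is_derive y v t dt ->
  is_derive y v (fun p => pt (s p) (t p)) (pt ds dt).
Proof.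
move=> Ds Dt.
have D := is_deriveD (is_derive_scale (@ex_derive _ _ _ _ _ _ _ Ds) (derivable_cst e0 y v))
  (is_derive_scale (@ex_derive _ _ _ _ _ _ _ Dt) (derivable_cst e1 y v)).
split; first exact: (@ex_derive _ _ _ _ _ _ _ D).
rewrite [LHS](@derive_val _ _ _ _ _ _ _ D) !derive_cst !scaler0 !addr0.
by rewrite (@derive_val _ _ _ _ _ _ _ Ds) (@derive_val _ _ _ _ _ _ _ Dt).
Qed.

Lemma is_derive_affine (y v : plane) (k l m : R) :
  is_derive y v (fun p : plane => m + (k * p 0 0 + l * p 0 1)) (k * v 0 0 + l * v 0 1).
Proof.
have D := is_deriveD (is_derive_cst m y v)
  (is_deriveD (is_deriveZ k (is_derive_coord y v 0)) (is_deriveZ l (is_derive_coord y v 1))).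
rewrite add0r in D; exact: D.
Qed.

(** In complex notation this is q + a y, with inverse (p - q) / a. The linear part sends the first
    coordinate vector to [a] and has determinant |a|^2, nonzero whenever [a] is, so no second basis
    vector has to be chosen. *)
Definition similarity (q a y : plane) : plane :=
  pt (q 0 0 + (a 0 0 * y 0 0 + - a 0 1 * y 0 1))
     (q 0 1 + (a 0 1 * y 0 0 + a 0 0 * y 0 1)).

Definition similarity_inv (q a p : plane) : plane :=
  let n := a 0 0 ^+ 2 + a 0 1 ^+ 2 in
  pt (- (a 0 0 * q 0 0 + a 0 1 * q 0 1) / n + (a 0 0 / n * p 0 0 + a 0 1 / n * p 0 1))
     ((a 0 1 * q 0 0 - a 0 0 * q 0 1) / n + (- a 0 1 / n * p 0 0 + a 0 0 / n * p 0 1)).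

Lemma sqr_sum_neq0 (a : plane) : a != 0 -> a 0 0 ^+ 2 + a 0 1 ^+ 2 != 0.
Proof.
move=> a0; rewrite paddr_eq0 ?sqr_ge0 // !sqrf_eq0.
apply: contra a0 => /andP[/eqP h0 /eqP h1]; apply/eqP.
by apply: row2P; rewrite mxE.
Qed.

Lemma similarityK q a : a != 0 -> cancel (similarity q a) (similarity_inv q a).
Proof.
move=> /sqr_sum_neq0 n0 y; rewrite /similarity /similarity_inv pt0 pt1.
move: (a 0 0) (a 0 1) (q 0 0) (q 0 1) n0 => a0 a1 q0 q1 n0.
by apply: row2P; rewrite ?pt0 ?pt1; field.
Qed.

Lemma similarity_invK q a : a != 0 -> cancel (similarity_inv q a) (similarity q a).
Proof.
move=> /sqr_sum_neq0 n0 y; rewrite /similarity /similarity_inv pt0 pt1.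
move: (a 0 0) (a 0 1) n0 => a0 a1 n0.
by apply: row2P; rewrite ?pt0 ?pt1; field.
Qed.

Lemma similarity0 q a : similarity q a 0 = q.
Proof. by apply: row2P; rewrite /similarity ?pt0 ?pt1 !mxE !mulr0 !addr0. Qed.

Lemma affine_smooth U k l m : open U ->
  smooth_on U (fun p : plane => m + (k * p 0 0 + l * p 0 1)).
Proof.
move=> oU j; exact: (CkD oU (Ck_cst j U m) (CkD oU (CkM oU (Ck_cst j U k) (coord_smooth 0 oU j))
  (CkM oU (Ck_cst j U l) (coord_smooth 1 oU j)))).
Qed.

Lemma smooth_pt U (s t : plane -> R) : open U -> smooth_on U s -> smooth_on U t ->
  smooth_on U (fun p => pt (s p) (t p)).
Proof.
by move=> oU Hs Ht k; exact: (CkD oU (CkZ oU (Hs k) (Ck_cst k U e0)) (CkZ oU (Ht k) (Ck_cst k U e1))).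
Qed.

Lemma similarity_smooth U q a : open U -> smooth_on U (similarity q a).
Proof. by move=> oU; apply: smooth_pt => //; exact: affine_smooth. Qed.

Lemma is_derive_similarity q a y v :
  is_derive y v (similarity q a)
    (pt (a 0 0 * v 0 0 + - a 0 1 * v 0 1) (a 0 1 * v 0 0 + a 0 0 * v 0 1)).
Proof. apply: is_derive_pt; exact: is_derive_affine. Qed.

Lemma similarity_inv_continuous q a p : {for p, continuous (similarity_inv q a)}.
Proof.
have oT : open (setT : set plane) by exact: openT.
by apply: (@Ck_continuous _ _ 0%N setT) => //; apply: smooth_pt => //; exact: affine_smooth.
Qed.

(** Null frames are built with a timelike first coordinate vector. A timelike surface provides some
    timelike direction [a] at the point, and the similarity turns it into the first coordinate
    direction. *)
Lemma timelike_parametrization (hM : smooth_surface z) (ht : timelike z) (m : M) :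
  exists U phi q, [/\ local_parametrization z U phi, U q, phi q = m &
    mink (du (z \o phi) q) (du (z \o phi) q) < 0].
Proof.
have [_ _ /(_ m)[U [phi [lp [q Uq qm]]]]] := hM.
have [oU _ _ Hw reg] := lp.
have [a [b [aa _ _]]] := ht U phi lp q Uq.
have dw p : U p -> differentiable (z \o phi) p by exact: Ck_differentiable oU (Hw 1%N).
have a0 : a != 0.
  by apply/eqP => a0; move: aa; rewrite a0 derive0 mink0l => /eqP; rewrite eq_sym oppr_eq0 oner_eq0.
pose g := similarity q a.
have oT : open (setT : set plane) by exact: openT.
have HgT : smooth_on setT g by exact: similarity_smooth.
pose V := g @^-1` U.
have oV : open V.
  apply: open_comp oU => p _; exact: Ck_continuous (HgT 0%N) _.
have Hg : smooth_on V g by move=> k; apply: Ck_sub (HgT k).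
have Dwg y v : V y -> 'D_v (z \o (phi \o g)) y =
    'D_(pt (a 0 0 * v 0 0 + - a 0 1 * v 0 1) (a 0 1 * v 0 0 + a 0 0 * v 0 1)) (z \o phi) (g y).
  move=> Vy; have Dg := is_derive_similarity q a y v.
  have := is_derive_comp_diff (dw _ Vy) (@ex_derive _ _ _ _ _ _ _ Dg).
  rewrite (@derive_val _ _ _ _ _ _ _ Dg) -deriveE; last exact: dw.
  by move=> D; rewrite [LHS](@derive_val _ _ _ _ _ _ _ D).
exists V, (phi \o g), 0; split.
- apply: (local_parametrization_comp (W := U) (Psi := similarity_inv q a) lp oU _ oV Hg).
  + exact: subset_refl.
  + by move=> p _; exact: similarity_inv_continuous.
  + by move=> y Vy; split=> //; exact: similarityK.
  + by move=> p Up; rewrite /V /= /g similarity_invK.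
  + move=> y Vy c; rewrite (Dwg y c Vy) => /(reg _ Vy) H.
    have n0 := sqr_sum_neq0 a0.
    have H0 := congr1 (fun h : plane => h 0 0) H; have H1 := congr1 (fun h : plane => h 0 1) H.
    rewrite pt0 mxE in H0; rewrite pt1 mxE in H1.
    move: (a 0 0) (a 0 1) n0 H0 H1 => x y' n0 H0 H1.
    apply: row2P; rewrite mxE; apply: (mulfI n0); rewrite mulr0.
      transitivity (x * (x * c 0 0 + - y' * c 0 1) + y' * (y' * c 0 0 + x * c 0 1)); first by ring.
      by rewrite H0 H1 !mulr0 addr0.
    transitivity (x * (y' * c 0 0 + x * c 0 1) - y' * (x * c 0 0 + - y' * c 0 1)); first by ring.
    by rewrite H0 H1 !mulr0 subr0.
- by rewrite /V /= /g similarity0.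
- by rewrite /= /g similarity0.
- have V0 : V 0 by rewrite /V /= /g similarity0.
  have -> : du (z \o (phi \o g)) 0 = 'D_a (z \o phi) q.
    rewrite [LHS](Dwg 0 e0 V0) /g similarity0; congr ('D__ _ _).
    by apply: row2P; rewrite ?pt0 ?pt1 !mxE /= !mulr1 !mulr0 addr0.
  by rewrite aa ltrN10.
Qed.

End Reparametrization.

Theorem theorem3p4 (R : realType) (M : topologicalType) (z : M -> 'rV[R]_4)
  (hM : smooth_surface z) (ht : timelike z) (hH : zero_mean_curvature z)
  (hflat : free_of_flat_points z) :
  forall p : M, exists (U : set 'rV[R]_2) (phi : 'rV[R]_2 -> M),
    [/\ local_parametrization z U phi, (phi @` U) p
      & canonical_parameters U (z \o phi)].
Proof.
move=> m; have [U0 [phi [q [lp U0q qm E0]]]] := timelike_parametrization hM ht m.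
have [oU0 _ _ Hw0 _] := lp.
pose E p := mink (du (z \o phi) p) (du (z \o phi) p).
have cE := Ck_continuous (Ck_mink oU0 (Ck_du (Hw0 1%N)) (Ck_du (Hw0 1%N))) U0q.
(* As long as E varies by at most half of its absolute value at [q], it stays negative. *)
have mE : 0 < - E q / 2 by rewrite divr_gt0 // oppr_gt0.
have /nbhs_ballP[r /= r0 Hr] : \forall p \near q, U0 p /\ `|E q - E p| <= - E q / 2.
  exact: filterI (near_open oU0 U0q) (continuous_near_le cE mE).
pose U := ball q r.
have oU : open U by exact: ball_open.
have UU0 : U `<=` U0 by move=> p /Hr[].
have EU p : U p -> E p < 0.
  move=> /Hr[_]; move: E0; rewrite -/(E q) => E0; rewrite ler_norml => /andP[A _].
  by move: A E0; move: (E p) (E q) => x y; lra.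
have Hw : smooth_on U (z \o phi) by move=> k; exact: Ck_sub UU0 (Hw0 k).
have [W [V [g [Psi [[oW Wq WU cPsi] [oV Hg] gV gW can]]]]] :=
  canonical_coordinates oU (ballxx q r0) Hw (fun p Up => ht U0 phi lp p (UU0 p Up))
    (fun p Up => hH U0 phi lp p (UU0 p Up)) (fun p Up => hflat U0 phi lp p (UU0 p Up)) EU.
have lp' : local_parametrization z V (phi \o g).
  apply: (local_parametrization_comp lp oW (subset_trans WU UU0) oV Hg cPsi gV gW).
  by move=> y /can[].
(* The hypotheses on the surface are now applied to the new parametrization. *)
have frame y (Vy : V y) := (can y Vy).2 (ht V (phi \o g) lp' y Vy) (hflat V (phi \o g) lp' y Vy).
exists V, (phi \o g); split=> //.
  by have [VPq gPq] := gW q Wq; exists (Psi q) => //=; rewrite gPq.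
split=> y /frame [a [b [n1 [n2 [nu [mu [gf [l1 l2] EFG]]]]]]].
  exists a, b, n1, n2, nu, mu; exact: And3 gf l1 l2.
exists a, b, n1, n2, nu, mu; exact: conj gf EFG.
Qed.
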